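(* Let $M$ be a smooth manifold, let $L<(T\oplus T^* )\otimes\mathbb{C}$ be an almost Dirac structure (a maximal isotropic sub-bundle), and let $U<\wedge^\bullet T^*\otimes\mathbb{C}$ be the associated pure spinor line bundle. Then $L$ is Courant involutive if and only if the exterior derivative $d$ satisfies $d(C^\infty(U_0))\subset C^\infty(U_1)$. That is, $L$ is involutive if and only if, for any local trivialization $\rho$ of $U$, there exists a section $X+\xi\in C^\infty((T\oplus T^* )\otimes\mathbb{C})$ (over the domain of $\rho$) such that $$d\rho=i_X\rho+\xi\wedge\rho.$$
   Context: $T\oplus T^*$ carries the inner product $\langle X+\xi,Y+\eta\rangle=\frac12(\xi(Y)+\eta(X))$ and the Courant bracket $[X+\xi,Y+\eta]=[X,Y]+\mathcal{L}_X\eta-\mathcal{L}_Y\xi-\frac12 d(i_X\eta-i_Y\xi)$, both extended complex linearly. Involutive means that smooth sections are closed under the Courant bracket. The Clifford action on differential forms is $(X+\xi)\cdot\rho=i_X\rho+\xi\wedge\rho$. The pure spinor line bundle $U$ of $L$ is the unique complex line sub-bundle of $\wedge^\bullet T^*\otimes\mathbb{C}$ such that $L=\{v\in(T\oplus T^* )\otimes\mathbb{C} : v\cdot U=0\}$. One puts $U_0=U$, and $U_1=((T\oplus T^* )\otimes\mathbb{C})\cdot U$ is the bundle of Clifford products of elements of $(T\oplus T^* )\otimes\mathbb{C}$ with elements of $U$. *)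

(* Defs.v *)
From HB Require Import structures.
From mathcomp Require Import all_boot all_order all_algebra.
From mathcomp Require Import all_classical all_reals all_analysis.
From mathcomp Require Import complex.
Set Implicit Arguments.
Unset Strict Implicit.
Unset Printing Implicit Defensive.
Import Order.TTheory GRing.Theory Num.Theory.
Import numFieldNormedType.Exports.
Local Open Scope classical_set_scope.
Local Open Scope complex_scope.
Local Open Scope ring_scope.

(** * Smooth functions on open subsets of R^n *)

Section Smooth.
Context {R : realType}.

Fixpoint iter_derive (V W : normedModType R) (f : V -> W) (s : seq V) : V -> W :=
  if s is v :: s' then 'D_v (iter_derive f s') else f.

(* C^oo on A, for A open: every iterated directional derivative exists and is
   differentiable at every point of A. *)
Definition smooth_on (V W : normedModType R) (A : set V) (f : V -> W) : Prop :=
  forall (s : seq V) (x : V), A x -> differentiable (iter_derive f s) x.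

(* R[i] is not a normed space over R in the library, so that complex-valued
   functions are differentiated through their real and imaginary parts. *)
Definition csmooth_on (V : normedModType R) (A : set V) (f : V -> R[i]) : Prop :=
  smooth_on A (fun x => complex.Re (f x) : R^o) /\
  smooth_on A (fun x => complex.Im (f x) : R^o).

Definition cpartial n (j : 'I_n) (f : 'rV[R]_n -> R[i]) (x : 'rV[R]_n) : R[i] :=
  'D_(delta_mx 0 j) (fun y => complex.Re (f y) : R^o) x +i*
  'D_(delta_mx 0 j) (fun y => complex.Im (f y) : R^o) x.

End Smooth.

(** * Linear algebra of V (+) V^* and of the exterior algebra, V = C^n *)

Section LinearAlgebra.
Context {R : realType} {n : nat}.
Local Notation C := R[i].

(* X + xi is the pair (X, xi); X has its coordinates in the basis d/dx_j and
   xi in the dual basis dx_j. *)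
Definition gtangent : Type := ('rV[C]_n * 'rV[C]_n)%type.

(* The exterior algebra of V^*: the coordinate indexed by S = {j1 < ... < jk}
   is the coefficient of dx_j1 /\ ... /\ dx_jk. *)
Definition forms : Type := {ffun {set 'I_n} -> C^o}.

Definition pairing (X xi : 'rV[C]_n) : C := \sum_j xi 0 j * X 0 j.

Definition inner (u v : gtangent) : C :=
  2^-1 * (pairing v.1 u.2 + pairing u.1 v.2).

(* dx_j /\ dx_S = sign_before j S * dx_(j |: S) when j is not in S. *)
Definition sign_before (j : 'I_n) (S : {set 'I_n}) : C :=
  (-1) ^+ #|[set i in S | (i < j)%N]|.

Definition interior_product (X : 'rV[C]_n) (w : forms) : forms :=
  [ffun S : {set 'I_n} =>
    \sum_(j | j \notin S) X 0 j * sign_before j S * w (j |: S)%SET].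

Definition wedge1 (xi : 'rV[C]_n) (w : forms) : forms :=
  [ffun S : {set 'I_n} =>
    \sum_(j in S) xi 0 j * sign_before j S * w (S :\ j)%SET].

Definition clifford (v : gtangent) (w : forms) : forms :=
  interior_product v.1 w + wedge1 v.2 w.

Definition form1 : forms := [ffun S : {set 'I_n} => (S == finset.set0)%:R].

(* The algebra morphism that sends dx_j to \sum_i K i j * dx_i. *)
Definition pullback (K : 'M[C]_n) (w : forms) : forms :=
  \sum_(S : {set 'I_n})
    (w S : C) *: foldr (fun j a => wedge1 (col j K)^T a) form1 (enum S).

Definition isotropic (L : {vspace gtangent}) : Prop :=
  forall u v, u \in L -> v \in L -> inner u v = 0.

Definition maximal_isotropic (L : {vspace gtangent}) : Prop :=
  isotropic L /\
  forall L' : {vspace gtangent}, isotropic L' -> (L <= L')%VS -> L' = L.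

End LinearAlgebra.
Arguments gtangent : clear implicits.
Arguments forms : clear implicits.

(** * Tensor calculus in the coordinates x_1, ..., x_n of R^n *)

Section Coordinates.
Context {R : realType} {n : nat}.
Local Notation C := R[i].
Local Notation E := 'rV[R]_n.
Implicit Types (X Y xi eta : E -> 'rV[C]_n) (x : E).

Definition gradient (f : E -> C) x : 'rV[C]_n := \row_i cpartial i f x.

Definition lie_bracket X Y x : 'rV[C]_n :=
  \row_i \sum_j (X x 0 j * cpartial j (fun y => Y y 0 i) x
               - Y x 0 j * cpartial j (fun y => X y 0 i) x).

Definition lie_derivative X eta x : 'rV[C]_n :=
  \row_i \sum_j (X x 0 j * cpartial j (fun y => eta y 0 i) x
               + eta x 0 j * cpartial i (fun y => X y 0 j) x).

Definition courant_coord (A B : E -> gtangent R n) x : gtangent R n :=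
  let X y := (A y).1 in let xi y := (A y).2 in
  let Y y := (B y).1 in let eta y := (B y).2 in
  (lie_bracket X Y x,
   lie_derivative X eta x - lie_derivative Y xi x
   - 2^-1 *: gradient (fun y => pairing (X y) (eta y) - pairing (Y y) (xi y)) x).

(* d w = \sum_j dx_j /\ (dw/dx_j). *)
Definition ext_d_coord (w : E -> forms R n) x : forms R n :=
  \sum_j wedge1 (delta_mx 0 j)
    [ffun S : {set 'I_n} => cpartial j (fun y => w y S : C) x].

End Coordinates.

(** * Smooth manifolds *)

(* chart_map is meaningful on chart_dom only, and chart_inv on the image of
   chart_dom only. *)
Record chart (R : realType) (n : nat) (M : topologicalType) := Chart {
  chart_dom : set M;
  chart_map : M -> 'rV[R]_n;
  chart_inv : 'rV[R]_n -> M;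
  chart_dom_open : open chart_dom;
  chart_img_open : open (chart_map @` chart_dom);
  chart_mapK : forall p, chart_dom p -> chart_inv (chart_map p) = p;
  chart_map_continuous : {within chart_dom, continuous chart_map};
  chart_inv_continuous :
    {within chart_map @` chart_dom, continuous chart_inv} }.

Definition transition R n M (a b : chart R n M) : 'rV[R]_n -> 'rV[R]_n :=
  chart_map b \o chart_inv a.

(* chart_at selects a chart of the atlas around each point. The fibre at p of
   each natural bundle is written in the coordinates of chart_at p, and other
   charts are reached through the Jacobian matrices of the transition maps. *)
Record smoothManifold (R : realType) (n : nat) := SmoothManifold {
  manifold_space :> topologicalType;
  manifold_hausdorff : hausdorff_space manifold_space;
  manifold_second_countable : @second_countable manifold_space;
  atlas : set (chart R n manifold_space);
  chart_at : manifold_space -> chart R n manifold_space;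
  chart_at_atlas : forall p, atlas (chart_at p);
  chart_at_dom : forall p, chart_dom (chart_at p) p;
  atlas_compatible : forall a b, atlas a -> atlas b ->
    smooth_on (chart_map a @` (chart_dom a `&` chart_dom b)) (transition a b) }.

Section Bundles.
Context {R : realType} {n : nat} {M : smoothManifold R n}.
Local Notation C := R[i].

(* The complexified Jacobian matrix at p of the change of coordinates from a
   to b; the library's jacobian acts on row vectors from the right. *)
Definition jac (a b : chart R n M) (p : M) : 'M[C]_n :=
  map_mx (fun r : R => r%:C) (jacobian (transition a b) (chart_map a p)).

(* Change of coordinates from a to b in the fibres at p: tangent vectors are
   pushed forward along the transition from a to b, covectors and forms are
   pulled back along the transition from b to a. *)
Definition gtangent_change (a b : chart R n M) (p : M) (v : gtangent R n) :
    gtangent R n :=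
  (v.1 *m jac a b p, v.2 *m (jac b a p)^T).

Definition forms_change (a b : chart R n M) (p : M) (w : forms R n) :
    forms R n :=
  pullback (jac b a p) w.

(* The coordinate expression in the chart c of a section s. *)
Definition gtangent_in (c : chart R n M) (s : M -> gtangent R n)
    (x : 'rV[R]_n) : gtangent R n :=
  let p := chart_inv c x in gtangent_change (chart_at p) c p (s p).

Definition forms_in (c : chart R n M) (s : M -> forms R n)
    (x : 'rV[R]_n) : forms R n :=
  let p := chart_inv c x in forms_change (chart_at p) c p (s p).

(* Smooth sections over the open set W; values outside W are irrelevant. *)
Definition gtangent_smooth (W : set M) (s : M -> gtangent R n) : Prop :=
  forall c, atlas c -> forall j : 'I_n,
    csmooth_on (chart_map c @` (W `&` chart_dom c))
      (fun x => (gtangent_in c s x).1 0 j) /\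
    csmooth_on (chart_map c @` (W `&` chart_dom c))
      (fun x => (gtangent_in c s x).2 0 j).

Definition forms_smooth (W : set M) (s : M -> forms R n) : Prop :=
  forall c, atlas c -> forall S : {set 'I_n},
    csmooth_on (chart_map c @` (W `&` chart_dom c))
      (fun x => forms_in c s x S : C).

Definition courant (A B : M -> gtangent R n) (p : M) : gtangent R n :=
  let c := chart_at p in
  courant_coord (gtangent_in c A) (gtangent_in c B) (chart_map c p).

Definition ext_d (w : M -> forms R n) (p : M) : forms R n :=
  let c := chart_at p in ext_d_coord (forms_in c w) (chart_map c p).

(* Sub-bundles of the bundle with fibre V whose smooth sections over W are
   given by smooth W: locally spanned by a smooth frame. *)
Definition subbundle (V : vectType C) (smooth : set M -> (M -> V) -> Prop)
    (F : M -> {vspace V}) : Prop :=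
  forall p : M, exists (W : set M) (k : nat) (s : 'I_k -> M -> V),
    [/\ open W, W p, (forall i, smooth W (s i)) &
        forall q, W q -> basis_of (F q) [seq s i q | i <- enum 'I_k]].

Definition almost_dirac (L : M -> {vspace gtangent R n}) : Prop :=
  subbundle gtangent_smooth L /\ forall p, maximal_isotropic (L p).

Definition pure_spinor_line (L : M -> {vspace gtangent R n})
    (U : M -> {vspace forms R n}) : Prop :=
  [/\ subbundle forms_smooth U, (forall p, \dim (U p) = 1%N) &
      forall p v, v \in L p <-> (forall w, w \in U p -> clifford v w = 0)].

Definition U0 (U : M -> {vspace forms R n}) (p : M) : set (forms R n) :=
  [set w | w \in U p].

Definition U1 (U : M -> {vspace forms R n}) (p : M) : set (forms R n) :=
  [set a | exists (v : gtangent R n) (w : forms R n),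
             w \in U p /\ a = clifford v w].

Definition gtangent_section (L : M -> {vspace gtangent R n})
    (s : M -> gtangent R n) : Prop :=
  gtangent_smooth setT s /\ forall p, s p \in L p.

Definition forms_section (F : M -> set (forms R n)) (w : M -> forms R n) :
    Prop :=
  forms_smooth setT w /\ forall p, F p (w p).

Definition courant_involutive (L : M -> {vspace gtangent R n}) : Prop :=
  forall A B, gtangent_section L A -> gtangent_section L B ->
    gtangent_section L (courant A B).

Definition local_trivialization (U : M -> {vspace forms R n}) (W : set M)
    (rho : M -> forms R n) : Prop :=
  [/\ open W, forms_smooth W rho &
      forall p, W p -> rho p \in U p /\ rho p != 0].

End Bundles.

(* Main.v *)
(** For sections A, B of (T + T^* ) (x) C and a form w, the Courant bracket acts on w through
    2 [A, B] w = d(ABw) - d(BAw) + 2 A d(Bw) - 2 B d(Aw) + AB dw - BA dw,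
    where juxtaposition is the Clifford action.  If A, B lie in L and w in U, this reduces to
    [A, B] w = A B dw, so that L is involutive if and only if L L dw = 0 for the sections w
    of U.  Since L is maximal isotropic, U is the whole space of forms annihilated by L
    (it has dimension 2^n / 2^n = 1), and L L dw = 0 gives dw = v w + b w for some v and some
    scalar b; parity forces b = 0, as w is even or odd and dw has the opposite parity.
    A smooth v exists locally by Cramer's rule, and globally by a partition of unity.

    The Clifford action being faithful, the same formula reduces the invariance of the Courant
    bracket under changes of charts to that of d. *)
From HB Require Import structures.
Require Import Defs.
From mathcomp Require Import all_boot all_order all_algebra.
From mathcomp Require Import all_classical all_reals all_analysis.
From mathcomp Require Import complex ring lra zify.
Set Implicit Arguments.
Unset Strict Implicit.
Unset Printing Implicit Defensive.
Import Order.TTheory GRing.Theory Num.Theory.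
Import numFieldNormedType.Exports.
Local Open Scope classical_set_scope.
Local Open Scope complex_scope.
Local Open Scope ring_scope.


(** * Clifford relations and pull-back of forms *)

(** Both [courant] and [ext_d] are computed at p in [chart_at p], a chart that depends on p with no
    regularity at all. Even the smoothness of [courant A B] and of [ext_d w] therefore rests on
    chart invariance, hence the long work on changes of charts. Involutivity and the condition on U
    quantify over global sections, while every identity is local. All conditions of the statement
    are therefore compared with one pointwise condition, [spinor_condition], and bump functions pass
    between local and global sections. Maximality of [L p] is stated by inclusion; that its
    dimension is at least n comes from solving a quadratic equation over C. If L L d rho = 0, each e
    in L satisfies e d rho = k rho for a scalar k. A field v with 2 <e, v> = k along a frame of L is
    the solution of a linear system, to which Cramer's rule applies. Membership of dw in U1 is
    delicate where the section w of U vanishes: w gives no trivialization there, and a nowhere zero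
    section is added to it. *)

Section CliffordAction.
Local Open Scope set_scope.
Context {R : realType} {n : nat}.
Local Notation C := R[i].
Implicit Types (X Y xi eta : 'rV[C]_n) (w : forms R n) (u v : gtangent R n).
Implicit Types (j k : 'I_n) (S T : {set 'I_n}) (a : C).

Lemma sign_beforeD1 j k S : j \in S ->
  sign_before k (S :\ j) = (-1) ^+ (j < k)%N * sign_before k S :> C.
Proof.
move=> jS; rewrite /sign_before.
have -> : [set i in S :\ j | (i < k)%N] = [set i in S | (i < k)%N] :\ j.
  by apply/setP => i; rewrite !inE andbA.
rewrite [#|[set i in S | _]|](cardsD1 j) !inE jS /= exprD.
by rewrite signrMK.
Qed.

Lemma sign_beforeU1 j k S : j \notin S ->
  sign_before k (j |: S) = (-1) ^+ (j < k)%N * sign_before k S :> C.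
Proof.
move=> jS; have := @sign_beforeD1 j k (j |: S) (setU11 _ _).
by rewrite setU1K // => ->; rewrite signrMK.
Qed.

Lemma sign_before_sq k S : sign_before k S * sign_before k S = 1 :> C.
Proof. by rewrite -expr2 sqrr_sign. Qed.

Lemma wedge1E xi w : wedge1 xi w = \sum_j xi 0 j *: wedge1 (delta_mx 0 j) w.
Proof.
apply/ffunP => S; rewrite sum_ffunE ffunE big_mkcond /=; apply: eq_bigr => j _.
rewrite !ffunE /=; case: ifPn => jS.
  rewrite (bigD1 j) //= big1 ?addr0 => [|k /andP[_ kj]].
    by rewrite mxE !eqxx /= mul1r [RHS]mulrA.
  by rewrite mxE eqxx (negPf kj) !mul0r.
rewrite big1 ?scaler0 // => k kS; rewrite mxE eqxx /=.
by case: eqP kS jS => [-> -> //|_ _ _]; rewrite !mul0r.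
Qed.

Lemma interior_productE X w :
  interior_product X w = \sum_j X 0 j *: interior_product (delta_mx 0 j) w.
Proof.
apply/ffunP => S; rewrite sum_ffunE ffunE big_mkcond /=; apply: eq_bigr => j _.
rewrite !ffunE /=; case: ifPn => jS.
  rewrite (bigD1 j) //= big1 ?addr0 => [|k /andP[_ kj]].
    by rewrite mxE !eqxx /= mul1r [RHS]mulrA.
  by rewrite mxE eqxx (negPf kj) !mul0r.
rewrite big1 ?scaler0 // => k kS; rewrite mxE eqxx /=.
by case: eqP kS jS => [-> -> //|_ _ _]; rewrite !mul0r.
Qed.

Lemma wedge_deltaE j w S : wedge1 (delta_mx 0 j) w S =
  if j \in S then sign_before j S * w (S :\ j) else 0.
Proof.
rewrite ffunE; case: ifPn => jS.
  rewrite (bigD1 j) //= big1 ?addr0 => [|k /andP[_ kj]].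
    by rewrite mxE !eqxx /= mul1r.
  by rewrite mxE eqxx (negPf kj) !mul0r.
rewrite big1 // => k kS; rewrite mxE eqxx /=.
by case: eqP kS jS => [-> -> //|_ _ _]; rewrite !mul0r.
Qed.

Lemma interior_deltaE j w S : interior_product (delta_mx 0 j) w S =
  if j \notin S then sign_before j S * w (j |: S) else 0.
Proof.
rewrite ffunE; case: ifPn => jS.
  rewrite (bigD1 j) //= big1 ?addr0 => [|k /andP[_ kj]].
    by rewrite mxE !eqxx /= mul1r.
  by rewrite mxE eqxx (negPf kj) !mul0r.
rewrite big1 // => k kS; rewrite mxE eqxx /=.
by case: eqP kS jS => [-> -> //|_ _ _]; rewrite !mul0r.
Qed.

Fact wedge1_is_linear xi : linear (wedge1 xi : forms R n -> forms R n).
Proof.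
move=> a w w'; apply/ffunP => S; rewrite !ffunE scaler_sumr -big_split /=.
by apply: eq_bigr => j _; rewrite !ffunE /= mulrDr; congr (_ + _); exact: mulrCA.
Qed.
HB.instance Definition _ xi :=
  GRing.isLinear.Build C (forms R n) (forms R n) _ (wedge1 xi) (wedge1_is_linear xi).

Fact interior_is_linear X : linear (interior_product X : forms R n -> forms R n).
Proof.
move=> a w w'; apply/ffunP => S; rewrite !ffunE scaler_sumr -big_split /=.
by apply: eq_bigr => j _; rewrite !ffunE /= mulrDr; congr (_ + _); exact: mulrCA.
Qed.
HB.instance Definition _ X :=
  GRing.isLinear.Build C (forms R n) (forms R n) _ (interior_product X) (interior_is_linear X).

Fact clifford_is_linear v : linear (clifford v : forms R n -> forms R n).
Proof. by move=> a w w'; rewrite /clifford !linearP /= scalerDr addrACA. Qed.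
HB.instance Definition _ v :=
  GRing.isLinear.Build C (forms R n) (forms R n) _ (clifford v) (clifford_is_linear v).

Lemma wedge1Dl a xi eta w :
  wedge1 (a *: xi + eta) w = a *: wedge1 xi w + wedge1 eta w.
Proof.
rewrite 3!(wedge1E _ w) scaler_sumr -big_split; apply: eq_bigr => j _ /=.
by rewrite !mxE scalerDl scalerA.
Qed.

Lemma interiorDl a X Y w : interior_product (a *: X + Y) w =
  a *: interior_product X w + interior_product Y w.
Proof.
rewrite 3!(interior_productE _ w) scaler_sumr -big_split; apply: eq_bigr => j _ /=.
by rewrite !mxE scalerDl scalerA.
Qed.

Lemma cliffordPl a u v w :
  clifford (a *: u + v) w = a *: clifford u w + clifford v w.
Proof. by rewrite /clifford wedge1Dl interiorDl /= scalerDr addrACA. Qed.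

Lemma clifford0l w : clifford (0 : gtangent R n) w = 0.
Proof.
have := cliffordPl (-1) 0 0 w; rewrite scaler0 addr0 => ->.
by rewrite scaleN1r addNr.
Qed.

Lemma cliffordDl u v w : clifford (u + v) w = clifford u w + clifford v w.
Proof. by rewrite -[u]scale1r cliffordPl !scale1r. Qed.

Lemma cliffordZl a u w : clifford (a *: u) w = a *: clifford u w.
Proof. by rewrite -[a *: u]addr0 cliffordPl clifford0l addr0. Qed.

Lemma clifford_suml (I : Type) (r : seq I) (P : pred I) (F : I -> gtangent R n) w :
  clifford (\sum_(i <- r | P i) F i) w = \sum_(i <- r | P i) clifford (F i) w.
Proof.
by apply: (big_morph (fun v => clifford v w) _ (clifford0l w)) => u v;
  rewrite cliffordDl.
Qed.

Lemma wedge_delta_anticomm j k w :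
  wedge1 (delta_mx 0 j) (wedge1 (delta_mx 0 k) w) +
  wedge1 (delta_mx 0 k) (wedge1 (delta_mx 0 j) w) = 0.
Proof.
apply/ffunP => S; rewrite [LHS]ffunE 4!wedge_deltaE [RHS]ffunE !inE.
have [->|nkj] := eqVneq j k; first by case: ifP; rewrite /= ?mulr0 addr0.
case jS: (j \in S); case kS: (k \in S); rewrite /= ?mulr0 ?addr0 //.
rewrite !sign_beforeD1 //.
have -> : S :\ k :\ j = S :\ j :\ k by apply/setP => i; rewrite !inE andbCA.
(* Of two distinct indices only the larger one notices that the other has been removed, so exactly
   one of the two orders picks up a sign. *)
move: nkj; rewrite neq_ltn => /orP[] h; rewrite h ltnNge (ltnW h) /= expr1 expr0; ring.
Qed.

Lemma interior_delta_anticomm j k w :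
  interior_product (delta_mx 0 j) (interior_product (delta_mx 0 k) w) +
  interior_product (delta_mx 0 k) (interior_product (delta_mx 0 j) w) = 0.
Proof.
apply/ffunP => S; rewrite [LHS]ffunE 4!interior_deltaE [RHS]ffunE !inE.
have [->|nkj] := eqVneq j k; first by case: ifP; rewrite /= ?mulr0 addr0.
case jS: (j \in S); case kS: (k \in S); rewrite /= ?mulr0 ?addr0 //.
rewrite !sign_beforeU1 ?jS ?kS //.
have -> : k |: (j |: S) = j |: (k |: S) by apply/setP => i; rewrite !inE orbCA.
move: nkj; rewrite neq_ltn => /orP[] h; rewrite h ltnNge (ltnW h) /= expr1 expr0; ring.
Qed.

Lemma interior_wedge_delta j k w :
  interior_product (delta_mx 0 j) (wedge1 (delta_mx 0 k) w) +
  wedge1 (delta_mx 0 k) (interior_product (delta_mx 0 j) w) = (j == k)%:R *: w.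
Proof.
apply/ffunP => S; rewrite [LHS]ffunE [RHS]ffunE.
rewrite interior_deltaE 2!wedge_deltaE interior_deltaE !inE.
have [->|nkj] := eqVneq j k; rewrite /= ?scale1r ?scale0r.
  case kS: (k \in S) => /=; rewrite /= ?addr0 ?add0r.
    by rewrite sign_beforeD1 // ltnn mul1r mulrA sign_before_sq mul1r finset.setD1K.
  by rewrite sign_beforeU1 ?kS// ltnn mul1r mulrA sign_before_sq mul1r setU1K ?kS.
case jS: (j \in S); case kS: (k \in S); rewrite /= ?mulr0 ?addr0 //.
rewrite sign_beforeU1 ?jS // sign_beforeD1 ?kS //.
have -> : j |: S :\ k = (j |: S) :\ k.
  by apply/setP => i; rewrite !inE; case: eqVneq => [->|]//=; rewrite ?(negPf nkj).
move: nkj; rewrite neq_ltn => /orP[] h; rewrite h ltnNge (ltnW h) /= expr1 expr0; ring.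
Qed.

End CliffordAction.

Section CliffordRelations.
Local Open Scope set_scope.
Context {R : realType} {n : nat}.
Local Notation C := R[i].
Implicit Types (X Y xi eta : 'rV[C]_n) (w : forms R n) (u v : gtangent R n).
Implicit Types (j k : 'I_n) (S T : {set 'I_n}) (a : C).

(** Both actions are linear in the vector argument, so an anticommutator is determined by its values
    [c j k] on basis vectors. The three relations below (interior with interior, wedge with wedge,
    interior with wedge) are instances. *)
Lemma anticomm_expand (f g : 'rV[C]_n -> {linear forms R n -> forms R n})
    (c : 'I_n -> 'I_n -> C) X Y w :
    (forall X w, f X w = \sum_j X 0 j *: f (delta_mx 0 j) w) ->
    (forall X w, g X w = \sum_j X 0 j *: g (delta_mx 0 j) w) ->
    (forall j k w, f (delta_mx 0 j) (g (delta_mx 0 k) w) +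
       g (delta_mx 0 k) (f (delta_mx 0 j) w) = c j k *: w) ->
  f X (g Y w) + g Y (f X w) = (\sum_j \sum_k X 0 j * Y 0 k * c j k) *: w.
Proof.
move=> hf hg h.
rewrite (hf X w) (hg Y w) (hf X) linear_sum scaler_suml -big_split /=.
apply: eq_bigr => j _; rewrite linear_sum linearZ /= (hg Y) -scalerDr -big_split /=.
rewrite scaler_sumr scaler_suml; apply: eq_bigr => k _.
by rewrite linearZ -scalerDr h !scalerA.
Qed.

Lemma interior_anticomm X Y w :
  interior_product X (interior_product Y w) +
  interior_product Y (interior_product X w) = 0.
Proof.
rewrite (@anticomm_expand (fun X => interior_product X : {linear _ -> _})
  (fun X => interior_product X : {linear _ -> _}) (fun _ _ => 0)) /=.
- rewrite big1 ?scale0r // => j _; rewrite big1 // => k _; exact: mulr0.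
- exact: interior_productE.
- exact: interior_productE.
- by move=> *; rewrite scale0r interior_delta_anticomm.
Qed.

Lemma wedge_anticomm xi eta w :
  wedge1 xi (wedge1 eta w) + wedge1 eta (wedge1 xi w) = 0.
Proof.
rewrite (@anticomm_expand (fun X => wedge1 X : {linear _ -> _})
  (fun X => wedge1 X : {linear _ -> _}) (fun _ _ => 0)) /=.
- rewrite big1 ?scale0r // => j _; rewrite big1 // => k _; exact: mulr0.
- exact: wedge1E.
- exact: wedge1E.
- by move=> *; rewrite scale0r wedge_delta_anticomm.
Qed.

Lemma interior_wedge X xi w :
  interior_product X (wedge1 xi w) + wedge1 xi (interior_product X w) =
  pairing X xi *: w.
Proof.
rewrite (@anticomm_expand (fun X => interior_product X : {linear _ -> _})
  (fun X => wedge1 X : {linear _ -> _}) (fun j k => (j == k)%:R)) /=.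
- congr (_ *: _); apply: eq_bigr => j _.
  rewrite (bigD1 j) //= eqxx mulr1 big1 ?addr0 1?mulrC // => k kj.
  by rewrite eq_sym (negPf kj) mulr0.
- exact: interior_productE.
- exact: wedge1E.
- exact: interior_wedge_delta.
Qed.

Lemma wedge_sq xi w : wedge1 xi (wedge1 xi w) = 0.
Proof.
have /eqP := wedge_anticomm xi xi w.
by rewrite -mulr2n -scaler_nat scaler_eq0 pnatr_eq0 /= => /eqP.
Qed.

Lemma pairingC X Y : pairing X Y = pairing Y X.
Proof. by apply: eq_bigr => j _; rewrite mulrC. Qed.

Lemma pairingPl a X Y xi : pairing (a *: X + Y) xi = a * pairing X xi + pairing Y xi.
Proof.
rewrite /pairing mulr_sumr -big_split /=; apply: eq_bigr => j _.
by rewrite !mxE mulrDr mulrCA.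
Qed.

Lemma pairing_delta X j : pairing X (delta_mx 0 j) = X 0 j.
Proof.
rewrite /pairing (bigD1 j) //= big1 ?addr0 => [|k kj].
  by rewrite mxE !eqxx mul1r.
by rewrite mxE eqxx (negPf kj) mul0r.
Qed.

Lemma innerC u v : inner u v = inner v u.
Proof. by rewrite /inner addrC. Qed.

Lemma innerPl a u v (t : gtangent R n) : inner (a *: u + v) t = a * inner u t + inner v t.
Proof.
rewrite /inner /= pairingPl pairingC pairingPl (pairingC t.1) (pairingC t.1); ring.
Qed.

Lemma inner0l v : inner 0 v = 0.
Proof.
have := innerPl (-1) 0 0 v; rewrite scaler0 addr0 => /eqP.
by rewrite mulN1r addNr => /eqP.
Qed.

Lemma innerDl u v (t : gtangent R n) : inner (u + v) t = inner u t + inner v t.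
Proof. by have := innerPl 1 u v t; rewrite scale1r mul1r. Qed.

Lemma innerZl a u v : inner (a *: u) v = a * inner u v.
Proof. by have := innerPl a u 0 v; rewrite addr0 inner0l addr0. Qed.

Lemma inner_suml (I : Type) (r : seq I) (P : pred I) (F : I -> gtangent R n) v :
  inner (\sum_(i <- r | P i) F i) v = \sum_(i <- r | P i) inner (F i) v.
Proof.
by apply: (big_morph (fun u => inner u v) _ (inner0l v)) => u t; rewrite innerDl.
Qed.

Lemma inner_sumr (I : Type) (r : seq I) (P : pred I) (F : I -> gtangent R n) v :
  inner v (\sum_(i <- r | P i) F i) = \sum_(i <- r | P i) inner v (F i).
Proof. by rewrite innerC inner_suml; apply: eq_bigr => i _; rewrite innerC. Qed.

Lemma clifford_anticomm u v w :
  clifford u (clifford v w) + clifford v (clifford u w) = (2 * inner u v) *: w.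
Proof.
rewrite /clifford !linearD /= /inner mulrA divff ?pnatr_eq0 // mul1r scalerDl.
rewrite -(interior_wedge v.1 u.2) -(interior_wedge u.1 v.2).
have h1 := interior_anticomm u.1 v.1 w.
have h2 := wedge_anticomm u.2 v.2 w.
(* The two unmixed anticommutators vanish; inserting them on the right gives both sides the same
   eight summands. *)
rewrite -[RHS]addr0 -[X in _ = _ + X]addr0 -{1}h1 -h2.
move: (interior_product _ (interior_product _ _)) => A1.
move: (interior_product v.1 (interior_product _ _)) => A2.
by rewrite [LHS](AC ((2*2)*(2*2)) (((6*3)*(2*7))*((1*5)*(4*8))))/=.
Qed.

Lemma clifford_sq v w : clifford v (clifford v w) = inner v v *: w.
Proof.
have := clifford_anticomm v v w.
rewrite -mulr2n -scaler_nat -scalerA => /(scalerI _); apply.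
by rewrite pnatr_eq0.
Qed.

Lemma cliffordC u v w :
  clifford u (clifford v w) = (2 * inner u v) *: w - clifford v (clifford u w).
Proof. by rewrite -clifford_anticomm addrK. Qed.

End CliffordRelations.

Section Pullback.
Local Open Scope set_scope.
Context {R : realType} {n : nat}.
Local Notation C := R[i].
Implicit Types (X Y xi eta : 'rV[C]_n) (w : forms R n) (u v : gtangent R n).
Implicit Types (j k : 'I_n) (S T : {set 'I_n}) (a : C) (K : 'M[C]_n).

(** [enum] lists a set of ordinals in increasing order, and a strictly increasing list is determined
    by its elements. *)
Lemma enum_setU1_min (h : 'I_n) S : (forall i, i \in S -> (h < i)%N) ->
  enum (h |: S) = h :: enum S.
Proof.
move=> hS.
have sE T : sorted (relpre val ltn) (enum T).
  rewrite /enum_mem sorted_filter //; first by move=> x y z; apply: ltn_trans.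
  by rewrite -enumT -sorted_map val_enum_ord iota_ltn_sorted.
apply: (irr_sorted_eq (leT := relpre val ltn)) => //.
- by move=> x y z; apply: ltn_trans.
- by move=> x; rewrite /= ltnn.
- rewrite /= path_sortedE; last by move=> x y z; apply: ltn_trans.
  by rewrite sE andbT; apply/allP => i; rewrite mem_enum => /hS.
- by move=> i; rewrite !(mem_enum, inE).
Qed.

(** Induction by adding a new least element. It fits products over [enum S], in which the least
    index is the outermost factor. *)
Lemma set_min_ind (P : {set 'I_n} -> Prop) :
  P finset.set0 ->
  (forall (h : 'I_n) S, (forall i, i \in S -> (h < i)%N) -> P S -> P (h |: S)) ->
  forall S, P S.
Proof.
move=> P0 PU S; move: {2}#|S| (leqnn #|S|) => m.
elim: m S => [|m IH] S; first by rewrite leqn0 cards_eq0 => /eqP ->.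
have [->//|/finset.set0Pn[i iS]] := eqVneq S finset.set0.
move=> Sm; case: (arg_minnP val iS) => h /= /[dup] hS' _ hmin.
have {hS'}hS : h \in S := hS'.
rewrite -(finset.setD1K hS); apply: PU => [k|].
  rewrite !inE => /andP[kh /hmin]; rewrite leq_eqVlt => /orP[/eqP/val_inj hk|//].
  by rewrite hk eqxx in kh.
by apply: IH; rewrite -ltnS (leq_trans _ Sm) // [leqRHS](cardsD1 h) hS.
Qed.

Lemma sign_before_min (h : 'I_n) S :
  (forall i, i \in S -> (h <= i)%N) -> sign_before h S = 1 :> C.
Proof.
move=> hS; rewrite /sign_before (_ : [set i in S | _] = finset.set0) ?cards0 //.
apply/setP => i; rewrite !inE; apply/negP => /andP[/hS].
by rewrite leqNgt => /negP.
Qed.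

(** For s = [enum S] this is the pull-back of dx_S, the product of the images of its factors
    dx_j. *)
Definition wedge_seq K (s : seq 'I_n) : forms R n :=
  foldr (fun j w => wedge1 (col j K)^T w) form1 s.

(** The new covector is moved inwards to its place in the increasing product. Each smaller index
    that it passes costs one sign, and [sign_before] counts these; meeting its own index gives a
    square, which is zero. *)
Lemma wedge_wedge_seq K S j : wedge1 (col j K)^T (wedge_seq K (enum S)) =
  if j \in S then 0 else sign_before j S *: wedge_seq K (enum (j |: S)).
Proof.
elim/set_min_ind: S j => [|h S hS IH] j.
  rewrite inE finset.setU0 enum_set0 sign_before_min ?scale1r; last first.
    by move=> i; rewrite inE.
  by rewrite enum_set1.
have hnS : h \notin S by apply/negP => /hS; rewrite ltnn.
rewrite (enum_setU1_min hS) /= -/(wedge_seq K (enum S)) !inE.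
have [jh|hj|/val_inj ->] := ltngtP j h; last by rewrite wedge_sq eqxx.
- have jS i : i \in h |: S -> (j < i)%N.
    by rewrite !inE => /orP[/eqP-> //|/hS]; apply: ltn_trans.
  have -> : (j == h) = false by apply/negbTE; rewrite neq_ltn jh.
  have -> : (j \in S) = false.
    by apply/negP => /hS; rewrite ltnNge (ltnW jh).
  rewrite (enum_setU1_min jS) sign_before_min ?scale1r; last first.
    by move=> i /jS/ltnW.
  by rewrite /= (enum_setU1_min hS).
- have -> : (j == h) = false by apply/negbTE; rewrite neq_ltn hj orbT.
  have := wedge_anticomm (col j K)^T (col h K)^T (wedge_seq K (enum S)).
  move/eqP; rewrite addr_eq0 => /eqP ->; rewrite IH /=.
  case: ifP => jS; first by rewrite linear0 oppr0.
  rewrite linearZ /= sign_beforeU1 // hj expr1 mulN1r scaleNr; congr (- (_ *: _)).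
  have -> : j |: (h |: S) = h |: (j |: S) by apply/setP => i; rewrite !inE orbCA.
  rewrite (@enum_setU1_min h (j |: S)) // => i.
  by rewrite !inE => /orP[/eqP-> //|/hS].
Qed.

Definition basis_form S : forms R n := [ffun T => (T == S)%:R].

Lemma forms_basisE w : w = \sum_S w S *: basis_form S.
Proof.
apply/ffunP => T; rewrite sum_ffunE (bigD1 T) //= big1 ?addr0.
  by rewrite !ffunE eqxx [RHS]mulr1.
by move=> S ST; rewrite !ffunE eq_sym (negPf ST); exact: mulr0.
Qed.

Lemma wedge_seq1 S : wedge_seq 1%:M (enum S) = basis_form S.
Proof.
elim/set_min_ind: S => [|h S hS IH]; first by rewrite enum_set0.
rewrite (enum_setU1_min hS) /= -/(wedge_seq _ _) IH col1 trmx_delta.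
have hnS : h \notin S by apply/negP => /hS; rewrite ltnn.
apply/ffunP => T; rewrite wedge_deltaE !ffunE; case: ifPn => hT.
  have -> : (T :\ h == S) = (T == h |: S).
    apply/eqP/eqP => [<-|->]; last by rewrite setU1K.
    by rewrite finset.setD1K.
  case: eqP => [->|_]; last by rewrite mulr0.
  rewrite sign_before_min ?mulr1 // => i; rewrite !inE => /orP[/eqP-> //|].
  by move/hS/ltnW.
by case: eqP hT => // ->; rewrite setU11.
Qed.

Lemma wedge_basis S j : wedge1 (delta_mx 0 j) (basis_form S) =
  if j \in S then 0 else sign_before j S *: basis_form (j |: S).
Proof.
by rewrite -!wedge_seq1 -wedge_wedge_seq col1 trmx_delta.
Qed.

(** The exterior algebra is generated from 1 by the operators dx_j /\. Identities between linear
    maps that behave well under these operators need a check on [form1] only. *)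
Lemma forms_ind (P : forms R n -> Prop) :
  P form1 -> (forall a w w', P w -> P w' -> P (a *: w + w')) ->
  (forall j w, P w -> P (wedge1 (delta_mx 0 j) w)) -> forall w, P w.
Proof.
move=> P1 PL PW w.
have P0 : P 0 by rewrite -(addNr form1) -scaleN1r; exact: PL.
rewrite (forms_basisE w); apply: (big_rec P P0) => S w' _; apply: PL.
rewrite -wedge_seq1; elim: (enum S) => [//|j s IH].
by rewrite /= col1 trmx_delta; apply: PW.
Qed.

Lemma pullbackE K w : pullback K w = \sum_S w S *: wedge_seq K (enum S).
Proof. by []. Qed.

Fact pullback_is_linear K : linear (pullback K : forms R n -> forms R n).
Proof.
move=> a w w'; rewrite !pullbackE scaler_sumr -big_split /=.
by apply: eq_bigr => S _; rewrite !ffunE scalerDl scalerA.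
Qed.
HB.instance Definition _ K :=
  GRing.isLinear.Build C (forms R n) (forms R n) _ (pullback K) (pullback_is_linear K).

Lemma pullback_basis K S : pullback K (basis_form S) = wedge_seq K (enum S).
Proof.
rewrite pullbackE (bigD1 S) //= big1 ?addr0; first by rewrite ffunE eqxx scale1r.
by move=> T TS; rewrite ffunE (negPf TS) scale0r.
Qed.

Lemma pullback_form1 K : pullback K form1 = form1.
Proof. by rewrite -[form1]/(basis_form finset.set0) pullback_basis enum_set0. Qed.

Lemma pullback_wedge K xi w :
  pullback K (wedge1 xi w) = wedge1 (xi *m K^T) (pullback K w).
Proof.
rewrite wedge1E linear_sum /=.
have -> : xi *m K^T = \sum_j xi 0 j *: (col j K)^T.
  apply/rowP => i; rewrite summxE mxE; apply: eq_bigr => j _.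
  by rewrite !mxE.
have -> w' : wedge1 (\sum_j xi 0 j *: (col j K)^T) w' =
    \sum_j xi 0 j *: wedge1 (col j K)^T w'.
  have w0 : wedge1 0 w' = 0.
    by rewrite -[0 in LHS](addNr 0) -scaleN1r wedge1Dl scaleN1r addNr.
  apply: (big_ind2 (fun x y => wedge1 x w' = y)) => [//|x1 x2 y1 y2 <- <-|j _].
    by rewrite -[x1]scale1r wedge1Dl !scale1r.
  by rewrite -[_ *: _ in LHS]addr0 wedge1Dl w0 addr0.
apply: eq_bigr => j _; rewrite linearZ /=; congr (_ *: _).
rewrite [in LHS](forms_basisE w) 2!linear_sum /=.
rewrite [in RHS]pullbackE [in RHS]linear_sum.
apply: eq_bigr => S _; rewrite !linearZ /= wedge_basis wedge_wedge_seq.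
by case: ifP => _; rewrite ?linear0 // linearZ /= pullback_basis.
Qed.

Lemma pullback1 w : pullback 1%:M w = w.
Proof.
by rewrite pullbackE [RHS]forms_basisE; apply: eq_bigr => S _; rewrite wedge_seq1.
Qed.

Lemma pullback_mul K K' w : pullback K (pullback K' w) = pullback (K *m K') w.
Proof.
elim/forms_ind: w => [|a w w' IH IH'|j w IH]; first by rewrite !pullback_form1.
  by rewrite !linearP /= IH IH'.
by rewrite !pullback_wedge IH trmx_mul mulmxA.
Qed.

Lemma pairing_mul X K xi : pairing X (xi *m K^T) = pairing (X *m K) xi.
Proof.
rewrite /pairing.
under eq_bigr => i _ do rewrite mxE mulr_suml.
under [RHS]eq_bigr => i _ do rewrite mxE mulr_sumr.
rewrite exchange_big /=; apply: eq_bigr => j _; apply: eq_bigr => i _.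
by rewrite !mxE mulrAC -!mulrA; congr (_ * _); rewrite mulrC.
Qed.

Lemma interior_form1 X : interior_product X form1 = 0.
Proof.
apply/ffunP => S; rewrite !ffunE big1 // => j _; rewrite ffunE.
have -> : (j |: S == finset.set0) = false.
  by apply/negP => /eqP/setP/(_ j); rewrite setU11 inE.
exact: mulr0.
Qed.

(** By [forms_ind]: the relation between interior and exterior products moves the interior product
    past one factor dx_j, and [pairing_mul] matches the scalars that appear. *)
Lemma interior_pullback X K w :
  interior_product X (pullback K w) = pullback K (interior_product (X *m K) w).
Proof.
elim/forms_ind: w => [|a w w' IH IH'|j w IH].
- by rewrite pullback_form1 !interior_form1 linear0.
- by rewrite !linearP /= IH IH'.
rewrite pullback_wedge.
have /(canRL (addrK _)) -> := interior_wedge X (delta_mx 0 j *m K^T) (pullback K w).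
have /(canRL (addrK _)) -> := interior_wedge (X *m K) (delta_mx 0 j) w.
by rewrite linearB linearZ /= pullback_wedge IH pairing_mul.
Qed.

(** Covectors are transported by K and vectors by its inverse K', so that contraction sees
    [K' *m K]. *)
Lemma clifford_pullback (K K' : 'M[C]_n) v w : K' *m K = 1%:M ->
  clifford (v.1 *m K', v.2 *m K^T) (pullback K w) = pullback K (clifford v w).
Proof.
move=> K1; rewrite /clifford linearD /= -pullback_wedge interior_pullback.
by rewrite -mulmxA K1 mulmx1.
Qed.

(** The grading involution: even and odd forms are its eigenvectors for 1 and -1. *)
Definition parity w : forms R n := [ffun S : {set 'I_n} => (-1) ^+ #|S| * w S].

Fact parity_is_linear : linear parity.
Proof.
move=> a w w'; apply/ffunP => S; rewrite !ffunE mulrDr; congr (_ + _).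
exact: mulrCA.
Qed.
HB.instance Definition _ :=
  GRing.isLinear.Build C (forms R n) (forms R n) _ parity parity_is_linear.

Lemma parity_wedge xi w : parity (wedge1 xi w) = - wedge1 xi (parity w).
Proof.
rewrite 2!(wedge1E xi) linear_sum -sumrN; apply: eq_bigr => j _ /=.
rewrite linearZ /= -scalerN; congr (_ *: _); apply/ffunP => S.
rewrite ffunE [RHS]ffunE !wedge_deltaE; case: ifP => jS; rewrite ?mulr0 ?oppr0 //.
by rewrite ffunE [#|S|](cardsD1 j) jS exprS mulN1r mulNr mulrCA.
Qed.

Lemma parity_interior X w : parity (interior_product X w) = - interior_product X (parity w).
Proof.
rewrite 2!(interior_productE X) linear_sum -sumrN; apply: eq_bigr => j _ /=.
rewrite linearZ /= -scalerN; congr (_ *: _); apply/ffunP => S.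
rewrite ffunE [RHS]ffunE !interior_deltaE; case: ifPn => jS; rewrite ?mulr0 ?oppr0 //.
rewrite ffunE cardsU1 jS exprS mulN1r mulNr mulrN opprK; exact: mulrCA.
Qed.

Lemma parity_clifford v w : parity (clifford v w) = - clifford v (parity w).
Proof.
by rewrite /clifford linearD /= parity_wedge parity_interior opprD.
Qed.

Lemma form1_neq0 : form1 != 0 :> forms R n.
Proof.
apply/eqP => /ffunP/(_ finset.set0); rewrite !ffunE eqxx => /eqP.
by rewrite oner_eq0.
Qed.

Lemma inner_delta1 v j : 2 * inner v (delta_mx 0 j, 0) = v.2 0 j.
Proof.
rewrite /inner mulrA divff ?pnatr_eq0 // mul1r /= pairingC pairing_delta.
by rewrite /pairing big1 ?addr0 // => k _; rewrite mxE mul0r.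
Qed.

Lemma inner_delta2 v j : 2 * inner v (0, delta_mx 0 j) = v.1 0 j.
Proof.
rewrite /inner mulrA divff ?pnatr_eq0 // mul1r /= pairing_delta.
by rewrite /pairing big1 ?add0r // => k _; rewrite mxE mulr0.
Qed.

(** If v acts by zero, its anticommutator with any u, which is multiplication by 2 <u, v>, is zero
    too; then v = 0 because the inner product is nondegenerate. *)
Lemma clifford_faithful v : (forall w, clifford v w = 0) -> v = 0.
Proof.
move=> h; have h2 u : 2 * inner v u = 0.
  have := clifford_anticomm v u form1; rewrite !h linear0 addr0.
  by move/esym/eqP; rewrite scaler_eq0 (negPf form1_neq0) orbF => /eqP.
case: v h h2 => v1 v2 h h2; congr pair; apply/rowP => j; rewrite !mxE.
  by rewrite -(h2 (0, delta_mx 0 j)) inner_delta2.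
by rewrite -(h2 (delta_mx 0 j, 0)) inner_delta1.
Qed.

End Pullback.

(** * Annihilators of isotropic subspaces *)

Section PureSpinors.
Context {R : realType} {n : nat}.
Local Notation C := R[i].
Implicit Types (w : forms R n) (u v : gtangent R n) (a : C).
Implicit Types (L : {vspace gtangent R n}) (U : {vspace forms R n}).

(** The inner product pairs tangent with cotangent parts, so the two halves are exchanged: the
    vector part of f records phi on covectors, and its covector part records phi on vectors. *)
Lemma inner_riesz (phi : {scalar gtangent R n}) :
  exists f, forall v, 2 * inner f v = phi v.
Proof.
exists (\row_j phi (0, delta_mx 0 j), \row_j phi (delta_mx 0 j, 0)) => v.
have -> : v = \sum_j (v.1 0 j *: (delta_mx 0 j, 0) + v.2 0 j *: (0, delta_mx 0 j)).
  rewrite big_split /=; case: v => v1 v2 /=.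
  rewrite [v1 in LHS]row_sum_delta [v2 in LHS]row_sum_delta.
  transitivity ((\sum_j v1 0 j *: delta_mx 0 j, 0) + 
     (0, \sum_j v2 0 j *: delta_mx 0 j) : gtangent R n).
    by congr pair; rewrite /= ?addr0 ?add0r.
  congr (_ + _).
    apply: (big_ind2 (fun (x : 'rV[C]_n) (y : gtangent R n) => (x, 0) = y)) => //.
      by move=> x1 _ x2 _ <- <-; congr pair; rewrite /= ?addr0.
    by move=> j _; congr pair; rewrite /= ?scaler0.
  apply: (big_ind2 (fun (x : 'rV[C]_n) (y : gtangent R n) => (0, x) = y)) => //.
    by move=> x1 _ x2 _ <- <-; congr pair; rewrite /= ?addr0.
  by move=> j _; congr pair; rewrite /= ?scaler0.
rewrite inner_sumr mulr_sumr linear_sum; apply: eq_bigr => j _.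
rewrite innerC innerDl !innerZl linearD !linearZ /= mulrDr.
rewrite (mulrCA 2 (v.1 0 j)) (mulrCA 2 (v.2 0 j)) innerC inner_delta1 innerC inner_delta2 /=.
by rewrite !mxE.
Qed.

(** The coordinate functionals of the family e, represented by vectors through nondegeneracy. *)
Lemma dual_family (k : nat) (e : k.-tuple (gtangent R n)) : free e ->
  forall i : 'I_k, exists f, forall j : 'I_k, 2 * inner f e`_j = (i == j)%:R.
Proof.
move=> fe i; have [f hf] := inner_riesz (coord e i).
by exists f => j; rewrite hf eq_sym; exact: coord_free.
Qed.

Definition clifford_fun v : 'End(forms R n) := linfun (clifford v).

Lemma clifford_funE v w : clifford_fun v w = clifford v w.
Proof. by rewrite lfunE. Qed.

(** Recursion on a list of vectors, so that the dimension can be followed as vectors are imposed one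
    at a time. *)
Fixpoint annihilated (s : seq (gtangent R n)) : {vspace forms R n} :=
  if s is v :: s' then (annihilated s' :&: lker (clifford_fun v))%VS else fullv.

Lemma annihilatedP s w :
  reflect (forall v, v \in s -> clifford v w = 0) (w \in annihilated s).
Proof.
elim: s => [|v s IH] /=; first by rewrite memvf; left.
rewrite memv_cap memv_ker clifford_funE.
apply: (iffP andP) => [[/IH h /eqP h'] u|h].
  by rewrite inE => /orP[/eqP->|/h].
split; first by apply/IH => u us; apply: h; rewrite inE us orbT.
by rewrite h ?inE ?eqxx.
Qed.

(* [annihilated s] is stable under clifford f, with f orthogonal to s, and there
   e f + f e = 1, e e = 0, so that the kernel of e is its image. *)
Lemma dim_annihilated s : free s ->
  (forall u v, u \in s -> v \in s -> inner u v = 0) ->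
  (\dim (annihilated s) * 2 ^ size s = 2 ^ n)%N.
Proof.
elim: s => [|e s IH] fs is0.
  rewrite /= muln1 dimvf; transitivity (#|{set 'I_n}| * 1)%N; first by [].
  rewrite muln1.
  rewrite -[in RHS](card_ord n) -[#|'I_n|]cardsT -card_powerset.
  by rewrite finset.powersetT cardsT.
have fs' : free s by move: fs; rewrite free_cons => /andP[].
have [f hf] := dual_family (e := in_tuple (e :: s)) fs ord0.
have fe : 2 * inner f e = 1 by rewrite (hf ord0).
have fs0 v : v \in s -> 2 * inner f v = 0.
  move=> vs; have hi : (index v s < size s)%N by rewrite index_mem.
  have := hf (lift ord0 (Ordinal hi)).
  by rewrite (negPf (neq_lift _ _)) lift0 /= nth_index.
have ie v : v \in s -> inner e v = 0.
  by move=> vs; rewrite is0 // inE ?eqxx ?vs ?orbT.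
have -> : (\dim (annihilated (e :: s)) * 2 ^ size (e :: s) =
  (\dim (annihilated (e :: s)) + \dim (annihilated (e :: s))) * 2 ^ size s)%N.
  by rewrite addnn -mul2n /= expnS mulnCA mulnA.
rewrite -{}IH //; last by move=> u v us vs; apply: is0; rewrite inE ?us ?vs orbT.
congr (_ * _)%N.
have {1}-> : annihilated (e :: s) = (clifford_fun e @: annihilated s)%VS.
  apply/vspaceP => w; rewrite /= memv_cap memv_ker clifford_funE.
  apply/andP/memv_imgP => [[ws /eqP ew]|[w' /annihilatedP w's ->]].
    exists (clifford f w); last first.
      by rewrite clifford_funE cliffordC ew linear0 subr0 innerC fe scale1r.
    apply/annihilatedP => v vs; rewrite cliffordC innerC (fs0 _ vs) scale0r sub0r.
    by move/annihilatedP: ws => -> //; rewrite linear0 oppr0.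
  rewrite clifford_funE clifford_sq is0 ?inE ?eqxx // scale0r eqxx; split=> //.
  apply/annihilatedP => v vs; rewrite cliffordC innerC ie // mulr0 scale0r sub0r.
  by rewrite w's // linear0 oppr0.
by rewrite addnC; exact: limg_ker_dim.
Qed.

(** Completion of the square. This is where complex scalars matter: a definite real plane has no
    isotropic line. *)
Lemma closed_quadratic (b c : C) : exists t, t ^+ 2 + 2 * b * t + c = 0.
Proof.
exists (sqrtC (b ^+ 2 - c) - b).
have := sqrtCK (b ^+ 2 - c); set s := sqrtC _ => hs.
transitivity (s ^+ 2 - b ^+ 2 + c); first by ring.
by rewrite hs; ring.
Qed.

(** If dim L < n, the orthogonal P of L has dimension at least dim L + 2 and so contains u and v
    independent modulo L. Either u is isotropic, or some v + t u is, t being a root of a quadratic.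
    Such a vector lies in P, hence may be added to L, and maximality puts it in L, a
    contradiction. *)
Lemma dim_maximal_isotropic L : maximal_isotropic L -> (n <= \dim L)%N.
Proof.
move=> [isoL maxL]; rewrite leqNgt; apply/negP => ltLn.
pose b := vbasis L.
have orthP v : (forall i : 'I_(\dim L), inner v b`_i = 0) ->
    forall u, u \in L -> inner v u = 0.
  move=> h u uL; rewrite (coord_vbasis uL) inner_sumr big1 // => i _.
  by rewrite innerC innerZl innerC h mulr0.
pose g (v : gtangent R n) : 'rV[C]_(\dim L) := \row_i inner v b`_i.
have gl : linear g by move=> a u v; apply/rowP => i; rewrite !mxE innerPl.
pose gL : {linear gtangent R n -> 'rV[C]_(\dim L)} :=
  HB.pack g (GRing.isLinear.Build C (gtangent R n) 'rV[C]_(\dim L) _ g gl).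
pose G := linfun gL.
pose P := lker G.
have memP v : (v \in P) -> forall u, u \in L -> inner v u = 0.
  rewrite memv_ker lfunE /= => /eqP/rowP h; apply: orthP => i.
  by have := h i; rewrite !mxE.
(* Rank and nullity of v |-> (<v, b_i>)_i give dim P >= 2n - dim L, and dim L <= n - 1. *)
have dimP : (\dim L + 2 <= \dim P)%N.
  have := limg_ker_dim G fullv; rewrite capfv -/P dimvf.
  have := dimvS (subvf (limg G)); rewrite dimvf.
  have -> : dim 'rV[C]_(\dim L) = \dim L by rewrite dim_matrix; exact: mul1n.
  have -> : dim (gtangent R n) = (n + n)%N.
    rewrite [LHS]/(dim 'rV[C]_n + dim 'rV[C]_n)%N !dim_matrix.
    exact: (congr2 addn (mul1n n) (mul1n n)).
  lia.
have notsub (V : {vspace gtangent R n}) :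
    (\dim V < \dim P)%N -> exists2 v, v \in P & v \notin V.
  move=> lt; have /subvPn[v vP vV] : ~~ (P <= V)%VS.
    by apply/negP => /dimvS; rewrite leqNgt lt.
  by exists v.
have maxP x : x \in P -> inner x x = 0 -> x \in L.
  move=> xP x0; have iso' : isotropic (L + <[x]>)%VS.
    move=> _ _ /memv_addP[u uL [_ /vlineP[a ->] ->]]
      /memv_addP[v vL [_ /vlineP[c ->] ->]].
    have pu : inner x u = 0 by apply: memP.
    have pv : inner x v = 0 by apply: memP.
    rewrite innerDl innerZl innerC innerDl innerZl isoL // pu mulr0 addr0 add0r.
    by rewrite innerC innerDl innerC pv innerZl x0 !mulr0 addr0 mulr0.
  by rewrite -[x]add0r -(maxL _ iso' (addvSl _ _)) memv_add ?mem0v ?memv_line.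
have [|u uP uL] := notsub L; first by lia.
have [|v vP vLu] := notsub (L + <[u]>)%VS.
  rewrite (leq_ltn_trans (dimv_add_leqif _ _)) // dim_vline.
  by case: (u != 0); lia.
have [u0|u0] := eqVneq (inner u u) 0; first by rewrite maxP in uL.
have [t ht] := closed_quadratic (inner u v / inner u u) (inner v v / inner u u).
have : v + t *: u \in L.
  apply: maxP; first by rewrite memvD // memvZ.
  have -> : inner (v + t *: u) (v + t *: u) = inner u u *
     (t ^+ 2 + 2 * (inner u v / inner u u) * t + inner v v / inner u u).
    rewrite innerDl innerZl innerC innerDl innerZl (innerC u (v + _)) innerDl innerZl.
    rewrite (innerC v u); field.
    exact: u0.
  by rewrite ht mulr0.
move=> h; move/negP: vLu; apply.
rewrite -(addrK (t *: u) v) addrC addrC memv_add //.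
by rewrite -scaleNr memvZ // memv_line.
Qed.

Lemma pure_spinor_uniq L U : maximal_isotropic L -> \dim U = 1%N ->
  (forall v, v \in L <-> (forall w, w \in U -> clifford v w = 0)) ->
  forall w, (forall v, v \in L -> clifford v w = 0) -> w \in U.
Proof.
move=> mL dU LU w wL.
have /andP[/eqP sb fb] := vbasisP L.
have KP w' : (w' \in annihilated (vbasis L)) <-> (forall v, v \in L -> clifford v w' = 0).
  split=> [/annihilatedP h v vL|h]; last first.
    by apply/annihilatedP => v /vbasis_mem; exact: h.
  rewrite (coord_vbasis vL) clifford_suml big1 // => i _.
  by rewrite cliffordZl h ?scaler0 // mem_nth ?size_tuple.
have UK : (U <= annihilated (vbasis L))%VS.
  by apply/subvP => w' w'U; apply/KP => v /LU; exact.
have dK : (\dim (annihilated (vbasis L)) <= \dim U)%N.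
  have := dim_annihilated fb; rewrite size_tuple => /(_ _).
  have := dim_maximal_isotropic mL => nL h; rewrite dU.
  have {}h : (\dim (annihilated (vbasis L)) * 2 ^ \dim L = 2 ^ n)%N.
    by apply: h => u v /vbasis_mem uL /vbasis_mem vL; exact: mL.1.
  (* As dim L >= n, here 2^n <= 2^(dim L), so the annihilator has dimension at most one; it contains
     the line U. *)
  have : (\dim (annihilated (vbasis L)) * 2 ^ \dim L <= 1 * 2 ^ \dim L)%N.
    by rewrite h mul1n leq_exp2l.
  by rewrite leq_pmul2r // expn_gt0.
have /eqP -> : U == annihilated (vbasis L) by rewrite eqEdim UK dK.
exact/KP.
Qed.

(** Parity anticommutes with every Clifford operator, hence preserves the annihilator of L, which is
    the line U. *)
Lemma parity_pure L U r : maximal_isotropic L -> \dim U = 1%N ->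
  (forall v, v \in L <-> (forall w, w \in U -> clifford v w = 0)) ->
  r \in U -> exists a, parity r = a *: r.
Proof.
move=> mL dU LU rU.
have [->|r0] := eqVneq r 0; first by exists 0; rewrite linear0 scaler0.
have : parity r \in U.
  apply: (pure_spinor_uniq mL dU LU) => v /LU vL; apply: oppr_inj.
  by rewrite -parity_clifford vL // linear0 oppr0.
suff -> : U = <[r]>%VS by move=> /vlineP[a ->]; exists a.
by apply/esym/eqP; rewrite eqEdim -memvE rU dim_vline r0 dU.
Qed.

(* The parity hypothesis excludes the component of [al] along [r]. *)
Lemma spinor_solution L U r al v : maximal_isotropic L -> \dim U = 1%N ->
  (forall v, v \in L <-> (forall w, w \in U -> clifford v w = 0)) ->
  r \in U -> r != 0 ->
  (forall a, parity r = a *: r -> parity al = - a *: al) ->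
  (forall u, u \in L -> clifford u al = (2 * inner u v) *: r) ->
  al = clifford v r.
Proof.
move=> mL dU LU rU r0 par hv.
have : al - clifford v r \in U.
  apply: (pure_spinor_uniq mL dU LU) => u uL.
  have ur : clifford u r = 0 by move: uL => /LU; apply.
  by rewrite linearB /= hv // cliffordC ur linear0 subr0 subrr.
have -> : U = <[r]>%VS.
  by apply/esym/eqP; rewrite eqEdim -memvE rU dim_vline r0 dU.
have [a ra] := parity_pure mL dU LU rU.
move=> /vlineP[b /eqP]; rewrite subr_eq => /eqP hal.
have pp w : parity (parity w) = w.
  apply/ffunP => S; rewrite !ffunE mulrA -exprD addnn -mul2n exprM sqrrN !expr1n.
  exact: mul1r.
have a0 : a != 0.
  by apply/eqP => a0; move: r0; rewrite -[r]pp ra a0 scale0r linear0 eqxx.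
(* Parity multiplies [b *: r] by a and [clifford v r] by -a, while it must multiply their sum [al]
   by -a. What remains is 2 a b r = 0. *)
have := par _ ra; rewrite {1}hal linearD linearZ /= parity_clifford ra linearZ /=.
rewrite hal scalerDr !scalerA mulNr scaleNr scaleNr.
rewrite linearZ /= => /addIr/eqP; rewrite -addr_eq0 -scalerDl -mulr2n -mulr_natl.
rewrite scaler_eq0 (negPf r0) orbF.
rewrite !mulf_eq0 pnatr_eq0 (negPf a0) /= => /eqP b0.
by rewrite b0 scale0r add0r.
Qed.

End PureSpinors.

(** * Smooth functions *)

Section RealSmooth.
Context {R : realType}.
Implicit Types (V W : normedModType R).

(** Differentiability depends on the germ only; transition maps and coordinate expressions are known
    only near a point. *)
Lemma near_eq_differentiable V W (f g : V -> W) x :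
  {near x, f =1 g} -> differentiable f x -> differentiable g x.
Proof.
move=> fg df.
have fgx : f x = g x by exact: nbhs_singleton fg.
have dfc := diff_continuous df.
have h : g \o shift x = cst (g x) + 'd f x +o_ 0 id.
  have /eqaddoP H := diff_locally df; apply/eqaddoP => e e0.
  have fg0 : \forall h \near (0 : V), f (h + x) = g (h + x).
    by have := fg; rewrite (near_shift 0 x) subr0.
  near=> h.
  suff -> : (g \o shift x - (cst (g x) + 'd f x)) h =
     (f \o shift x - (cst (f x) + 'd f x)) h by near: h; exact: H.
  have fgh : f (h + x) = g (h + x) by near: h.
  by rewrite !fctE /= fgh fgx.
have dg : 'd g x = 'd f x :> (V -> W) by exact: diff_unique.
by apply/diff_locallyP; rewrite dg.
Unshelve. all: by end_near. Qed.

Lemma iter_derive_rcons V W (f : V -> W) s v :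
  iter_derive f (rcons s v) = iter_derive ('D_v f) s.
Proof. by elim: s => //= u s ->. Qed.

(** Smoothness graded by the order k, with the first derivative taken innermost. The calculus rules
    then follow by induction on k, since each rule expresses one derivative by functions of the same
    kind. *)
Fixpoint cont_diff V W (k : nat) (A : set V) (f : V -> W) : Prop :=
  (forall x, A x -> differentiable f x) /\
  if k is k'.+1 then forall v, cont_diff k' A ('D_v f) else True.

Lemma smooth_onP V W (A : set V) (f : V -> W) :
  smooth_on A f <-> forall k, cont_diff k A f.
Proof.
split=> [fA k|fA s x Ax].
  elim: k f fA => [|k IH] f fA; split=> //; first exact: (fA [::]).
    exact: (fA [::]).
  by move=> v; apply: IH => s x Ax; rewrite -iter_derive_rcons; exact: fA.
elim/last_ind: s f fA => [|s v IH] f fA; first by have [fd _] := fA 0%N; exact: fd.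
by rewrite iter_derive_rcons; apply: IH => k; have [_] := fA k.+1; apply.
Qed.

Lemma smooth_on_differentiable V W (A : set V) (f : V -> W) x :
  smooth_on A f -> A x -> differentiable f x.
Proof. by move=> fA Ax; exact: (fA [::]). Qed.

Lemma smooth_on_derive V W (A : set V) (f : V -> W) v :
  smooth_on A f -> smooth_on A ('D_v f).
Proof. by move=> fA s x Ax; rewrite -iter_derive_rcons; exact: fA. Qed.

Lemma smooth_on_sub V W (A B : set V) (f : V -> W) :
  A `<=` B -> smooth_on B f -> smooth_on A f.
Proof. by move=> AB fB s x /AB; exact: fB. Qed.

Lemma eq_near_open V W (A : set V) (f g : V -> W) x : open A ->
  (forall y, A y -> f y = g y) -> A x -> {near x, f =1 g}.
Proof. by move=> oA fg Ax; near do apply: fg; exact: open_nbhs_nbhs.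
Unshelve. all: by end_near. Qed.

Lemma cont_diff_ext V W k (A : set V) (f g : V -> W) : open A ->
  (forall x, A x -> f x = g x) -> cont_diff k A f -> cont_diff k A g.
Proof.
move=> oA; elim: k f g => [|k IH] f g fg [fd fk]; split => //.
- by move=> x Ax; apply: near_eq_differentiable (fd _ Ax); exact: eq_near_open fg Ax.
- by move=> x Ax; apply: near_eq_differentiable (fd _ Ax); exact: eq_near_open fg Ax.
move=> v; apply: IH (fk v) => x Ax; apply: near_eq_derive.
exact: eq_near_open fg Ax.
Qed.

Lemma smooth_on_ext V W (A : set V) (f g : V -> W) : open A ->
  (forall x, A x -> f x = g x) -> smooth_on A f -> smooth_on A g.
Proof.
by move=> oA fg /smooth_onP fA; apply/smooth_onP => k; exact: cont_diff_ext (fA k).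
Qed.

Lemma smooth_on_local V W (A : set V) (f : V -> W) :
  (forall x, A x -> exists B : set V, B x /\ smooth_on B f) -> smooth_on A f.
Proof. by move=> h s x Ax; have [B [Bx fB]] := h _ Ax; exact: fB. Qed.

Lemma cont_diff_cst V W k (A : set V) (a : W) : cont_diff k A (cst a).
Proof.
elim: k a => [|k IH] a; split => // v.
have -> : 'D_v (cst a) = cst (0 : W) by apply/funext => x; exact: derive_cst.
exact: IH.
Qed.

Lemma smooth_on_cst V W (A : set V) (a : W) : smooth_on A (cst a).
Proof. by apply/smooth_onP => k; exact: cont_diff_cst. Qed.

Lemma cont_diffD V W k (A : set V) (f g : V -> W) : open A ->
  cont_diff k A f -> cont_diff k A g -> cont_diff k A (f + g).
Proof.
move=> oA; elim: k f g => [|k IH] f g [fd fk] [gd gk].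
- by split=> [x Ax|//]; apply: differentiableD; auto.
split=> [x Ax|]; first by apply: differentiableD; auto.
move=> v; apply: (@cont_diff_ext _ _ _ _ ('D_v f + 'D_v g)) => //; last exact: IH (fk v) (gk v).
by move=> x Ax; rewrite deriveD //; apply: diff_derivable; auto.
Qed.

(** Leibniz's rule leaves one factor underived, which has to be brought down to the lower order of
    the induction hypothesis. *)
Lemma cont_diffS V W k (A : set V) (f : V -> W) : cont_diff k.+1 A f -> cont_diff k A f.
Proof.
elim: k f => [|k IH] f [fd fk]; split => //.
by move=> v; apply: IH.
Qed.

Lemma cont_diffM V k (A : set V) (f g : V -> R^o) : open A ->
  cont_diff k A f -> cont_diff k A g -> cont_diff k A (f * g : V -> R^o).
Proof.
move=> oA; elim: k f g => [|k IH] f g fk gk; have [fd fk'] := fk; have [gd gk'] := gk.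
- by split=> [x Ax|//]; apply: differentiableM; auto.
split=> [x Ax|]; first by apply: differentiableM; auto.
move=> v; apply: (@cont_diff_ext _ _ _ _ (f * 'D_v g + g * 'D_v f : V -> R^o)) => //.
  move=> x Ax; rewrite [RHS]deriveM //; apply: diff_derivable; auto.
apply: cont_diffD => //; first exact: IH (cont_diffS fk) (gk' v).
exact: IH (cont_diffS gk) (fk' v).
Qed.

Lemma smooth_onD V W (A : set V) (f g : V -> W) : open A ->
  smooth_on A f -> smooth_on A g -> smooth_on A (f + g).
Proof.
move=> oA /smooth_onP fA /smooth_onP gA; apply/smooth_onP => k; exact: cont_diffD.
Qed.

Lemma smooth_onM V (A : set V) (f g : V -> R^o) : open A ->
  smooth_on A f -> smooth_on A g -> smooth_on A (f * g : V -> R^o).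
Proof.
move=> oA /smooth_onP fA /smooth_onP gA; apply/smooth_onP => k; exact: cont_diffM.
Qed.

Lemma smooth_onN V (A : set V) (f : V -> R^o) : open A ->
  smooth_on A f -> smooth_on A (- f : V -> R^o).
Proof.
move=> oA fA.
apply: (@smooth_on_ext _ _ _ (cst (-1 : R^o) * f : V -> R^o)) => //.
  by move=> x _; rewrite !fctE mulN1r.
by apply: smooth_onM => //; exact: smooth_on_cst.
Qed.

Lemma cont_diff_inv V k (A : set V) (f : V -> R^o) : open A ->
  (forall x, A x -> f x != 0) -> cont_diff k A f ->
  cont_diff k A (fun x => (f x)^-1 : R^o).
Proof.
move=> oA f0; elim: k => [|k IH] fk; have [fd fk'] := fk.
- by split=> [x Ax|//]; apply: differentiableV; auto.
split=> [x Ax|]; first by apply: differentiableV; auto.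
have IHk := IH (cont_diffS fk).
(* The derivative - f^(-2) D_v f involves only 1/f, known at order k by induction, and D_v f. *)
move=> v; apply: (@cont_diff_ext _ _ _ _ (cst (-1 : R^o) *
   ((fun x => (f x)^-1 : R^o) * (fun x => (f x)^-1 : R^o)) * 'D_v f : V -> R^o)) => //.
  move=> x Ax; have fx0 := f0 x Ax; have dfx : derivable f x v by apply: diff_derivable; auto.
  rewrite deriveV //.
  by rewrite !fctE mulN1r -expr2 exprVn.
apply: cont_diffM => //; last exact: fk' v.
by apply: cont_diffM => //; [exact: cont_diff_cst | exact: cont_diffM].
Qed.

Lemma smooth_on_inv V (A : set V) (f : V -> R^o) : open A ->
  (forall x, A x -> f x != 0) -> smooth_on A f ->
  smooth_on A (fun x => (f x)^-1 : R^o).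
Proof. by move=> oA f0 /smooth_onP fA; apply/smooth_onP => k; exact: cont_diff_inv. Qed.

Lemma cont_diff_sum V (I : Type) (r : seq I) k (A : set V) (F : I -> V -> R^o) : open A ->
  (forall i, cont_diff k A (F i)) -> cont_diff k A (fun x => \sum_(i <- r) F i x : R^o).
Proof.
move=> oA FA; elim: r => [|i r IH].
  by apply: cont_diff_ext (cont_diff_cst k A (0 : R^o)) => // x _; rewrite big_nil.
have := cont_diffD oA (FA i) IH; apply: cont_diff_ext => // x _.
by rewrite big_cons.
Qed.

(* The decomposition of 'D_v g covers at once targets 'rV_m (coordinates) and
   R^o. *)
Lemma cont_diff_comp V V' k (A : set V) (B : set V') m (e : 'I_m -> V')
    (c : 'I_m -> V -> V -> R^o) (f : V' -> R^o) (g : V -> V') :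
  open A -> (forall x, A x -> B (g x)) -> (forall x, A x -> differentiable g x) ->
  (forall v x, A x -> 'D_v g x = \sum_j c j v x *: e j) ->
  (forall j v, smooth_on A (c j v)) ->
  cont_diff k B f -> cont_diff k A (f \o g).
Proof.
move=> oA gB gd gc cA; elim: k f => [|k IH] f [fd fk].
- by split=> [x Ax|//]; apply: differentiable_comp; auto.
split=> [x Ax|]; first by apply: differentiable_comp; auto.
move=> v; apply: (@cont_diff_ext _ _ _ _
    (fun x => \sum_j (c j v * ('D_(e j) f \o g)) x : R^o)) => //.
  move=> x Ax; have dg := gd x Ax; have df := fd (g x) (gB x Ax).
  have dfg : differentiable (f \o g) x by exact: differentiable_comp dg df.
  rewrite (deriveE v dfg) (diff_comp dg df) /=.
  rewrite -(deriveE v dg) gc // linear_sum; apply: eq_bigr => j _.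
  by rewrite linearZ /= -(deriveE _ df).
apply: cont_diff_sum => // j; apply: cont_diffM => //.
  by move/smooth_onP: (cA j v); apply.
exact: IH (fk (e j)).
Qed.

Lemma smooth_on_comp1 V (A : set V) (B : set R^o) (f : R^o -> R^o) (g : V -> R^o) :
  open A -> (forall x, A x -> B (g x)) -> smooth_on A g -> smooth_on B f ->
  smooth_on A (f \o g).
Proof.
move=> oA gB gA /smooth_onP fB; apply/smooth_onP => k.
apply: (@cont_diff_comp _ _ _ _ B 1 (fun=> 1) (fun _ v => 'D_v g)) => //.
- by move=> x Ax; exact: smooth_on_differentiable gA Ax.
- by move=> v x Ax; rewrite big_ord1 [RHS]mulr1.
- by move=> _ v; exact: smooth_on_derive.
Qed.

Lemma smooth_on_coord V m (A : set V) (f : V -> 'rV[R]_m) j : open A ->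
  smooth_on A f -> smooth_on A (fun x => f x 0 j : R^o).
Proof.
move=> oA /smooth_onP fA; apply/smooth_onP => k; elim: k f fA => [|k IH] f fA.
  split=> // x Ax; have [fd _] := fA 0%N.
  by apply: (@differentiable_comp _ _ _ _ f (fun y => y 0 j));
    [exact: fd | exact: differentiable_coord].
have [fd _] := fA 0%N.
split=> [x Ax|v].
  by apply: (@differentiable_comp _ _ _ _ f (fun y => y 0 j));
    [exact: fd | exact: differentiable_coord].
apply: (@cont_diff_ext _ _ _ _ (fun x => ('D_v f) x 0 j)) => //.
  by move=> x Ax; rewrite derive_mx ?mxE //; exact/diff_derivable/fd.
by apply: IH => k'; have [_] := fA k'.+1; apply.
Qed.

Lemma smooth_on_compm V m (A : set V) (B : set 'rV[R]_m) (f : 'rV[R]_m -> R^o)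
    (g : V -> 'rV[R]_m) :
  open A -> (forall x, A x -> B (g x)) -> smooth_on A g -> smooth_on B f ->
  smooth_on A (f \o g).
Proof.
move=> oA gB gA /smooth_onP fB; apply/smooth_onP => k.
apply: (@cont_diff_comp _ _ _ _ B m (fun j => delta_mx 0 j)
   (fun j v x => ('D_v g) x 0 j)) => //.
- by move=> x Ax; exact: smooth_on_differentiable gA Ax.
- by move=> v x Ax; exact: row_sum_delta.
- by move=> j v; apply: smooth_on_coord => //; exact: smooth_on_derive.
Qed.

(** Turns a directional derivative into a derivative in one variable, to which the mean value
    theorem applies. *)
Lemma smooth_on_line V W (A : set V) (f : V -> W) (a v : V) (t : R) :
  smooth_on A f -> A (a + t *: v) ->
  is_derive t 1 (fun s : R => f (a + s *: v)) ('D_v f (a + t *: v)).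
Proof.
move=> fA At; have df := smooth_on_differentiable fA At.
have -> : (fun s : R => f (a + s *: v)) = f \o (cst a + (fun s : R^o => s *: v)) by [].
have dg : is_diff (t : R^o) (cst a + (fun s : R^o => s *: v)) (0 + (fun s : R^o => s *: v)).
  exact: is_diffD.
have dfg : differentiable (f \o (cst a + (fun s : R^o => s *: v))) (t : R^o).
  by apply: differentiable_comp.
apply: DeriveDef; first exact: diff_derivable.
rewrite deriveE // diff_comp // deriveE //= diff_val.
by rewrite !fctE add0r scale1r.
Qed.

End RealSmooth.

(** * Symmetry of second derivatives *)

Section Schwarz.
Context {R : realType} {V : normedModType R}.

(** The mean value theorem, used once along u and once along v, gives h^2 times a value of D_v D_u f
    in the parallelogram spanned by h u and h v at x. Continuity brings that value within e of the
    one at x. *)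
Lemma second_difference (A : set V) (f : V -> R^o) (u v x : V) (e : R) :
  open A -> smooth_on A f -> A x -> 0 < e ->
  exists2 d : R, 0 < d & forall h : R, 0 < h -> h < d ->
    exists2 z : R, `|z - 'D_v ('D_u f) x| < e &
      f (x + h *: u + h *: v) - f (x + h *: u) - f (x + h *: v) + f x = z * h * h.
Proof.
move=> oA fA Ax e0; pose a := 'D_v ('D_u f) x.
have fuA := smooth_on_derive u fA.
have /differentiable_continuous ca :=
  smooth_on_differentiable (smooth_on_derive v fuA) Ax.
have nA : \forall y \near x, A y by exact: open_nbhs_nbhs.
have : \forall y \near x, A y /\ `|'D_v ('D_u f) y - a| < e.
  near=> y; split; first by near: y.
  rewrite distrC; near: y; have /cvgrPdist_lt := ca; exact.
move=> /nbhs_ballP[r /= r0 hr].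
have n0 : 0 < `|u| + `|v| + 1 by rewrite ltr_wpDl // addr_ge0.
(* For h below this bound the parallelogram stays in the ball of radius r; the 1 keeps the
   denominator positive when u = v = 0. *)
exists (r / (`|u| + `|v| + 1)); first by rewrite divr_gt0.
move=> h h0; rewrite ltr_pdivlMr // => hlt.
have inB s t : s \in `[0, h] -> t \in `[0, h] -> ball x r (x + s *: u + t *: v).
  rewrite !in_itv /= => /andP[s0 sh] /andP[t0 th].
  rewrite -ball_normE /= -addrA opprD addNKr normrN.
  apply: (le_lt_trans (ler_normD _ _)); rewrite !normrZ !ger0_norm //.
  apply: le_lt_trans hlt; rewrite 2!mulrDr mulr1 -[leLHS]addr0.
  by rewrite lerD ?(ltW h0) // lerD // ler_wpM2r.
have inA s t : s \in `[0, h] -> t \in `[0, h] -> A (x + s *: u + t *: v).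
  by move=> sh th; have [] := hr _ (inB _ _ sh th).
have zi : 0 \in `[0, h] by rewrite in_itv /= lexx ltW.
have hi : h \in `[0, h] by rewrite in_itv /= lexx ltW.
have oc c : c \in `]0, h[ -> c \in `[0, h].
  by rewrite !in_itv /= => /andP[c0 c1]; rewrite !ltW.
(* The difference along v as a function of the displacement s along u; the second difference is g h
   - g 0. *)
pose g s := f ((x + h *: v) + s *: u) - f (x + s *: u).
pose dg s := 'D_u f ((x + h *: v) + s *: u) - 'D_u f (x + s *: u).
have gd s : s \in `[0, h] -> is_derive s 1 g (dg s).
  move=> sh; apply: is_deriveB; apply: (smooth_on_line fA).
    by rewrite addrAC; exact: inA.
  by have := inA _ _ sh zi; rewrite scale0r addr0.
have [|c /oc ch hc] := @MVT _ g dg 0 h h0 (fun s hs => gd s (oc s hs)).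
  by apply: derivable_within_continuous => s /gd [].
pose k t := 'D_u f ((x + c *: u) + t *: v).
pose dk t := 'D_v ('D_u f) ((x + c *: u) + t *: v).
have kd t : t \in `[0, h] -> is_derive t 1 k (dk t).
  by move=> th; apply: (smooth_on_line fuA); exact: inA.
have [|d /oc dh hd] := @MVT _ k dk 0 h h0 (fun s hs => kd s (oc s hs)).
  by apply: derivable_within_continuous => s /kd [].
exists (dk d); first by have [] := hr _ (inB _ _ ch dh).
move: hc hd; rewrite /g /k /dg !scale0r !addr0 !subr0 => hc hd.
rewrite -hd (addrAC x (c *: u)) -hc (addrAC x (h *: v)); ring.
Unshelve. all: by end_near. Qed.

(** The second difference is symmetric in u and v. For small h its quotient by h^2 is within e/2 of
    both mixed derivatives, which therefore differ by at most e. *)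
Lemma derive_comm (A : set V) (f : V -> R^o) (u v x : V) :
  open A -> smooth_on A f -> A x -> 'D_u ('D_v f) x = 'D_v ('D_u f) x.
Proof.
move=> oA fA Ax; apply/eqP; rewrite -subr_eq0 -normr_le0; apply/ler_addgt0Pr => e e0.
rewrite add0r.
have [d d0 hd] := second_difference u v oA fA Ax (divr_gt0 e0 (ltr0n R 2)).
have [d' d'0 hd'] := second_difference v u oA fA Ax (divr_gt0 e0 (ltr0n R 2)).
pose h := Num.min d d' / 2.
have m0 : 0 < Num.min d d' by rewrite lt_min d0.
have h0 : 0 < h by rewrite divr_gt0.
have hm : h < Num.min d d' by rewrite ltr_pdivrMr // ltr_pMr // ltr1n.
move: hm; rewrite lt_min => /andP[hhd hhd'].
have [z ze zE] := hd h h0 hhd; have [z' z'e z'E] := hd' h h0 hhd'.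
have zz' : z = z'.
  have h2 : h * h != 0 by rewrite mulf_neq0 // gt_eqF.
  have e1 : z * h * h = z' * h * h by rewrite -zE -z'E (addrAC x (h *: v)); ring.
  by apply: (mulIf h2); rewrite [LHS]mulrA [RHS]mulrA.
move: ze z'e; rewrite {}zz'.
move: ('D_v ('D_u f) x) ('D_u ('D_v f) x) => p q ze z'e.
have -> : q - p = (z' - p) - (z' - q) by rewrite opprB [RHS]addrC subrKA.
rewrite (le_trans (ler_normB _ _)) // [leRHS]splitr lerD // ltW //.
Qed.

End Schwarz.

(** * Complex-valued smooth functions and their partial derivatives *)

Section ComplexSmooth.
Context {R : realType}.
Local Notation C := R[i].
Implicit Types (V : normedModType R).

Lemma ReD (a b : C) : complex.Re (a + b) = complex.Re a + complex.Re b.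
Proof. by case: a b => ? ? [? ?]. Qed.
Lemma ImD (a b : C) : complex.Im (a + b) = complex.Im a + complex.Im b.
Proof. by case: a b => ? ? [? ?]. Qed.
Lemma ReM (a b : C) :
  complex.Re (a * b) = complex.Re a * complex.Re b - complex.Im a * complex.Im b.
Proof. by case: a b => ? ? [? ?]. Qed.
Lemma ImM (a b : C) :
  complex.Im (a * b) = complex.Re a * complex.Im b + complex.Im a * complex.Re b.
Proof. by case: a b => ? ? [? ?]. Qed.

Lemma csmooth_on_ext V (A : set V) (f g : V -> C) : open A ->
  (forall x, A x -> f x = g x) -> csmooth_on A f -> csmooth_on A g.
Proof.
move=> oA fg [fr fi]; split; [apply: smooth_on_ext fr|apply: smooth_on_ext fi] => //;
  by move=> x Ax; rewrite fg.
Qed.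

Lemma csmooth_on_sub V (A B : set V) (f : V -> C) :
  A `<=` B -> csmooth_on B f -> csmooth_on A f.
Proof. by move=> AB [fr fi]; split; [apply: smooth_on_sub fr|apply: smooth_on_sub fi]. Qed.

Lemma csmooth_on_local V (A : set V) (f : V -> C) :
  (forall x, A x -> exists B : set V, B x /\ csmooth_on B f) -> csmooth_on A f.
Proof.
by move=> h; split; apply: smooth_on_local => x /h[B [Bx [fr fi]]]; exists B.
Qed.

Lemma csmooth_on_cst V (A : set V) (a : C) : csmooth_on A (fun=> a).
Proof. by split; apply: smooth_on_cst. Qed.

Lemma csmooth_on_real V (A : set V) (f : V -> R^o) :
  smooth_on A f -> csmooth_on A (fun x => (f x)%:C).
Proof. by move=> fA; split => //; exact: smooth_on_cst. Qed.

Lemma csmooth_onD V (A : set V) (f g : V -> C) : open A ->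
  csmooth_on A f -> csmooth_on A g -> csmooth_on A (fun x => f x + g x).
Proof.
move=> oA [fr fi] [gr gi]; split.
  by apply: smooth_on_ext (smooth_onD oA fr gr) => // x _; rewrite ReD.
by apply: smooth_on_ext (smooth_onD oA fi gi) => // x _; rewrite ImD.
Qed.

Lemma csmooth_onM V (A : set V) (f g : V -> C) : open A ->
  csmooth_on A f -> csmooth_on A g -> csmooth_on A (fun x => f x * g x).
Proof.
move=> oA [fr fi] [gr gi]; split.
  have h := smooth_onD oA (smooth_onM oA fr gr) (smooth_onN oA (smooth_onM oA fi gi)).
  by apply: smooth_on_ext h => // x _; rewrite ReM.
have h := smooth_onD oA (smooth_onM oA fr gi) (smooth_onM oA fi gr).
by apply: smooth_on_ext h => // x _; rewrite ImM.
Qed.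

Lemma csmooth_onN V (A : set V) (f : V -> C) : open A ->
  csmooth_on A f -> csmooth_on A (fun x => - f x).
Proof.
move=> oA fA; have := csmooth_onM oA (csmooth_on_cst A (-1)) fA.
by apply: csmooth_on_ext => // x _; rewrite mulN1r.
Qed.

Lemma csmooth_on_sum V (A : set V) (I : Type) (r : seq I) (P : pred I) (F : I -> V -> C) :
  open A -> (forall i, csmooth_on A (F i)) ->
  csmooth_on A (fun x => \sum_(i <- r | P i) F i x).
Proof.
move=> oA FA; elim: r => [|i r IH].
  by apply: csmooth_on_ext (csmooth_on_cst A 0) => // x _; rewrite big_nil.
have [Pi|Pi] := boolP (P i).
  apply: csmooth_on_ext (csmooth_onD oA (FA i) IH) => // x _.
  by rewrite big_cons Pi.
by apply: csmooth_on_ext IH => // x _; rewrite big_cons (negPf Pi).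
Qed.

Lemma csmooth_on_prod V (A : set V) (I : Type) (r : seq I) (F : I -> V -> C) :
  open A -> (forall i, csmooth_on A (F i)) ->
  csmooth_on A (fun x => \prod_(i <- r) F i x).
Proof.
move=> oA FA; elim: r => [|i r IH].
  by apply: csmooth_on_ext (csmooth_on_cst A 1) => // x _; rewrite big_nil.
by apply: csmooth_on_ext (csmooth_onM oA (FA i) IH) => // x _; rewrite big_cons.
Qed.

Lemma csmooth_on_det V (A : set V) m (F : V -> 'M[C]_m) : open A ->
  (forall i j, csmooth_on A (fun x => F x i j)) ->
  csmooth_on A (fun x => \det (F x)).
Proof.
move=> oA FA; apply: csmooth_on_sum => // s.
apply: csmooth_onM => //; first exact: csmooth_on_cst.
by apply: csmooth_on_prod => // i; exact: FA.
Qed.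

Lemma csmooth_on_inv V (A : set V) (f : V -> C) : open A ->
  (forall x, A x -> f x != 0) -> csmooth_on A f -> csmooth_on A (fun x => (f x)^-1).
Proof.
move=> oA f0 [fr fi].
(* N is the squared modulus, and 1/f is the conjugate of f divided by N. *)
pose N x : R^o := complex.Re (f x) * complex.Re (f x) + complex.Im (f x) * complex.Im (f x).
have NA : smooth_on A N := smooth_onD oA (smooth_onM oA fr fr) (smooth_onM oA fi fi).
have N0 x : A x -> N x != 0.
  move=> /f0; rewrite /N; case: (f x) => a b /=; apply: contraNneq => /eqP.
  rewrite paddr_eq0 ?sqr_ge0 // -?expr2 ?sqr_ge0 //.
  by rewrite !sqrf_eq0 => /andP[/eqP-> /eqP->].
have iA := smooth_on_inv oA N0 NA.
split.
  apply: smooth_on_ext (smooth_onM oA fr iA) => // x _.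
  by rewrite !fctE /N; case: (f x) => a b /=; rewrite !expr2.
apply: smooth_on_ext (smooth_onN oA (smooth_onM oA fi iA)) => // x _.
by rewrite !fctE /N; case: (f x) => a b /=; rewrite !expr2.
Qed.

Lemma csmooth_on_comp V m (A : set V) (B : set 'rV[R]_m) (f : 'rV[R]_m -> C)
    (g : V -> 'rV[R]_m) :
  open A -> (forall x, A x -> B (g x)) -> smooth_on A g -> csmooth_on B f ->
  csmooth_on A (f \o g).
Proof.
move=> oA gB gA [fr fi]; split; first exact: (smooth_on_compm oA gB gA fr).
exact: (smooth_on_compm oA gB gA fi).
Qed.

Definition cdifferentiable V (f : V -> C) x :=
  differentiable (fun y => complex.Re (f y) : R^o) x /\
  differentiable (fun y => complex.Im (f y) : R^o) x.

Lemma csmooth_on_differentiable V (A : set V) (f : V -> C) x :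
  csmooth_on A f -> A x -> cdifferentiable f x.
Proof.
move=> [fr fi] Ax; split; first exact: smooth_on_differentiable fr Ax.
exact: smooth_on_differentiable fi Ax.
Qed.

End ComplexSmooth.

Section ComplexPartial.
Context {R : realType} {n : nat}.
Local Notation C := R[i].
Local Notation E := 'rV[R]_n.
Implicit Types (f g : E -> C) (x : E) (j : 'I_n).

Lemma csmooth_on_cpartial (A : set E) f j : csmooth_on A f -> csmooth_on A (cpartial j f).
Proof. by move=> [fr fi]; split; exact: smooth_on_derive. Qed.

Lemma eq_complexP (a b : C) :
  complex.Re a = complex.Re b -> complex.Im a = complex.Im b -> a = b.
Proof. by case: a b => ? ? [? ?] /= -> ->. Qed.

Lemma cpartial_ext f g j x : {near x, f =1 g} -> cpartial j f x = cpartial j g x.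
Proof.
move=> fg; rewrite /cpartial; congr (_ +i* _); apply: near_eq_derive;
  by apply: filterS fg => y ->.
Qed.

Lemma cpartial_cst a j x : cpartial j (fun=> a) x = 0.
Proof. by rewrite /cpartial !derive_cst. Qed.

Lemma cdifferentiable_cst a x : cdifferentiable (fun _ : E => a) x.
Proof. by split; exact: differentiable_cst. Qed.

Let ReDfun f g : (fun y => complex.Re (f y + g y) : R^o) =
    (fun y => complex.Re (f y) : R^o) + (fun y => complex.Re (g y) : R^o) :> (E -> R^o).
Proof. by apply/funext => y; rewrite ReD. Qed.

Let ImDfun f g : (fun y => complex.Im (f y + g y) : R^o) =
    (fun y => complex.Im (f y) : R^o) + (fun y => complex.Im (g y) : R^o) :> (E -> R^o).
Proof. by apply/funext => y; rewrite ImD. Qed.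

Lemma cdifferentiableD f g x : cdifferentiable f x -> cdifferentiable g x ->
  cdifferentiable (fun y => f y + g y) x.
Proof.
move=> [fr fi] [gr gi]; split; rewrite ?ReDfun ?ImDfun; exact: differentiableD.
Qed.

Lemma cpartialD f g j x : cdifferentiable f x -> cdifferentiable g x ->
  cpartial j (fun y => f y + g y) x = cpartial j f x + cpartial j g x.
Proof.
move=> [/diff_derivable fr /diff_derivable fi] [/diff_derivable gr /diff_derivable gi].
by rewrite {1}/cpartial ReDfun ImDfun !deriveD.
Qed.

Let ReMfun f g : (fun y => complex.Re (f y * g y) : R^o) =
    (fun y => complex.Re (f y) : R^o) * (fun y => complex.Re (g y) : R^o)
  - (fun y => complex.Im (f y) : R^o) * (fun y => complex.Im (g y) : R^o) :> (E -> R^o).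
Proof. by apply/funext => y; rewrite ReM. Qed.

Let ImMfun f g : (fun y => complex.Im (f y * g y) : R^o) =
    (fun y => complex.Re (f y) : R^o) * (fun y => complex.Im (g y) : R^o)
  + (fun y => complex.Im (f y) : R^o) * (fun y => complex.Re (g y) : R^o) :> (E -> R^o).
Proof. by apply/funext => y; rewrite ImM. Qed.

Lemma cdifferentiableM f g x : cdifferentiable f x -> cdifferentiable g x ->
  cdifferentiable (fun y => f y * g y) x.
Proof.
move=> [fr fi] [gr gi]; split; rewrite ?ReMfun ?ImMfun.
  by apply: differentiableB; exact: differentiableM.
by apply: differentiableD; exact: differentiableM.
Qed.

Lemma cpartialM f g j x : cdifferentiable f x -> cdifferentiable g x ->
  cpartial j (fun y => f y * g y) x = cpartial j f x * g x + f x * cpartial j g x.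
Proof.
move=> [/diff_derivable fr /diff_derivable fi] [/diff_derivable gr /diff_derivable gi].
rewrite {1}/cpartial ReMfun ImMfun.
rewrite deriveB; try exact: derivableM.
rewrite deriveD; try exact: derivableM.
rewrite !deriveM // /cpartial.
move: ('D__ (fun y => complex.Re (f y) : R^o) x) ('D__ (fun y => complex.Im (f y) : R^o) x)
  ('D__ (fun y => complex.Re (g y) : R^o) x) ('D__ (fun y => complex.Im (g y) : R^o) x)
  => a b c d.
case: (f x) (g x) => p q [r s]; apply: eq_complexP; rewrite !(ReD, ImD, ReM, ImM) /=;
  rewrite /GRing.scale /=; ring.
Qed.

Lemma cdifferentiable_sum (I : Type) (r : seq I) (P : pred I) (F : I -> E -> C) x :
  (forall i, cdifferentiable (F i) x) ->
  cdifferentiable (fun y => \sum_(i <- r | P i) F i y) x.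
Proof.
move=> h; elim: r => [|i r IH].
  by under eq_fun do rewrite big_nil; exact: cdifferentiable_cst.
under eq_fun do rewrite big_cons.
by case: (P i) => //; exact: cdifferentiableD.
Qed.

Lemma cpartial_sum (I : Type) (r : seq I) (P : pred I) (F : I -> E -> C) j x :
  (forall i, cdifferentiable (F i) x) ->
  cpartial j (fun y => \sum_(i <- r | P i) F i y) x = \sum_(i <- r | P i) cpartial j (F i) x.
Proof.
move=> h; elim: r => [|i r IH].
  by under eq_fun do rewrite big_nil; rewrite cpartial_cst big_nil.
under eq_fun do rewrite big_cons; rewrite big_cons; case: ifP => // _.
by rewrite cpartialD ?IH //; exact: cdifferentiable_sum.
Qed.

Lemma cdifferentiable_comp m (f : 'rV[R]_m -> C) (g : E -> 'rV[R]_m) x :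
  differentiable g x -> cdifferentiable f (g x) -> cdifferentiable (f \o g) x.
Proof.
by move=> dg [fr fi]; split; [exact: differentiable_comp dg fr | exact: differentiable_comp dg fi].
Qed.

Lemma cpartial_comp m (f : 'rV[R]_m -> C) (g : E -> 'rV[R]_m) j x :
  differentiable g x -> cdifferentiable f (g x) ->
  cpartial j (f \o g) x = \sum_k (jacobian g x j k)%:C * cpartial k f (g x).
Proof.
move=> dg [fr fi].
have key (h : 'rV[R]_m -> R^o) : differentiable h (g x) ->
    'D_(delta_mx 0 j) (h \o g) x = \sum_k jacobian g x j k * 'D_(delta_mx 0 k) h (g x).
  move=> dh; have dhg : differentiable (h \o g) x by exact: differentiable_comp dg dh.
  rewrite (deriveE _ dhg) (diff_comp dg dh) /= -(deriveE _ dg) deriveEjacobian //.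
  rewrite -rowE [row j _]row_sum_delta linear_sum; apply: eq_bigr => k _.
  by rewrite linearZ mxE /= -(deriveE _ dh).
apply: eq_complexP.
  rewrite (_ : complex.Re _ = 'D_(delta_mx 0 j) ((fun y => complex.Re (f y) : R^o) \o g) x) //.
  rewrite key // (big_morph _ ReD (erefl : complex.Re 0 = 0)).
  by apply: eq_bigr => k _; rewrite ReM /= mul0r subr0.
rewrite (_ : complex.Im _ = 'D_(delta_mx 0 j) ((fun y => complex.Im (f y) : R^o) \o g) x) //.
  rewrite key // (big_morph _ ImD (erefl : complex.Im 0 = 0)).
by apply: eq_bigr => k _; rewrite ImM /= mul0r addr0.
Qed.

Lemma cpartial_comm (A : set E) f j k x : open A -> csmooth_on A f -> A x ->
  cpartial j (cpartial k f) x = cpartial k (cpartial j f) x.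
Proof.
move=> oA [fr fi] Ax; apply: eq_complexP.
  exact: (derive_comm (delta_mx 0 j) (delta_mx 0 k) oA fr Ax).
exact: (derive_comm (delta_mx 0 j) (delta_mx 0 k) oA fi Ax).
Qed.

End ComplexPartial.

(** * Bump functions on R^n *)

Section Bump.
Context {R : realType}.
Implicit Types (p q : {poly R}) (t : R).

(** The functions p(1/t) exp(-1/t), extended by 0. Letting p range over all polynomials makes the
    family closed under differentiation. *)
Definition flat p t : R := if 0 < t then p.[t^-1] * expR (- t^-1) else 0.

(** With s = 1/t, the inequality s^(i+1) <= (i+1)! exp s bounds s^i exp(-s) by (i+1)! t. Summing
    over the coefficients of p gives the constant. *)
Lemma flat_lipschitz0 p : exists2 K, 0 <= K & forall t, `|flat p t| <= K * `|t|.
Proof.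
exists (\sum_(i < size p) `|p`_i| * (i.+1)`!%:R).
  by apply: sumr_ge0 => i _; rewrite mulr_ge0.
move=> t; rewrite /flat; case: ifPn => t0; last first.
  by rewrite normr0 mulr_ge0 // sumr_ge0 // => i _; rewrite mulr_ge0.
rewrite horner_coef mulr_suml mulr_suml (le_trans (ler_norm_sum _ _ _)) //.
apply: ler_sum => i _; rewrite !normrM -!mulrA ler_wpM2l //.
set s := t^-1; have s0 : 0 < s by rewrite invr_gt0.
rewrite [`|expR _|]ger0_norm ?expR_ge0 // ger0_norm; last by rewrite exprn_ge0 // ltW.
rewrite [`|t|]gtr0_norm //; have -> : t = s^-1 by rewrite /s invrK.
rewrite expRN ler_pdivlMr // mulrAC -exprSr.
rewrite ler_pdivrMr ?expR_gt0 //.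
have := expR_ge1Dxn i (ltW s0); rewrite addrC -lerBrDr => h.
rewrite mulrC -ler_pdivrMr ?ltr0n ?fact_gt0 //.
by rewrite (le_trans h) // gerBl.
Qed.

Lemma flat_le0 p t : t <= 0 -> flat p t = 0.
Proof. by rewrite /flat ltNge => ->. Qed.

(** For t > 0, differentiating p(1/t) gives -p'(1/t)/t^2 and differentiating exp(-1/t) gives
    exp(-1/t)/t^2; with X standing for 1/t this is the factor X^2 (p - p'). *)
Lemma flat_is_derive p t :
  is_derive t 1 (flat p : R -> R) (flat ('X^2 * (p - p^`())) t).
Proof.
have [t0|t0|->] := ltgtP t 0.
- rewrite (flat_le0 _ (ltW t0)).
  have h : is_derive t 1 (cst (0 : R) : R -> R) 0 by exact: is_derive_cst.
  apply: near_eq_is_derive h.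
  by near=> s; rewrite flat_le0 // ltW //; near: s; exact: lt_nbhsl.
- rewrite [X in is_derive _ _ _ X]/flat t0.
  pose f : R -> R := (horner p \o GRing.inv) * (expR \o (fun s => - s^-1)).
  apply: (near_eq_is_derive (f := f)).
    by near=> s; rewrite /flat ifT //; near: s; exact: lt_nbhsr.
  have tn0 : t != 0 by rewrite gt_eqF.
  have di : is_derive t 1 (GRing.inv : R -> R) (- t ^- 2).
    by apply: is_derive_eq (is_deriveV tn0 (is_derive_id t 1)) _; rewrite [LHS]mulr1.
  have dn : is_derive t 1 (fun s : R => - s^-1) (- - t ^- 2) by apply: is_deriveN.
  have dp := is_derive1_comp (is_derive_poly p t^-1) di.
  have de := @is_derive1_comp _ expR (fun s : R => - s^-1) t _ _ (is_derive_expR (- t^-1)) dn.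
  apply: is_derive_eq (is_deriveM dp de) _.
  rewrite !hornerE /= /GRing.scale /= exprVn; ring.
- rewrite (flat_le0 _ (lexx 0)).
  (* At 0 the difference quotient of [flat p] is [flat ('X * p)], and the linear bound for it forces
     the limit 0. *)
  have [K K0 hK] := flat_lipschitz0 ('X * p).
  have c0 : (fun h : R => h^-1 *: ((flat p \o shift 0) (h *: 1) - flat p 0)) @ 0^' --> (0 : R^o).
    apply/cvgrPdist_le => e e0.
    have K1 : 0 < K + 1 by rewrite ltr_wpDl.
    near=> h; rewrite sub0r normrN /= addr0 [h *: 1]mulr1.
    rewrite [flat p 0]/flat ltxx subr0.
    have -> : h^-1 *: flat p h = flat ('X * p) h.
      rewrite /flat; case: ifP => _; last by rewrite scaler0.
      by rewrite !hornerE; exact: mulrA.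
    rewrite (le_trans (hK h)) //.
    rewrite (@le_trans _ _ ((K + 1) * `|h|)) // ?ler_wpM2r // ?lerDl //.
    rewrite mulrC -ler_pdivlMr // ltW //.
    near: h; apply: dnbhs0_lt; exact: divr_gt0.
  by apply: DeriveDef; [apply/cvg_ex; exists 0 | apply: cvg_lim].
Unshelve. all: by end_near. Qed.

Lemma flat_smooth p (A : set R^o) : smooth_on A (flat p : R^o -> R^o).
Proof.
apply: (@smooth_on_sub _ _ _ _ setT) => //; apply/smooth_onP => k.
elim: k p => [|k IH] p;
  (split=> [t _|]; first by apply/derivable1_diffP; case: (flat_is_derive p t)) => //.
move=> v.
apply: (@cont_diff_ext _ _ _ _ _ (cst (v : R^o) * flat ('X^2 * (p - p^`()))  : R^o -> R^o)).
- exact: openT.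
- move=> t _; have df : differentiable (flat p : R^o -> R^o) t.
    by apply/derivable1_diffP; case: (flat_is_derive p t).
  rewrite deriveE // -[v in RHS]mulr1 linearZ /= -deriveE //.
  by have [_ ->] := flat_is_derive p t.
apply: cont_diffM; [exact: openT|exact: cont_diff_cst|exact: IH].
Qed.

Lemma smooth_on_linear (V W : normedModType R) (A : set V) (f : {linear V -> W}) :
  continuous f -> smooth_on A f.
Proof.
move=> cf; apply/smooth_onP => -[|k]; (split=> [x _|]; first exact: linear_differentiable) => //.
move=> v; have -> : 'D_v f = cst (f v).
  apply/funext => x; rewrite deriveE; last exact: linear_differentiable.
  by rewrite diff_lin.
exact: cont_diff_cst.
Qed.

Lemma smooth_on_id (V : normedModType R) (A : set V) : smooth_on A (id : V -> V).
Proof. by apply: (@smooth_on_linear _ _ _ idfun) => x; exact: cvg_id. Qed.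

Definition step t : R := flat 1 t / (flat 1 t + flat 1 (1 - t)).

Lemma flat1_ge0 t : 0 <= flat 1 t.
Proof. by rewrite /flat; case: ifP => // _; rewrite hornerC mul1r expR_ge0. Qed.

Lemma flat1_gt0 t : 0 < t -> 0 < flat 1 t.
Proof. by rewrite /flat => ->; rewrite hornerC mul1r expR_gt0. Qed.

Lemma step_le0 t : t <= 0 -> step t = 0.
Proof. by move=> t0; rewrite /step flat_le0 // mul0r. Qed.

Lemma step_ge1 t : 1 <= t -> step t = 1.
Proof.
move=> t1; rewrite /step [flat 1 (1 - t)]flat_le0 ?subr_le0 // addr0 divff //.
by rewrite gt_eqF // flat1_gt0 // (lt_le_trans ltr01).
Qed.

Lemma step_smooth : smooth_on setT (step : R^o -> R^o).
Proof.
have o := @openT R^o.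
have f2 : smooth_on setT ((flat 1 : R^o -> R^o) \o (fun t : R^o => 1 - t : R^o)).
  apply: (@smooth_on_comp1 _ _ _ setT) => //; last exact: flat_smooth.
  have := smooth_onD o (smooth_on_cst (A := setT) (1 : R^o))
    (smooth_onN o (@smooth_on_id R^o setT)).
  by apply: smooth_on_ext.
have fD := smooth_onD o (flat_smooth (A := setT) 1) f2.
apply: smooth_onM o (flat_smooth (A := setT) 1) (smooth_on_inv o _ fD) => t _.
rewrite gt_eqF // /= fctE /=; have [t0|t0] := ltP 0 t.
  by rewrite ltr_pwDl ?flat1_gt0 ?flat1_ge0.
by rewrite ltr_wpDl ?flat1_ge0 // flat1_gt0 // subr_gt0 (le_lt_trans t0).
Qed.

Lemma bump_rV n (a : 'rV[R]_n) (r : R) : 0 < r ->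
  exists phi : 'rV[R]_n -> R^o, [/\ smooth_on setT phi,
    forall y, `|y - a| <= r -> phi y = 1 & forall y, 2 * r <= `|y - a| -> phi y = 0].
Proof.
(* The norm of ['rV_n] is the maximum of the coordinates, so a product over coordinates suffices.
   Squares avoid the corner of the absolute value: q j >= 1 if |y_j - a_j| <= r, and q j <= -2 if
   |y_j - a_j| >= 2 r, where [step] is constant. *)
move=> r0; pose q j (y : 'rV[R]_n) : R^o := 2 - ((y 0 j - a 0 j) / r) ^+ 2.
have normE (y : 'rV[R]_n) : `|y| = \big[Num.max/0]_ij `|y ij.1 ij.2| by exact: mx_normrE.
have o : open [set: 'rV[R]_n] by exact: openT.
have qs j : smooth_on setT (q j).
  have h1 : smooth_on setT (fun y : 'rV[R]_n => y 0 j : R^o).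
    exact: (smooth_on_coord (f := id) j o (@smooth_on_id 'rV[R]_n setT)).
  have h2 := smooth_onM o (smooth_onD o h1 (smooth_on_cst (A := setT) (- a 0 j : R^o)))
     (smooth_on_cst (A := setT) (r^-1 : R^o)).
  have h3 := smooth_onD o (smooth_on_cst (A := setT) (2 : R^o)) (smooth_onN o (smooth_onM o h2 h2)).
  by apply: smooth_on_ext h3 => // y _; rewrite /q expr2.
exists (fun y => \prod_j step (q j y)); split.
- have hj j : smooth_on setT ((step : R^o -> R^o) \o q j).
    exact: smooth_on_comp1 o _ (qs j) step_smooth.
  elim: (index_enum _) => [|j s IH].
    by apply: smooth_on_ext (smooth_on_cst (A := setT) (1 : R^o)) => // y _; rewrite big_nil.
  by apply: smooth_on_ext (smooth_onM o (hj j) IH) => // y _; rewrite big_cons.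
- move=> y ya; rewrite big1 // => j _; apply: step_ge1.
  have yj : `|y 0 j - a 0 j| <= r.
    apply: le_trans ya; rewrite normE.
    by have := le_bigmax 0 (fun ij => `|(y - a) ij.1 ij.2|) (0, j); rewrite !mxE.
  have : ((y 0 j - a 0 j) / r) ^+ 2 <= 1.
    rewrite -real_normK ?num_real // exprn_ile1 // normrM normfV (gtr0_norm r0).
    by rewrite ler_pdivrMr // mul1r.
  rewrite /q; lra.
- move=> y ya; have [j hj] : exists j, 2 * r <= `|y 0 j - a 0 j|.
    apply: contrapT => /forallNP h; move: ya; apply/negP; rewrite -ltNge normE.
    apply/bigmax_ltP; split=> [|[i j] _ /=]; first by rewrite mulr_gt0.
    by rewrite !mxE ord1 ltNge; apply/negP; exact: h.
  rewrite (bigD1 j) //= step_le0 ?mul0r //.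
  have : 2 ^+ 2 <= ((y 0 j - a 0 j) / r) ^+ 2.
    rewrite -[leRHS]real_normK ?num_real // lerXn2r ?nnegrE //.
    by rewrite normrM normfV (gtr0_norm r0) ler_pdivlMr.
  rewrite /q; lra.
Qed.

End Bump.

(** * Calculus in coordinates *)

Section Coordinates.
Local Open Scope set_scope.
Context {R : realType} {n : nat}.
Local Notation C := R[i].
Local Notation E := 'rV[R]_n.
Implicit Types (w : E -> forms R n) (A B : E -> gtangent R n) (x : E).
Implicit Types (i j k : 'I_n) (S : {set 'I_n}).

Definition forms_partial j w x : forms R n := [ffun S => cpartial j (fun y => w y S : C) x].

Definition gtangent_partial j A x : gtangent R n :=
  (\row_k cpartial j (fun y => (A y).1 0 k) x, \row_k cpartial j (fun y => (A y).2 0 k) x).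

Definition forms_diff w x := forall S, cdifferentiable (fun y => w y S : C) x.

Definition gtangent_diff A x := forall k,
  cdifferentiable (fun y => (A y).1 0 k) x /\ cdifferentiable (fun y => (A y).2 0 k) x.

Definition covector j : gtangent R n := (0, delta_mx 0 j).

Lemma interior0 (w : forms R n) : interior_product 0 w = 0.
Proof. by rewrite interior_productE big1 // => k _; rewrite mxE scale0r. Qed.

Lemma clifford_covector (xi : 'rV[C]_n) (w : forms R n) : clifford (0, xi) w = wedge1 xi w.
Proof. by rewrite /clifford interior0 add0r. Qed.

(** Writes d as the sum of e_j d_j with Clifford operators e_j = dx_j. Identities that involve d
    then reduce to Clifford algebra, one index j at a time. *)
Lemma ext_d_coordE w x :
  ext_d_coord w x = \sum_j clifford (covector j) (forms_partial j w x).
Proof. by apply: eq_bigr => j _; rewrite clifford_covector. Qed.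

Lemma clifford_coefE (v : gtangent R n) (w : forms R n) S : clifford v w S =
  \sum_k (if k \in S then sign_before k S * (v.2 0 k * w (S :\ k))
          else sign_before k S * (v.1 0 k * w (k |: S))).
Proof.
rewrite /clifford !ffunE [RHS](bigID (mem S)) /= addrC; congr (_ + _).
  apply: eq_bigr => k kS; rewrite (negPf kS) [X in X * _]mulrC.
  exact/esym/mulrA.
by apply: eq_bigr => k kS; rewrite kS [X in X * _]mulrC; exact/esym/mulrA.
Qed.

Lemma forms_diff_clifford A w x : gtangent_diff A x -> forms_diff w x ->
  forms_diff (fun y => clifford (A y) (w y)) x.
Proof.
move=> dA dw S; under eq_fun do rewrite clifford_coefE.
apply: cdifferentiable_sum => k; have [dA1 dA2] := dA k.
case: (k \in S); (apply: cdifferentiableM; first exact: cdifferentiable_cst);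
  exact: cdifferentiableM.
Qed.

Lemma forms_partial_clifford j A w x : gtangent_diff A x -> forms_diff w x ->
  forms_partial j (fun y => clifford (A y) (w y)) x =
  clifford (gtangent_partial j A x) (w x) + clifford (A x) (forms_partial j w x).
Proof.
move=> dA dw; apply/ffunP => S; rewrite ffunE [RHS]ffunE !clifford_coefE.
under [in LHS]eq_fun do rewrite clifford_coefE.
have hd k : cdifferentiable (fun y => if k \in S
    then sign_before k S * ((A y).2 0 k * w y (S :\ k))
    else sign_before k S * ((A y).1 0 k * w y (k |: S)) : C) x.
  have [dA1 dA2] := dA k; case: (k \in S);
   (apply: cdifferentiableM; first exact: cdifferentiable_cst); exact: cdifferentiableM.
rewrite cpartial_sum // -big_split /=; apply: eq_bigr => k _.
have [dA1 dA2] := dA k; case: (k \in S); rewrite cpartialM;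
  (try exact: cdifferentiable_cst); (try exact: cdifferentiableM);
  by rewrite cpartialM // cpartial_cst mul0r add0r !ffunE !mxE mulrDr.
Qed.

Lemma ext_d_ext w w' x : {near x, w =1 w'} -> ext_d_coord w x = ext_d_coord w' x.
Proof.
move=> ww'; apply: eq_bigr => j _; congr wedge1; apply/ffunP => S; rewrite !ffunE.
by apply: cpartial_ext; apply: filterS ww' => y ->.
Qed.

Lemma forms_partial_sum (I : Type) (r : seq I) (P : pred I) (F : I -> E -> forms R n) j x :
  (forall i : I, forms_diff (F i) x) ->
  forms_partial j (fun y => \sum_(i <- r | P i) F i y) x =
  \sum_(i <- r | P i) forms_partial j (F i) x.
Proof.
move=> dF; apply/ffunP => S; rewrite ffunE sum_ffunE.
under eq_fun do rewrite sum_ffunE.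
rewrite (@cpartial_sum _ _ _ _ _ (fun (i : I) y => F i y S)).
  by apply: eq_bigr => i _; rewrite ffunE.
by move=> i; exact: dF.
Qed.

Lemma forms_partialZ (f : E -> C) w j x : cdifferentiable f x -> forms_diff w x ->
  forms_partial j (fun y => f y *: w y) x =
  cpartial j f x *: w x + f x *: forms_partial j w x.
Proof.
move=> df dw; apply/ffunP => S; rewrite ffunE [RHS]ffunE.
under eq_fun do rewrite ffunE.
rewrite [LHS](@cpartialM _ _ f (fun y => w y S) j x df (dw S)).
by rewrite !ffunE.
Qed.

Lemma forms_diffZ (f : E -> C) w x : cdifferentiable f x -> forms_diff w x ->
  forms_diff (fun y => f y *: w y) x.
Proof.
move=> df dw S; under eq_fun do rewrite ffunE.
exact: (@cdifferentiableM _ _ f (fun y => w y S)).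
Qed.

(** The Lie derivatives and the exact term combine into inner products of the sections with their
    partial derivatives. As (A x).1 0 j is 2 <dx_j, A>, the bracket is expressed by [inner] alone,
    which is what the Clifford relations can handle. *)
Lemma courant_coordE A B x : gtangent_diff A x -> gtangent_diff B x ->
  courant_coord A B x = \sum_j
   ((A x).1 0 j *: gtangent_partial j B x - (B x).1 0 j *: gtangent_partial j A x
    + (inner (gtangent_partial j A x) (B x) - inner (A x) (gtangent_partial j B x))
        *: covector j).
Proof.
move=> dA dB.
have fstS (F : 'I_n -> gtangent R n) : (\sum_j F j).1 = \sum_j (F j).1.
  by apply: (big_morph fst).
have sndS (F : 'I_n -> gtangent R n) : (\sum_j F j).2 = \sum_j (F j).2.
  by apply: (big_morph snd).
rewrite [RHS]surjective_pairing fstS sndS /courant_coord; congr pair.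
  apply/rowP => i; rewrite mxE summxE; apply: eq_bigr => j _ /=.
  by rewrite scaler0 addr0 !mxE.
have pdiff (F G : E -> 'rV[C]_n) : (forall k, cdifferentiable (fun y => F y 0 k) x) ->
    (forall k, cdifferentiable (fun y => G y 0 k) x) ->
    cdifferentiable (fun y => pairing (F y) (G y)) x.
  by move=> hF hG; apply: cdifferentiable_sum => k; exact: cdifferentiableM.
have ppart i (F G : E -> 'rV[C]_n) : (forall k, cdifferentiable (fun y => F y 0 k) x) ->
    (forall k, cdifferentiable (fun y => G y 0 k) x) ->
    cpartial i (fun y => pairing (F y) (G y)) x =
    \sum_k (cpartial i (fun y => G y 0 k) x * F x 0 k + G x 0 k * cpartial i (fun y => F y 0 k) x).
  move=> hF hG; rewrite /pairing cpartial_sum; last by move=> k; exact: cdifferentiableM.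
  by apply: eq_bigr => k _; rewrite cpartialM.
have dA1 k : cdifferentiable (fun y => (A y).1 0 k) x by have [] := dA k.
have dA2 k : cdifferentiable (fun y => (A y).2 0 k) x by have [] := dA k.
have dB1 k : cdifferentiable (fun y => (B y).1 0 k) x by have [] := dB k.
have dB2 k : cdifferentiable (fun y => (B y).2 0 k) x by have [] := dB k.
apply/rowP => i; rewrite summxE /=.
under [RHS]eq_bigr => j _ do rewrite !mxE /=.
have dsum (c : 'I_n -> C) : \sum_j c j * (i == j)%:R = c i.
  rewrite (bigD1 i) //= eqxx mulr1 big1 ?addr0 // => k ki.
  by rewrite eq_sym (negPf ki) mulr0.
rewrite [RHS]big_split /= dsum !mxE.
have cN f : cdifferentiable f x -> cpartial i (fun y => - f y) x = - cpartial i f x.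
  move=> df; under eq_fun do rewrite -mulN1r.
  by rewrite cpartialM ?cpartial_cst ?mul0r ?add0r ?mulN1r //; exact: cdifferentiable_cst.
have dN f : cdifferentiable f x -> cdifferentiable (fun y => - f y) x.
  move=> df; under eq_fun do rewrite -mulN1r.
  by apply: cdifferentiableM => //; exact: cdifferentiable_cst.
rewrite cpartialD; [|exact: pdiff|by apply: dN; exact: pdiff].
rewrite cN; last exact: pdiff.
rewrite !ppart // /inner -mulrBr /pairing /=.
rewrite -!big_split /= -!sumrB !mulr_sumr -sumrB -[RHS]big_split /=.
apply: eq_bigr => k _; rewrite !mxE.
move: (cpartial i (fun y => (A y).1 0 k) x) (cpartial i (fun y => (A y).2 0 k) x)
  (cpartial i (fun y => (B y).1 0 k) x) (cpartial i (fun y => (B y).2 0 k) x)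
  (cpartial k (fun y => (A y).2 0 i) x) (cpartial k (fun y => (B y).2 0 i) x)
  ((A x).1 0 k) ((A x).2 0 k) ((B x).1 0 k) ((B x).2 0 k).
by move=> *; field.
Qed.

End Coordinates.

(** * The derived-bracket formula and the naturality of d *)

Section DerivedBracket.
Local Open Scope set_scope.
Context {R : realType} {n : nat}.
Local Notation C := R[i].
Local Notation E := 'rV[R]_n.
Implicit Types (w : E -> forms R n) (A B : E -> gtangent R n) (x : E).
Implicit Types (i j k : 'I_n) (S : {set 'I_n}).

#[local] Opaque clifford.

Lemma cliffordDr (v : gtangent R n) (p q : forms R n) :
  clifford v (p + q) = clifford v p + clifford v q.
Proof. exact: linearD. Qed.

Lemma cliffordBr (v : gtangent R n) (p q : forms R n) :
  clifford v (p - q) = clifford v p - clifford v q.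
Proof. exact: linearB. Qed.

Lemma cliffordBl (u v : gtangent R n) (p : forms R n) :
  clifford (u - v) p = clifford u p - clifford v p.
Proof. by rewrite cliffordDl -[- v]scaleN1r cliffordZl scaleN1r. Qed.

Lemma cliffordZr (v : gtangent R n) (a : C) (p : forms R n) :
  clifford v (a *: p) = a *: clifford v p.
Proof. exact: linearZ. Qed.

(* The polarised derived-bracket identity, at the level of one partial
   derivative: e = dx_j, a = d_j A, b = d_j B and p1 = d_j p0. *)
Lemma clifford_derived_bracket (e a b u v : gtangent R n) (p0 p1 : forms R n) :
  2 *: clifford ((2 * inner e u) *: b - (2 * inner e v) *: a
       + (inner a v - inner u b) *: e) p0 =
  clifford e (clifford a (clifford v p0) +
    clifford u (clifford b p0 + clifford v p1))
  - clifford e (clifford b (clifford u p0) +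
    clifford v (clifford a p0 + clifford u p1))
  + 2 *: clifford u (clifford e (clifford b p0 + clifford v p1))
  - 2 *: clifford v (clifford e (clifford a p0 + clifford u p1))
  + clifford u (clifford v (clifford e p1))
  - clifford v (clifford u (clifford e p1)).
Proof.
(* The terms in the derivative p1 of the form cancel, so the right-hand side is of order zero in the
   form. *)
have E1 : clifford e (clifford u (clifford v p1)) - clifford e (clifford v (clifford u p1))
   + 2 *: clifford u (clifford e (clifford v p1)) - 2 *: clifford v (clifford e (clifford u p1))
   + clifford u (clifford v (clifford e p1)) - clifford v (clifford u (clifford e p1)) = 0.
  rewrite [clifford e (clifford u _)]cliffordC [clifford e (clifford v (clifford u _))]cliffordC.
  rewrite [clifford e (clifford v p1)]cliffordC [clifford e (clifford u p1)]cliffordC.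
  rewrite !cliffordBr !cliffordZr.
  move: (clifford u (clifford v (clifford e p1))) (clifford v (clifford u (clifford e p1)))
    => q1 q2.
  move: (clifford u p1) (clifford v p1) => q3 q4.
  by apply/ffunP => S; rewrite !ffunE /GRing.scale /=; ring.
(* The terms in p0 fall into a group in (u, b) and a group in (v, a), equal up to sign after
   renaming; one identity serves for both. *)
have E2 u' b' : clifford e (clifford u' (clifford b' p0))
    - clifford e (clifford b' (clifford u' p0)) + 2 *: clifford u' (clifford e (clifford b' p0))
   = 2 *: clifford ((2 * inner e u') *: b' - inner u' b' *: e) p0.
  rewrite [clifford b' (clifford u' p0)]cliffordC cliffordBr cliffordZr.
  rewrite [clifford e (clifford u' _)]cliffordC cliffordDl -scaleNr !cliffordZl (innerC b' u').
  move: (clifford u' (clifford e (clifford b' p0))) (clifford b' p0) (clifford e p0) => q1 q2 q3.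
  by apply/ffunP => S; rewrite !ffunE /GRing.scale /=; ring.
have -> : (2 * inner e u) *: b - (2 * inner e v) *: a + (inner a v - inner u b) *: e =
   ((2 * inner e u) *: b - inner u b *: e) - ((2 * inner e v) *: a - inner v a *: e).
  rewrite (innerC a v) scalerBl opprB addrACA [RHS]addrACA; congr (_ + _).
  exact: addrC.
have hE (P Q : gtangent R n) :
    2 *: clifford (P - Q) p0 = 2 *: clifford P p0 - 2 *: clifford Q p0.
  by rewrite cliffordBl scalerBr.
apply: etrans (hE _ _) _.
apply: etrans (congr2 (fun p q => p - q) (esym (E2 u b)) (esym (E2 v a))) _.
apply: etrans (esym (addr0 _)) _.
apply: etrans (congr1 (fun p => _ + p) (esym E1)) _.
rewrite (cliffordDr u (clifford b p0) (clifford v p1)).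
rewrite (cliffordDr v (clifford a p0) (clifford u p1)).
rewrite (cliffordDr e (clifford b p0) (clifford v p1)).
rewrite (cliffordDr e (clifford a p0) (clifford u p1)).
rewrite (cliffordDr e (clifford a (clifford v p0))).
rewrite (cliffordDr e (clifford u (clifford b p0))).
rewrite (cliffordDr e (clifford b (clifford u p0))).
rewrite (cliffordDr e (clifford v (clifford a p0))).
rewrite (cliffordDr u (clifford e (clifford b p0))).
rewrite (cliffordDr v (clifford e (clifford a p0))).
move: (clifford e (clifford u (clifford b p0))) (clifford e (clifford b (clifford u p0)))
  (clifford u (clifford e (clifford b p0))) (clifford e (clifford v (clifford a p0)))
  (clifford e (clifford a (clifford v p0))) (clifford v (clifford e (clifford a p0)))
  (clifford e (clifford u (clifford v p1))) (clifford e (clifford v (clifford u p1)))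
  (clifford u (clifford e (clifford v p1))) (clifford v (clifford e (clifford u p1)))
  (clifford u (clifford v (clifford e p1))) (clifford v (clifford u (clifford e p1))).
by move=> *; apply/ffunP => S; rewrite !ffunE /GRing.scale /=; ring.
Qed.

Lemma inner_covector (v : gtangent R n) j : 2 * inner (covector j) v = v.1 0 j.
Proof. by rewrite innerC inner_delta2. Qed.

(** The graded commutator [[d, A], B] is the Clifford action of the Dorfman bracket; its
    skew-symmetrisation in A and B is twice the Courant bracket, whence the factor 2. The proof
    compares the summands of index j after applying Leibniz's rule. *)
Lemma courant_clifford A B w x : gtangent_diff A x -> gtangent_diff B x -> forms_diff w x ->
  2 *: clifford (courant_coord A B x) (w x) =
  ext_d_coord (fun y => clifford (A y) (clifford (B y) (w y))) x
  - ext_d_coord (fun y => clifford (B y) (clifford (A y) (w y))) x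
  + 2 *: clifford (A x) (ext_d_coord (fun y => clifford (B y) (w y)) x)
  - 2 *: clifford (B x) (ext_d_coord (fun y => clifford (A y) (w y)) x)
  + clifford (A x) (clifford (B x) (ext_d_coord w x))
  - clifford (B x) (clifford (A x) (ext_d_coord w x)).
Proof.
move=> dA dB dw.
have dAw := forms_diff_clifford dA dw; have dBw := forms_diff_clifford dB dw.
rewrite !ext_d_coordE courant_coordE // clifford_suml !linear_sum /=.
rewrite -!big_split /=; apply: eq_bigr => j _.
rewrite (forms_partial_clifford j dA dBw) (forms_partial_clifford j dB dAw).
rewrite (forms_partial_clifford j dA dw) (forms_partial_clifford j dB dw).
apply: etrans (clifford_derived_bracket _ _ _ _ _ _ _).
by rewrite !inner_covector.
Qed.

(** A pulled-back form is the sum over S of w_S(phi) times the product of the d phi_j for j in S.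
    These products are closed, so only the coefficients are differentiated, and the chain rule
    concludes. *)
Lemma ext_d_pullback (O : set E) (phi : E -> E) w x :
  open O -> O x -> smooth_on O phi -> forms_diff w (phi x) ->
  let K y : 'M[C]_n := map_mx (fun r : R => r%:C) (jacobian phi y) in
  ext_d_coord (fun y => pullback (K y) (w (phi y))) x = pullback (K x) (ext_d_coord w (phi x)).
Proof.
move=> oO Ox phiO dw K.
have dphi : differentiable phi x by exact: smooth_on_differentiable phiO Ox.
have phij j : csmooth_on O (fun y => (phi y 0 j)%:C).
  by apply: csmooth_on_real; exact: smooth_on_coord.
(* Column j of K is the gradient of the component phi_j, so [kap j] below is the covector field d
   phi_j. *)
have KE i j y : O y -> K y i j = cpartial i (fun z => (phi z 0 j)%:C) y.
  move=> Oy; rewrite mxE /cpartial /= derive_cst; congr (_ +i* _).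
  have dy : differentiable phi y by exact: smooth_on_differentiable phiO Oy.
  have := deriveEjacobian (delta_mx 0 i) dy; rewrite -rowE => /rowP/(_ j).
  by rewrite [RHS]mxE => <-; rewrite derive_mx ?mxE //; exact: diff_derivable.
have Ks i j : csmooth_on O (fun y => K y i j).
  by apply: csmooth_on_ext (csmooth_on_cpartial i (phij j)) => // y Oy; rewrite KE.
pose kap j y : gtangent R n := (0, (col j (K y))^T).
have dkap j y : O y -> gtangent_diff (kap j) y.
  move=> Oy k; split; first by under eq_fun do rewrite mxE; exact: cdifferentiable_cst.
  by under eq_fun do rewrite 2!mxE; exact: csmooth_on_differentiable (Ks k j) Oy.
have ths s : forall y, O y -> forms_diff (fun y => wedge_seq (K y) s) y.
  elim: s => [|j s IH] y Oy; first by move=> S; exact: cdifferentiable_cst.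
  rewrite /=; under eq_fun do rewrite -clifford_covector.
  by apply: forms_diff_clifford (IH _ Oy); exact: dkap.
have dth s : ext_d_coord (fun y => wedge_seq (K y) s) x = 0.
  elim: s => [|j s IH].
    rewrite /ext_d_coord big1 // => j _; rewrite (_ : finfun _ = 0) ?linear0 //.
    by apply/ffunP => S; rewrite ffunE [RHS]ffunE; exact: cpartial_cst.
  rewrite /=; under eq_fun do rewrite -clifford_covector.
  rewrite ext_d_coordE.
  under eq_bigr => i _ do rewrite (forms_partial_clifford i (dkap j x Ox) (ths s x Ox)) linearD /=.
  rewrite big_split /= [X in _ + X](_ : _ = 0) ?addr0; last first.
    under eq_bigr => i _ do rewrite cliffordC.
    rewrite big_split /= sumrN -linear_sum /= -ext_d_coordE IH linear0 oppr0 addr0.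
    rewrite big1 // => i _; rewrite inner_covector mxE scale0r //.
  pose H i k := cpartial i (fun y => K y k j) x.
  have Hs i k : H i k = H k i.
    have hh i' k' : H i' k' = cpartial i' (cpartial k' (fun z => (phi z 0 j)%:C)) x.
      by apply: cpartial_ext; apply: filterS (open_nbhs_nbhs (conj oO Ox)) => y Oy; exact: KE.
    by rewrite !hh; exact: cpartial_comm oO (phij j) Ox.
  have gp i : gtangent_partial i (kap j) x = \sum_k H i k *: covector k.
    rewrite [RHS]surjective_pairing; congr pair.
      rewrite (big_morph fst (id1 := 0) (op1 := +%R)) // big1 => [|k _ /=]; last by rewrite scaler0.
      apply/rowP => k; rewrite mxE [RHS]mxE -[RHS](cpartial_cst 0 i x).
      by congr cpartial; apply/funext => y; rewrite mxE.
    rewrite (big_morph snd (id1 := 0) (op1 := +%R)) //=.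
    rewrite [LHS]row_sum_delta; apply: eq_bigr => k _; congr (_ *: _).
    by rewrite mxE; congr cpartial; apply/funext => y; rewrite !mxE.
  (* T contracts the Hessian of phi_j, symmetric by Schwarz, with the anticommuting products dx_i
     dx_k; hence T = -T. *)
  pose T := \sum_i \sum_k
    H i k *: clifford (covector i) (clifford (covector k) (wedge_seq (K x) s)).
  have TE : \sum_i clifford (covector i)
      (clifford (gtangent_partial i (kap j) x) (wedge_seq (K x) s)) = T.
    apply: eq_bigr => i _; rewrite gp clifford_suml linear_sum; apply: eq_bigr => k _ /=.
    by rewrite cliffordZl linearZ.
  rewrite TE; have : T = - T.
    rewrite {1}/T exchange_big /= -sumrN; apply: eq_bigr => k _.
    rewrite -sumrN; apply: eq_bigr => i _; rewrite Hs -scalerN; congr (_ *: _).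
    rewrite cliffordC inner_covector mxE scale0r sub0r //.
  move/eqP; rewrite -addr_eq0 -mulr2n -scaler_nat scaler_eq0 pnatr_eq0 /=.
  by move/eqP.
have dwS S : cdifferentiable (fun y => w (phi y) S : C) x.
  exact: (@cdifferentiable_comp _ _ _ (fun y => w y S : C)).
rewrite ext_d_coordE.
under eq_bigr => j _.
  rewrite (_ : (fun y => pullback (K y) (w (phi y))) =
     (fun y => \sum_S w (phi y) S *: wedge_seq (K y) (enum S))) //.
  rewrite forms_partial_sum; last by move=> S; exact: forms_diffZ (dwS S) (ths _ _ Ox).
  rewrite linear_sum.
  under eq_bigr => S _ do rewrite (forms_partialZ _ (dwS S) (ths _ _ Ox)) linearD !linearZ /=.
  over.
rewrite exchange_big /= /ext_d_coord linear_sum /=.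
under [RHS]eq_bigr => k _.
  rewrite pullback_wedge pullbackE linear_sum.
  under eq_bigr => S _ do rewrite linearZ /= ffunE.
  over.
rewrite [RHS]exchange_big /=; apply: eq_bigr => S _.
rewrite big_split /= -scaler_sumr -ext_d_coordE dth scaler0 addr0.
under eq_bigr => j _ do
  rewrite (@cpartial_comp _ _ _ (fun y => w y S : C) phi j x dphi (dw S)) scaler_suml.
rewrite exchange_big /=; apply: eq_bigr => k _.
have -> : delta_mx 0 k *m (K x)^T = \sum_j K x j k *: delta_mx 0 j :> 'rV[C]_n.
  rewrite -rowE [LHS]row_sum_delta; apply: eq_bigr => j _.
  by rewrite !mxE.
rewrite wedge1E scaler_sumr; apply: eq_bigr => j _.
rewrite clifford_covector scalerA mulrC; congr (_ * _ *: _).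
rewrite summxE (bigD1 j) //= big1 ?addr0; last first.
  by move=> i ij; rewrite !mxE eqxx eq_sym (negPf ij) mulr0.
by rewrite !mxE !eqxx mulr1.
Qed.

End DerivedBracket.

(** * Changes of charts *)

Section Charts.
Context {R : realType} {n : nat} {M : smoothManifold R n}.
Local Notation C := R[i].
Local Notation E := 'rV[R]_n.
Implicit Types (a b c : chart R n M) (p q : M) (W : set M).

Lemma chart_inv_continuous_at c x : (chart_map c @` chart_dom c) x ->
  {for x, continuous (chart_inv c)}.
Proof.
move=> cx; have := @chart_inv_continuous _ _ _ c.
by rewrite continuous_open_subspace; [apply; rewrite inE | exact: chart_img_open].
Qed.

Lemma chart_map_continuous_at c p : chart_dom c p -> {for p, continuous (chart_map c)}.
Proof.
move=> cp; have := @chart_map_continuous _ _ _ c.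
by rewrite continuous_open_subspace; [apply; rewrite inE | exact: chart_dom_open].
Qed.

Lemma open_chart_image c W : open W -> open (chart_map c @` (W `&` chart_dom c)).
Proof.
move=> oW; rewrite openE => x [p [Wp cp] <-]; rewrite /interior.
have im : (chart_map c @` chart_dom c) (chart_map c p) by exists p.
have h1 : \forall y \near chart_map c p, (chart_map c @` chart_dom c) y.
  by apply: open_nbhs_nbhs; split => //; exact: chart_img_open.
have h2 : \forall y \near chart_map c p, W (chart_inv c y).
  apply: (chart_inv_continuous_at im); rewrite chart_mapK //.
  exact: open_nbhs_nbhs.
near=> y; have [q cq qy] : (chart_map c @` chart_dom c) y by near: y.
exists q => //; split => //.
have : W (chart_inv c y) by near: y.
by rewrite -qy chart_mapK.
Unshelve. all: by end_near. Qed.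

Lemma open_chart_preimage c (B : set E) : open B ->
  open (chart_dom c `&` chart_map c @^-1` B).
Proof.
move=> oB; rewrite openE => p [cp Bp]; rewrite /interior.
have h1 : \forall q \near p, chart_dom c q.
  by apply: open_nbhs_nbhs; split => //; exact: chart_dom_open.
have h2 : \forall q \near p, B (chart_map c q).
  by apply: (chart_map_continuous_at cp); exact: open_nbhs_nbhs.
by apply: filterS2 h1 h2 => q.
Qed.

Lemma transitionE a b p : chart_dom a p -> transition a b (chart_map a p) = chart_map b p.
Proof. by move=> ap; rewrite /transition /= chart_mapK. Qed.

Definition overlap a b : set E := chart_map a @` (chart_dom a `&` chart_dom b).

Lemma open_overlap a b : open (overlap a b).
Proof.
rewrite /overlap setIC; exact: (open_chart_image (chart_dom_open b)).
Qed.

Lemma transition_smooth a b : atlas a -> atlas b -> smooth_on (overlap a b) (transition a b).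
Proof. exact: atlas_compatible. Qed.

Lemma overlapI a b p : chart_dom a p -> chart_dom b p -> overlap a b (chart_map a p).
Proof. by move=> ap bp; exists p. Qed.

Lemma transition_differentiable a b p : atlas a -> atlas b ->
  chart_dom a p -> chart_dom b p -> differentiable (transition a b) (chart_map a p).
Proof.
move=> aa ab ap bp; apply: smooth_on_differentiable (transition_smooth aa ab) _.
exact: overlapI.
Qed.

Lemma jac_id a p : chart_dom a p -> jac a a p = 1%:M.
Proof.
move=> ap; rewrite /jac (_ : jacobian _ _ = 1%:M) ?map_mx1 //.
have d1 : differentiable (id : E -> E) (chart_map a p) by [].
have nid : {near chart_map a p, (id : E -> E) =1 transition a a}.
  have : \forall y \near chart_map a p, (chart_map a @` chart_dom a) y.
    apply: open_nbhs_nbhs; split; first exact: chart_img_open.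
    by exists p.
  by apply: filterS => _ [q aq <-]; rewrite transitionE.
have d2 := near_eq_differentiable nid d1.
apply/row_matrixP => i; rewrite !rowE -(deriveEjacobian _ d2).
by rewrite -(near_eq_derive (delta_mx 0 i) nid) derive_id mulmx1.
Qed.

(** The chain rule. Jacobian matrices act on row vectors from the right, so they are multiplied in
    the order of composition. *)
Lemma jac_mul a b c p : atlas a -> atlas b -> atlas c ->
  chart_dom a p -> chart_dom b p -> chart_dom c p ->
  jac a b p *m jac b c p = jac a c p.
Proof.
move=> aa ab ac ap bp cp; rewrite /jac -map_mxM; congr map_mx.
have dab := transition_differentiable aa ab ap bp.
have dbc := transition_differentiable ab ac bp cp.
have dac := transition_differentiable aa ac ap cp.
have dbc' : differentiable (transition b c) (transition a b (chart_map a p)).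
  by rewrite transitionE.
have dcomp : differentiable (transition b c \o transition a b) (chart_map a p).
  exact: differentiable_comp.
have ne : {near chart_map a p, transition b c \o transition a b =1 transition a c}.
  have : \forall y \near chart_map a p, overlap a b y.
    by apply: open_nbhs_nbhs; split; [exact: open_overlap | exact: overlapI].
  by apply: filterS => _ [q [aq bq] <-]; rewrite /= !transitionE.
have key (v : E) : v *m jacobian (transition a c) (chart_map a p) =
    v *m jacobian (transition a b) (chart_map a p)
      *m jacobian (transition b c) (transition a b (chart_map a p)).
  have h1 := deriveEjacobian v dac.
  have h2 := near_eq_derive v ne.
  have h3 := deriveE v dcomp.
  have h4 := congr1 (fun h : E -> E => h v) (diff_comp dab dbc').
  have h5 := deriveE v dab.
  have h6 := deriveEjacobian v dab.
  have h7 := deriveE ('D_v (transition a b) (chart_map a p)) dbc'.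
  have h8 := deriveEjacobian ('D_v (transition a b) (chart_map a p)) dbc'.
  move: h1 h6 h8.
  move: (jacobian (transition a c) (chart_map a p)) (jacobian (transition a b) (chart_map a p))
    (jacobian (transition b c) (transition a b (chart_map a p))) => J1 J2 J3 h1 h6 h8.
  rewrite -[LHS]h1 -[LHS]h2 [LHS]h3; apply: (eq_trans h4).
  by rewrite -h6 -[RHS]h8 [RHS]h7 h5.
move: key; rewrite (transitionE b ap).
move: (jacobian (transition a c) (chart_map a p)) (jacobian (transition a b) (chart_map a p))
  (jacobian (transition b c) (chart_map b p)) => J1 J2 J3 key.
by apply/row_matrixP => i; rewrite !rowE mulmxA key.
Qed.

Lemma jacK a b p : atlas a -> atlas b -> chart_dom a p -> chart_dom b p ->
  jac a b p *m jac b a p = 1%:M.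
Proof. by move=> aa ab ap bp; rewrite jac_mul // jac_id. Qed.

Lemma jac_smooth a b i j : atlas a -> atlas b ->
  csmooth_on (overlap a b) (fun x => jac a b (chart_inv a x) i j).
Proof.
move=> aa ab; have oO := @open_overlap a b; have ts := transition_smooth aa ab.
have := csmooth_on_real (smooth_on_coord j oO (smooth_on_derive (delta_mx 0 i) ts)).
apply: csmooth_on_ext => // _ [p [ap bp] <-].
rewrite /jac mxE chart_mapK //; congr (_ %:C).
have dab := transition_differentiable aa ab ap bp.
by rewrite (deriveEjacobian _ dab) -rowE mxE.
Qed.

(** The matrix [jac b a] is naturally a smooth function of the coordinates of b; composition with
    the transition from a to b makes it one of the coordinates of a. *)
Lemma jac_smooth_rev a b i j : atlas a -> atlas b ->
  csmooth_on (overlap a b) (fun x => jac b a (chart_inv a x) i j).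
Proof.
move=> aa ab; have oO := @open_overlap a b; have ts := transition_smooth aa ab.
have im x : overlap a b x -> overlap b a (transition a b x).
  by move=> [p [ap bp] <-]; rewrite transitionE //; exact: overlapI.
have h := csmooth_on_comp oO im ts (jac_smooth i j ab aa).
apply: (csmooth_on_ext oO _ h) => _ [p [ap bp] <-].
have e : chart_inv b (transition a b (chart_map a p)) = chart_inv a (chart_map a p).
  by rewrite (transitionE b ap) (chart_mapK ap) (chart_mapK bp).
exact: (congr1 (fun q => jac b a q i j) e).
Qed.

End Charts.

Lemma parity_pullback (R : realType) (n : nat) (K : 'M[R[i]]_n) (w : forms R n) :
  parity (pullback K w) = pullback K (parity w).
Proof.
elim/(@forms_ind R n): w => [|k w w' IH IH'|j w IH].
- have p1 : parity form1 = form1 :> forms R n.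
    apply/ffunP => S; rewrite !ffunE; case: eqP => [->|_]; last exact: mulr0.
    by rewrite cards0 mulr1.
  by rewrite pullback_form1 p1 pullback_form1.
- by rewrite !linearP /= IH IH'.
by rewrite pullback_wedge !parity_wedge linearN /= pullback_wedge IH.
Qed.

Section Changes.
Context {R : realType} {n : nat} {M : smoothManifold R n}.
Local Notation C := R[i].
Implicit Types (a b c : chart R n M) (p q : M) (u v : gtangent R n) (w : forms R n).

Lemma gtangent_change_linear a b p : linear (gtangent_change a b p).
Proof.
move=> k u v; rewrite /gtangent_change /=.
by congr pair; rewrite mulmxDl -scalemxAl.
Qed.
HB.instance Definition _ a b p := GRing.isLinear.Build C (gtangent R n) (gtangent R n) _
  (gtangent_change a b p) (gtangent_change_linear a b p).

Lemma forms_change_linear a b p : linear (forms_change a b p).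
Proof. by move=> k u v; rewrite /forms_change linearP. Qed.
HB.instance Definition _ a b p := GRing.isLinear.Build C (forms R n) (forms R n) _
  (forms_change a b p) (forms_change_linear a b p).

Lemma forms_change_comp a b c p w : atlas a -> atlas b -> atlas c ->
  chart_dom a p -> chart_dom b p -> chart_dom c p ->
  forms_change b c p (forms_change a b p w) = forms_change a c p w.
Proof.
move=> aa ab ac ap bp cp; have := jac_mul ac ab aa cp bp ap; rewrite /forms_change.
move: (jac c b p) (jac b a p) (jac c a p) => K1 K2 K3 <-; exact: pullback_mul.
Qed.

Lemma gtangent_change_comp a b c p v : atlas a -> atlas b -> atlas c ->
  chart_dom a p -> chart_dom b p -> chart_dom c p ->
  gtangent_change b c p (gtangent_change a b p v) = gtangent_change a c p v.
Proof.
move=> aa ab ac ap bp cp; rewrite /gtangent_change /=.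
have := jac_mul aa ab ac ap bp cp; have := jac_mul ac ab aa cp bp ap.
move: (jac a b p) (jac b c p) (jac a c p) => J1 J2 J3.
move: (jac c b p) (jac b a p) (jac c a p) => K1 K2 K3 <- <-.
by rewrite trmx_mul !mulmxA.
Qed.

Lemma forms_change_id a p w : chart_dom a p -> forms_change a a p w = w.
Proof. by move=> ap; rewrite /forms_change (jac_id ap); exact: pullback1. Qed.

Lemma gtangent_change_id a p v : chart_dom a p -> gtangent_change a a p v = v.
Proof.
by move=> ap; rewrite /gtangent_change (jac_id ap) trmx1 !mulmx1; case: v.
Qed.

Lemma forms_changeK a b p : atlas a -> atlas b -> chart_dom a p -> chart_dom b p ->
  cancel (forms_change a b p) (forms_change b a p).
Proof.
move=> aa ab ap bp w; apply: (eq_trans (forms_change_comp w aa ab aa ap bp ap)).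
exact: forms_change_id.
Qed.

Lemma gtangent_changeK a b p : atlas a -> atlas b -> chart_dom a p -> chart_dom b p ->
  cancel (gtangent_change a b p) (gtangent_change b a p).
Proof.
move=> aa ab ap bp v; apply: (eq_trans (gtangent_change_comp v aa ab aa ap bp ap)).
exact: gtangent_change_id.
Qed.

Lemma clifford_change a b p v w : atlas a -> atlas b -> chart_dom a p -> chart_dom b p ->
  clifford (gtangent_change a b p v) (forms_change a b p w) = forms_change a b p (clifford v w).
Proof.
move=> aa ab ap bp; have := jacK aa ab ap bp; rewrite /gtangent_change /forms_change.
move: (jac a b p) (jac b a p) => J K; exact: clifford_pullback.
Qed.

Lemma inner_change a b p u v : atlas a -> atlas b -> chart_dom a p -> chart_dom b p ->
  inner (gtangent_change a b p u) (gtangent_change a b p v) = inner u v.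
Proof.
move=> aa ab ap bp; have := jacK aa ab ap bp; rewrite /gtangent_change.
move: (jac a b p) (jac b a p) => J K h.
by rewrite /inner /= !pairing_mul -!mulmxA h !mulmx1.
Qed.

Lemma parity_change a b p w : parity (forms_change a b p w) = forms_change a b p (parity w).
Proof. exact: parity_pullback. Qed.

End Changes.

(** * Smoothness of the operations in coordinates *)

Section CoordinateSmoothness.
Local Open Scope set_scope.
Context {R : realType} {n : nat}.
Local Notation C := R[i].
Local Notation E := 'rV[R]_n.
Implicit Types (O : set E) (w : E -> forms R n) (A : E -> gtangent R n).

Definition forms_csmooth O w := forall S : {set 'I_n}, csmooth_on O (fun x => w x S : C).

Definition gtangent_csmooth O A := forall j : 'I_n,
  csmooth_on O (fun x => (A x).1 0 j) /\ csmooth_on O (fun x => (A x).2 0 j).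

Lemma forms_csmooth_ext O w w' : open O -> (forall x, O x -> w x = w' x) ->
  forms_csmooth O w -> forms_csmooth O w'.
Proof.
by move=> oO h ws S; apply: (csmooth_on_ext oO _ (ws S)) => x Ox; rewrite h.
Qed.

Lemma gtangent_csmooth_ext O A A' : open O -> (forall x, O x -> A x = A' x) ->
  gtangent_csmooth O A -> gtangent_csmooth O A'.
Proof.
move=> oO h As j; have [s1 s2] := As j.
by split; [apply: (csmooth_on_ext oO _ s1)|apply: (csmooth_on_ext oO _ s2)] => x Ox;
  rewrite h.
Qed.

Lemma forms_csmooth_diff O w x : forms_csmooth O w -> O x -> forms_diff w x.
Proof. by move=> ws Ox S; exact: csmooth_on_differentiable (ws S) Ox. Qed.

Lemma gtangent_csmooth_diff O A x : gtangent_csmooth O A -> O x -> gtangent_diff A x.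
Proof.
move=> As Ox j; have [s1 s2] := As j.
by split; [exact: csmooth_on_differentiable s1 Ox | exact: csmooth_on_differentiable s2 Ox].
Qed.

Lemma clifford_csmooth O A w : open O -> gtangent_csmooth O A -> forms_csmooth O w ->
  forms_csmooth O (fun x => clifford (A x) (w x)).
Proof.
move=> oO As ws S; under eq_fun do rewrite clifford_coefE.
apply: csmooth_on_sum => // k; have [s1 s2] := As k.
case: (k \in S); (apply: csmooth_onM => //; first exact: csmooth_on_cst);
  by apply: csmooth_onM => //; exact: ws.
Qed.

Lemma pullback_csmooth O (K : E -> 'M[C]_n) w : open O ->
  (forall i j, csmooth_on O (fun x => K x i j)) -> forms_csmooth O w ->
  forms_csmooth O (fun x => pullback (K x) (w x)).
Proof.
move=> oO Ks ws.
have seqs s : forms_csmooth O (fun x => wedge_seq (K x) s).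
  elim: s => [|j s IH]; first by move=> S; exact: csmooth_on_cst.
  rewrite /=; under eq_fun do rewrite -clifford_covector.
  apply: clifford_csmooth => // k; split.
    by under eq_fun do rewrite mxE; exact: csmooth_on_cst.
  by under eq_fun do rewrite 2!mxE; exact: Ks.
move=> S; under eq_fun do rewrite pullbackE sum_ffunE.
apply: csmooth_on_sum => // T; under eq_fun do rewrite ffunE.
exact: csmooth_onM oO (ws T) (seqs (enum T) S).
Qed.

Lemma ext_d_csmooth O w : open O -> forms_csmooth O w -> forms_csmooth O (ext_d_coord w).
Proof.
move=> oO ws S.
have h j : csmooth_on O (fun x => clifford (covector j) (forms_partial j w x) S : C).
  apply: (@clifford_csmooth O (fun=> covector j) (forms_partial j w)) => //.
    by move=> k; split; exact: csmooth_on_cst.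
  by move=> T; under eq_fun do rewrite ffunE; exact: csmooth_on_cpartial.
apply: (csmooth_on_ext oO _ (csmooth_on_sum (index_enum 'I_n) xpredT oO h)) => x _.
by rewrite ext_d_coordE sum_ffunE.
Qed.

Lemma courant_csmooth O A B : open O -> gtangent_csmooth O A -> gtangent_csmooth O B ->
  gtangent_csmooth O (courant_coord A B).
Proof.
move=> oO As Bs j.
have a1 k : csmooth_on O (fun x => (A x).1 0 k) by have [] := As k.
have a2 k : csmooth_on O (fun x => (A x).2 0 k) by have [] := As k.
have b1 k : csmooth_on O (fun x => (B x).1 0 k) by have [] := Bs k.
have b2 k : csmooth_on O (fun x => (B x).2 0 k) by have [] := Bs k.
have sB (f g : E -> C) : csmooth_on O f -> csmooth_on O g -> csmooth_on O (fun x => f x - g x).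
  by move=> fs gs; apply: csmooth_onD => //; exact: csmooth_onN.
split.
  under eq_fun do rewrite mxE.
  apply: csmooth_on_sum => // k; apply: sB; apply: csmooth_onM => //;
    exact: csmooth_on_cpartial.
have ps (X xi : E -> 'rV[C]_n) : (forall k, csmooth_on O (fun x => X x 0 k)) ->
    (forall k, csmooth_on O (fun x => xi x 0 k)) ->
    csmooth_on O (fun x => pairing (X x) (xi x)).
  by move=> Xs xis; apply: csmooth_on_sum => // k; exact: csmooth_onM.
have ls (X xi : E -> 'rV[C]_n) : (forall k, csmooth_on O (fun x => X x 0 k)) ->
    (forall k, csmooth_on O (fun x => xi x 0 k)) ->
    csmooth_on O (fun x => lie_derivative X xi x 0 j).
  move=> Xs xis; under eq_fun do rewrite mxE.
  by apply: csmooth_on_sum => // k; apply: csmooth_onD => //; apply: csmooth_onM => //;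
    exact: csmooth_on_cpartial.
have h : csmooth_on O (fun x =>
   lie_derivative (fun y => (A y).1) (fun y => (B y).2) x 0 j
   - lie_derivative (fun y => (B y).1) (fun y => (A y).2) x 0 j
   - 2^-1 * cpartial j (fun y => pairing (A y).1 (B y).2 - pairing (B y).1 (A y).2) x).
  apply: (sB); first by apply: (sB); exact: ls.
  apply: csmooth_onM => //; first exact: csmooth_on_cst.
  by apply: csmooth_on_cpartial; apply: (sB); exact: ps.
by apply: (csmooth_on_ext oO _ h) => x _; rewrite /courant_coord /= !mxE.
Qed.

Lemma csmooth_open_neq0 O (f : E -> C) : open O -> csmooth_on O f ->
  open (O `&` [set x | f x != 0]).
Proof.
move=> oO fs; rewrite openE => x [Ox /= fx0]; rewrite /interior.
have nO : \forall y \near x, O y by exact: open_nbhs_nbhs.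
have [dr di] := csmooth_on_differentiable fs Ox.
have cr := differentiable_continuous dr; have ci := differentiable_continuous di.
have [re0|re0] := eqVneq (complex.Re (f x)) 0.
  have im0 : complex.Im (f x) != 0.
    by apply: contra fx0 => /eqP im0; rewrite eq_complex re0 im0 !eqxx.
  have h : \forall y \near x, complex.Im (f y) != 0.
    have := ci (fun t => t != 0); apply.
    exact: (open_nbhs_nbhs (conj (@open_neq R^o 0) im0)).
  apply: filterS2 nO h => y Oy p; split => //=.
  by apply: contra_neq p => ->.
have h : \forall y \near x, complex.Re (f y) != 0.
  have := cr (fun t => t != 0); apply.
  exact: (open_nbhs_nbhs (conj (@open_neq R^o 0) re0)).
apply: filterS2 nO h => y Oy p; split => //=.
by apply: contra_neq p => ->.
Qed.

End CoordinateSmoothness.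

(** * Coordinate expressions of sections and chart independence of d *)

Section Sections.
Context {R : realType} {n : nat} {M : smoothManifold R n}.
Local Notation C := R[i].
Local Notation E := 'rV[R]_n.
Implicit Types (a b c : chart R n M) (p q : M) (W : set M).
Implicit Types (w : M -> forms R n) (A B : M -> gtangent R n).

Local Notation img c W := (chart_map c @` (W `&` chart_dom c)).

Lemma imgI c W p : W p -> chart_dom c p -> img c W (chart_map c p).
Proof. by move=> Wp cp; exists p. Qed.

Lemma forms_inE c w p : chart_dom c p ->
  forms_in c w (chart_map c p) = forms_change (chart_at p) c p (w p).
Proof. by move=> cp; rewrite /forms_in (chart_mapK cp). Qed.

Lemma gtangent_inE c A p : chart_dom c p ->
  gtangent_in c A (chart_map c p) = gtangent_change (chart_at p) c p (A p).
Proof. by move=> cp; rewrite /gtangent_in (chart_mapK cp). Qed.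

Lemma forms_in_at w p : forms_in (chart_at p) w (chart_map (chart_at p) p) = w p.
Proof.
by apply: (eq_trans (forms_inE w (chart_at_dom p))); exact: forms_change_id (chart_at_dom p).
Qed.

Lemma gtangent_in_at A p : gtangent_in (chart_at p) A (chart_map (chart_at p) p) = A p.
Proof.
by apply: (eq_trans (gtangent_inE A (chart_at_dom p))); exact: gtangent_change_id (chart_at_dom p).
Qed.

Lemma forms_in_change a b w p : atlas a -> atlas b -> chart_dom a p -> chart_dom b p ->
  forms_in b w (chart_map b p) = forms_change a b p (forms_in a w (chart_map a p)).
Proof.
move=> aa ab ap bp; apply: (eq_trans (forms_inE w bp)); apply: esym.
apply: (eq_trans (congr1 _ (forms_inE w ap))).
exact: forms_change_comp (chart_at_atlas p) aa ab (chart_at_dom p) ap bp.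
Qed.

Lemma gtangent_in_change a b A p : atlas a -> atlas b -> chart_dom a p -> chart_dom b p ->
  gtangent_in b A (chart_map b p) = gtangent_change a b p (gtangent_in a A (chart_map a p)).
Proof.
move=> aa ab ap bp; apply: (eq_trans (gtangent_inE A bp)); apply: esym.
apply: (eq_trans (congr1 _ (gtangent_inE A ap))).
exact: gtangent_change_comp (chart_at_atlas p) aa ab (chart_at_dom p) ap bp.
Qed.

Definition cliffordM A w q := clifford (A q) (w q).

Lemma forms_in_clifford c A w p : atlas c -> chart_dom c p ->
  forms_in c (cliffordM A w) (chart_map c p) =
  clifford (gtangent_in c A (chart_map c p)) (forms_in c w (chart_map c p)).
Proof.
move=> ac cp; have h1 := forms_inE w cp; have h2 := gtangent_inE A cp.
have h3 := forms_inE (cliffordM A w) cp.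
have h4 := clifford_change (A p) (w p) (chart_at_atlas p) ac (chart_at_dom p) cp.
apply: (eq_trans h3); apply: (eq_trans (esym h4)).
by apply: congr2; apply: esym.
Qed.

Lemma forms_smooth_clifford W A w : open W -> gtangent_smooth W A -> forms_smooth W w ->
  forms_smooth W (cliffordM A w).
Proof.
move=> oW As ws c ac; have oI := open_chart_image (c := c) oW.
apply: (forms_csmooth_ext oI _ (clifford_csmooth oI (As c ac) (ws c ac))).
by move=> _ [p [Wp cp] <-]; apply: esym; exact: forms_in_clifford.
Qed.

(** Near the point, the expression in b is the pull-back of the expression in a along the transition
    from b to a, and d commutes with pull-backs. *)
Lemma ext_d_in_change a b W w p : atlas a -> atlas b -> chart_dom a p -> chart_dom b p ->
  open W -> W p -> forms_smooth W w ->
  ext_d_coord (forms_in b w) (chart_map b p) =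
  forms_change a b p (ext_d_coord (forms_in a w) (chart_map a p)).
Proof.
move=> aa ab ap bp oW Wp ws.
have oO := @open_overlap _ _ _ b a; have ts := transition_smooth ab aa.
have wd : forms_diff (forms_in a w) (transition b a (chart_map b p)).
  rewrite (transitionE a bp); apply: (forms_csmooth_diff (ws a aa)); exact: imgI.
have h := ext_d_pullback oO (overlapI bp ap) ts wd.
have h1 : {near chart_map b p, forms_in b w =1 (fun y => pullback
    (map_mx (fun r : R => r%:C) (jacobian (transition b a) y))
    (forms_in a w (transition b a y)))}.
  have : \forall y \near chart_map b p, overlap b a y.
    by apply: open_nbhs_nbhs; split=> //; exact: overlapI.
  apply: filterS => _ [q [bq aq] <-].
  apply: (eq_trans (forms_in_change w aa ab aq bq)).
  exact: (congr1 (fun z => pullback (jac b a q) (forms_in a w z)) (esym (transitionE a bq))).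
apply: (eq_trans (ext_d_ext h1)); apply: (eq_trans h).
exact: (congr1 (fun z => pullback (jac b a p) (ext_d_coord (forms_in a w) z)) (transitionE a bp)).
Qed.

(** Frees [ext_d] from the chart [chart_at p], which varies arbitrarily with p: on a whole chart
    domain it is given by one coordinate formula, which gives its smoothness. *)
Lemma ext_d_in b W w p : atlas b -> chart_dom b p -> open W -> W p -> forms_smooth W w ->
  forms_in b (ext_d w) (chart_map b p) = ext_d_coord (forms_in b w) (chart_map b p).
Proof.
move=> ab bp oW Wp ws; apply: (eq_trans (forms_inE _ bp)); apply: esym.
exact: (ext_d_in_change (chart_at_atlas p) ab (chart_at_dom p) bp oW Wp ws).
Qed.

Lemma forms_smooth_ext_d W w : open W -> forms_smooth W w -> forms_smooth W (ext_d w).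
Proof.
move=> oW ws c ac; have oI := open_chart_image (c := c) oW.
apply: (forms_csmooth_ext oI _ (ext_d_csmooth oI (ws c ac))).
by move=> _ [p [Wp cp] <-]; apply: esym; exact: ext_d_in ac cp oW Wp ws.
Qed.

Lemma near_chart c W p (P : E -> Prop) : open W -> W p -> chart_dom c p ->
  (forall q, W q -> chart_dom c q -> P (chart_map c q)) ->
  \forall y \near chart_map c p, P y.
Proof.
move=> oW Wp cp h.
have := open_nbhs_nbhs (conj (open_chart_image (c := c) oW) (imgI Wp cp)).
by apply: filterS => _ [q [Wq cq] <-]; exact: h.
Qed.

Lemma ext_d_near W w w' p : open W -> W p -> (forall q, W q -> w q = w' q) ->
  ext_d w p = ext_d w' p.
Proof.
move=> oW Wp h; apply: ext_d_ext; apply: (near_chart oW Wp (chart_at_dom p)) => q Wq cq.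
by apply: (eq_trans (forms_inE w cq)); apply: esym; rewrite (forms_inE w' cq) h.
Qed.

(** The right-hand side of the bracket formula as a function of values at one point: x3, x4, x2, x1,
    x0 stand for d(ABw), d(BAw), d(Bw), d(Aw), dw. A change of chart can then act on each argument
    separately. *)
Definition bracket_rhs (u v : gtangent R n) (x3 x4 x2 x1 x0 : forms R n) : forms R n :=
  x3 - x4 + 2 *: clifford u x2 - 2 *: clifford v x1
  + clifford u (clifford v x0) - clifford v (clifford u x0).

Lemma bracket_rhs_congr u u' v v' x3 x3' x4 x4' x2 x2' x1 x1' x0 x0' :
  u = u' -> v = v' -> x3 = x3' -> x4 = x4' -> x2 = x2' -> x1 = x1' -> x0 = x0' ->
  bracket_rhs u v x3 x4 x2 x1 x0 = bracket_rhs u' v' x3' x4' x2' x1' x0'.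
Proof. by move=> -> -> -> -> -> -> ->. Qed.

(* The right-hand side of [courant_clifford], computed in the chart c. *)
Definition courant_rhs c A B w p : forms R n :=
  bracket_rhs (gtangent_in c A (chart_map c p)) (gtangent_in c B (chart_map c p))
    (ext_d_coord (forms_in c (cliffordM A (cliffordM B w))) (chart_map c p))
    (ext_d_coord (forms_in c (cliffordM B (cliffordM A w))) (chart_map c p))
    (ext_d_coord (forms_in c (cliffordM B w)) (chart_map c p))
    (ext_d_coord (forms_in c (cliffordM A w)) (chart_map c p))
    (ext_d_coord (forms_in c w) (chart_map c p)).

Lemma courant_clifford_in c A B W w p : atlas c -> chart_dom c p -> open W -> W p ->
  gtangent_smooth W A -> gtangent_smooth W B -> forms_smooth W w ->
  2 *: clifford (courant_coord (gtangent_in c A) (gtangent_in c B) (chart_map c p))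
    (forms_in c w (chart_map c p)) = courant_rhs c A B w p.
Proof.
move=> ac cp oW Wp As Bs ws; have I := imgI Wp cp.
have dA := gtangent_csmooth_diff (As c ac) I.
have dB := gtangent_csmooth_diff (Bs c ac) I.
have dw := forms_csmooth_diff (ws c ac) I.
apply: (eq_trans (courant_clifford dA dB dw)).
have e1 A' : ext_d_coord (fun y => clifford (gtangent_in c A' y) (forms_in c w y)) (chart_map c p)
   = ext_d_coord (forms_in c (cliffordM A' w)) (chart_map c p).
  apply: ext_d_ext; apply: (near_chart oW Wp cp) => q Wq cq.
  by apply: esym; exact: forms_in_clifford.
have e2 A' B' : ext_d_coord (fun y => clifford (gtangent_in c A' y)
      (clifford (gtangent_in c B' y) (forms_in c w y))) (chart_map c p)
   = ext_d_coord (forms_in c (cliffordM A' (cliffordM B' w))) (chart_map c p).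
  apply: ext_d_ext; apply: (near_chart oW Wp cp) => q Wq cq; apply: esym.
  apply: (eq_trans (forms_in_clifford A' (cliffordM B' w) ac cq)).
  by apply: congr1; exact: forms_in_clifford.
by apply: bracket_rhs_congr.
Qed.

Lemma courant_rhs_change a b A B W w p : atlas a -> atlas b -> chart_dom a p -> chart_dom b p ->
  open W -> W p -> gtangent_smooth W A -> gtangent_smooth W B -> forms_smooth W w ->
  courant_rhs b A B w p = forms_change a b p (courant_rhs a A B w p).
Proof.
move=> aa ab ap bp oW Wp As Bs ws.
have Aws := forms_smooth_clifford oW As ws; have Bws := forms_smooth_clifford oW Bs ws.
have ABws := forms_smooth_clifford oW As Bws; have BAws := forms_smooth_clifford oW Bs Aws.
have e0 := ext_d_in_change aa ab ap bp oW Wp ws.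
have e1 := ext_d_in_change aa ab ap bp oW Wp Aws.
have e2 := ext_d_in_change aa ab ap bp oW Wp Bws.
have e3 := ext_d_in_change aa ab ap bp oW Wp ABws.
have e4 := ext_d_in_change aa ab ap bp oW Wp BAws.
have eA := gtangent_in_change A aa ab ap bp; have eB := gtangent_in_change B aa ab ap bp.
have brc u v x3 x4 x2 x1 x0 : forms_change a b p (bracket_rhs u v x3 x4 x2 x1 x0) =
  bracket_rhs (gtangent_change a b p u) (gtangent_change a b p v) (forms_change a b p x3)
    (forms_change a b p x4) (forms_change a b p x2) (forms_change a b p x1)
    (forms_change a b p x0).
  have cl v' z : clifford (gtangent_change a b p v') (forms_change a b p z) =
    forms_change a b p (clifford v' z) by exact: clifford_change.
  have fD z z' : forms_change a b p (z + z') = forms_change a b p z + forms_change a b p z'.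
    exact: linearD.
  have fN z : forms_change a b p (- z) = - forms_change a b p z by exact: linearN.
  have fZ k z : forms_change a b p (k *: z) = k *: forms_change a b p z by exact: linearZ.
  by rewrite /bracket_rhs !cl !(fD, fN, fZ).
apply: esym; apply: (eq_trans (brc _ _ _ _ _ _ _)).
by apply: bracket_rhs_congr; apply: esym.
Qed.

End Sections.

(** * Chart independence of smoothness and of the Courant bracket *)

Section ChartInvariance.
Context {R : realType} {n : nat} {M : smoothManifold R n}.
Local Notation C := R[i].
Local Notation E := 'rV[R]_n.
Implicit Types (a b c : chart R n M) (p q : M) (W : set M).
Implicit Types (w : M -> forms R n) (A B : M -> gtangent R n) (f : M -> C).

Local Notation img c W := (chart_map c @` (W `&` chart_dom c)).

Lemma img_transition a b W x : (W `<=` chart_dom a) -> img b W x ->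
  (chart_map a @` W) (transition b a x).
Proof. by move=> Wa [p [Wp bp] <-]; exists p => //; rewrite (transitionE a bp). Qed.

Lemma img_overlap a b W : W `<=` chart_dom a -> img b W `<=` overlap b a.
Proof. by move=> Wa x [p [Wp bp] <-]; apply: overlapI => //; exact: Wa. Qed.

Lemma csmooth_transition a b W (g : E -> C) : atlas a -> atlas b -> open W ->
  W `<=` chart_dom a -> csmooth_on (chart_map a @` W) g ->
  csmooth_on (img b W) (g \o transition b a).
Proof.
move=> aa ab oW Wa gs.
apply: csmooth_on_comp (open_chart_image (c := b) oW) _ _ gs.
  by move=> x; exact: img_transition.
by move=> s x /(img_overlap Wa); exact: transition_smooth.
Qed.

Lemma jac_smooth_img a b W i j : atlas a -> atlas b -> W `<=` chart_dom a ->
  csmooth_on (img b W) (fun x => jac a b (chart_inv b x) i j).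
Proof.
by move=> aa ab Wa; apply: csmooth_on_sub (jac_smooth_rev i j ab aa); exact: img_overlap.
Qed.

Lemma jac_smooth_img_rev a b W i j : atlas a -> atlas b -> W `<=` chart_dom a ->
  csmooth_on (img b W) (fun x => jac b a (chart_inv b x) i j).
Proof. by move=> aa ab Wa; apply: csmooth_on_sub (jac_smooth i j ab aa); exact: img_overlap. Qed.

(** [gtangent_smooth] asks for smoothness in every chart of the atlas. One chart covering W is
    enough, since the others differ by a transition map and by Jacobian matrices with smooth
    entries. *)
Lemma gtangent_smooth_of_chart a W A : atlas a -> open W -> W `<=` chart_dom a ->
  gtangent_csmooth (chart_map a @` W) (gtangent_in a A) -> gtangent_smooth W A.
Proof.
move=> aa oW Wa As b ab; have oI := open_chart_image (c := b) oW.
pose G x : gtangent R n := ((gtangent_in a A (transition b a x)).1 *m jac a b (chart_inv b x),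
  (gtangent_in a A (transition b a x)).2 *m (jac b a (chart_inv b x))^T).
have Gs : gtangent_csmooth (img b W) G.
  move=> j; split.
    under eq_fun do rewrite mxE; apply: csmooth_on_sum => // k.
    apply: (csmooth_onM oI); last exact: jac_smooth_img.
    exact: (csmooth_transition aa ab oW Wa (As k).1).
  under eq_fun do rewrite mxE; apply: csmooth_on_sum => // k.
  apply: (csmooth_onM oI); last by under eq_fun do rewrite mxE; exact: jac_smooth_img_rev.
  exact: (csmooth_transition aa ab oW Wa (As k).2).
apply: (gtangent_csmooth_ext oI _ Gs) => _ [p [Wp bp] <-]; have ap := Wa p Wp.
rewrite /G; apply: esym; apply: (eq_trans (gtangent_in_change A aa ab ap bp)).
by rewrite (transitionE a bp) (chart_mapK bp).
Qed.

Lemma forms_smooth_of_chart a W w : atlas a -> open W -> W `<=` chart_dom a ->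
  forms_csmooth (chart_map a @` W) (forms_in a w) -> forms_smooth W w.
Proof.
move=> aa oW Wa ws b ab; have oI := open_chart_image (c := b) oW.
pose G x : forms R n := pullback (jac b a (chart_inv b x)) (forms_in a w (transition b a x)).
have Gs : forms_csmooth (img b W) G.
  apply: (pullback_csmooth oI) => [i j|S]; first exact: jac_smooth_img_rev.
  exact: (csmooth_transition aa ab oW Wa (ws S)).
apply: (forms_csmooth_ext oI _ Gs) => _ [p [Wp bp] <-]; have ap := Wa p Wp.
rewrite /G; apply: esym; apply: (eq_trans (forms_in_change w aa ab ap bp)).
by rewrite (transitionE a bp) (chart_mapK bp).
Qed.

(** Test forms: smooth near a given point with any prescribed value there, as the faithfulness of
    the Clifford action requires. *)
Lemma constant_forms a (w0 : forms R n) : atlas a -> exists w,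
  forms_smooth (chart_dom a) w /\
  forall q, chart_dom a q -> forms_in a w (chart_map a q) = w0.
Proof.
move=> aa; pose w q := forms_change a (chart_at q) q w0.
have wE q : chart_dom a q -> forms_in a w (chart_map a q) = w0.
  move=> aq; apply: (eq_trans (forms_inE w aq)).
  exact: (forms_changeK aa (chart_at_atlas q) aq (chart_at_dom q) w0).
exists w; split => //.
apply: (forms_smooth_of_chart aa (chart_dom_open a)) => //.
apply: (@forms_csmooth_ext _ _ _ (fun=> w0)); first exact: chart_img_open.
  by move=> _ [q aq <-]; rewrite wE.
by move=> S; exact: csmooth_on_cst.
Qed.

Lemma forms_smooth_sub W W' w : W' `<=` W -> forms_smooth W w -> forms_smooth W' w.
Proof.
by move=> WW ws c ac S; apply: csmooth_on_sub (ws c ac S) => x [p [/WW Wp cp] <-]; exists p.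
Qed.

Lemma gtangent_smooth_sub W W' A : W' `<=` W -> gtangent_smooth W A -> gtangent_smooth W' A.
Proof.
move=> WW As c ac j; have [s1 s2] := As c ac j.
by split; [apply: csmooth_on_sub s1|apply: csmooth_on_sub s2] => x [p [/WW Wp cp] <-]; exists p.
Qed.

Lemma courant_in_change a b A B W p : atlas a -> atlas b -> chart_dom a p -> chart_dom b p ->
  open W -> W p -> gtangent_smooth W A -> gtangent_smooth W B ->
  courant_coord (gtangent_in b A) (gtangent_in b B) (chart_map b p) =
  gtangent_change a b p (courant_coord (gtangent_in a A) (gtangent_in a B) (chart_map a p)).
Proof.
move=> aa ab ap bp oW Wp As Bs.
have key z : clifford (courant_coord (gtangent_in b A) (gtangent_in b B) (chart_map b p)) z =
   clifford (gtangent_change a b p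
     (courant_coord (gtangent_in a A) (gtangent_in a B) (chart_map a p))) z.
  (* The vector z is extended to a form with constant coefficients in a. W is cut down to the domain
     of a, where this form is smooth, and the bracket formula is then available in both charts. *)
  have [w [ws wE]] := constant_forms (forms_change b a p z) aa.
  have oW' : open (W `&` chart_dom a) by apply: openI => //; exact: chart_dom_open.
  have W'p : (W `&` chart_dom a) p by [].
  have As' := gtangent_smooth_sub (@subIsetl _ W (chart_dom a)) As.
  have Bs' := gtangent_smooth_sub (@subIsetl _ W (chart_dom a)) Bs.
  have ws' := forms_smooth_sub (@subIsetr _ W (chart_dom a)) ws.
  have ha := courant_clifford_in aa ap oW' W'p As' Bs' ws'.
  have hb := courant_clifford_in ab bp oW' W'p As' Bs' ws'.
  have hc := courant_rhs_change aa ab ap bp oW' W'p As' Bs' ws'.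
  have zE : forms_in b w (chart_map b p) = z.
    apply: (eq_trans (forms_in_change w aa ab ap bp)).
    apply: (eq_trans (congr1 _ (wE p ap))); exact: (forms_changeK ab aa bp ap z).
  have chg k v y : forms_change a b p (k *: clifford v y) =
      k *: clifford (gtangent_change a b p v) (forms_change a b p y).
    by rewrite (clifford_change v y aa ab ap bp); exact: linearZ.
  have e1 := congr1 (forms_change a b p) ha.
  have e2 := eq_trans hb (eq_trans hc (esym e1)).
  have e3 := eq_trans e2 (chg 2 _ _).
  have e4 : forms_change a b p (forms_in a w (chart_map a p)) = z.
    apply: (eq_trans (congr1 _ (wE p ap))); exact: (forms_changeK ab aa bp ap z).
  move: e3; rewrite zE e4 => /(scalerI _); apply.
  by rewrite pnatr_eq0.
apply/eqP; rewrite -subr_eq0; apply/eqP; apply: clifford_faithful => z.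
by rewrite cliffordBl key subrr.
Qed.

End ChartInvariance.

(** * Bump functions on the manifold and extension of sections *)

Section BumpFunctions.
Context {R : realType} {n : nat} {M : smoothManifold R n}.
Local Notation C := R[i].
Local Notation E := 'rV[R]_n.
Implicit Types (a b c : chart R n M) (p q : M) (W : set M).
Implicit Types (w : M -> forms R n) (A B : M -> gtangent R n) (f : M -> C).

Local Notation img c W := (chart_map c @` (W `&` chart_dom c)).

Lemma courant_in b A B W p : atlas b -> chart_dom b p -> open W -> W p ->
  gtangent_smooth W A -> gtangent_smooth W B ->
  gtangent_in b (courant A B) (chart_map b p) =
  courant_coord (gtangent_in b A) (gtangent_in b B) (chart_map b p).
Proof.
move=> ab bp oW Wp As Bs; apply: (eq_trans (gtangent_inE _ bp)); apply: esym.
exact: (courant_in_change (chart_at_atlas p) ab (chart_at_dom p) bp oW Wp As Bs).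
Qed.

Lemma gtangent_smooth_courant W A B : open W -> gtangent_smooth W A -> gtangent_smooth W B ->
  gtangent_smooth W (courant A B).
Proof.
move=> oW As Bs c ac; have oI := open_chart_image (c := c) oW.
apply: (gtangent_csmooth_ext oI _ (courant_csmooth oI (As c ac) (Bs c ac))).
by move=> _ [p [Wp cp] <-]; apply: esym; exact: courant_in ac cp oW Wp As Bs.
Qed.

Lemma courant_cliffordM W A B w p : open W -> W p ->
  gtangent_smooth W A -> gtangent_smooth W B -> forms_smooth W w ->
  2 *: clifford (courant A B p) (w p) =
  bracket_rhs (A p) (B p) (ext_d (cliffordM A (cliffordM B w)) p)
    (ext_d (cliffordM B (cliffordM A w)) p) (ext_d (cliffordM B w) p)
    (ext_d (cliffordM A w) p) (ext_d w p).
Proof.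
move=> oW Wp As Bs ws.
have h := courant_clifford_in (chart_at_atlas p) (chart_at_dom p) oW Wp As Bs ws.
have e1 := forms_in_at w p; have eA := gtangent_in_at A p; have eB := gtangent_in_at B p.
have g : 2 *: clifford (courant A B p) (w p) = 2 *: clifford (courant A B p)
    (forms_in (chart_at p) w (chart_map (chart_at p) p)) by rewrite e1.
apply: (eq_trans g); apply: (eq_trans h).
by apply: bracket_rhs_congr.
Qed.

Definition fun_smooth W f := forall c, atlas c ->
  csmooth_on (img c W) (fun x => f (chart_inv c x)).

Lemma gtangent_inZ c f A x :
  gtangent_in c (fun q => f q *: A q) x = f (chart_inv c x) *: gtangent_in c A x.
Proof. by rewrite /gtangent_in; exact: linearZ. Qed.

Lemma forms_inZ c f w x :
  forms_in c (fun q => f q *: w q) x = f (chart_inv c x) *: forms_in c w x.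
Proof. by rewrite /forms_in; exact: linearZ. Qed.

Lemma gtangent_inD c A B x :
  gtangent_in c (fun q => A q + B q) x = gtangent_in c A x + gtangent_in c B x.
Proof. by rewrite /gtangent_in; exact: linearD. Qed.

Lemma forms_inD c w w' x :
  forms_in c (fun q => w q + w' q) x = forms_in c w x + forms_in c w' x.
Proof. by rewrite /forms_in; exact: linearD. Qed.

Lemma gtangent_smoothZ W f A : open W -> fun_smooth W f -> gtangent_smooth W A ->
  gtangent_smooth W (fun q => f q *: A q).
Proof.
move=> oW fs As c ac; have oI := open_chart_image (c := c) oW.
have h : gtangent_csmooth (img c W) (fun x => f (chart_inv c x) *: gtangent_in c A x).
  move=> j; have [s1 s2] := As c ac j; split; under eq_fun do rewrite mxE.
    exact: csmooth_onM oI (fs c ac) s1.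
  exact: csmooth_onM oI (fs c ac) s2.
by apply: (gtangent_csmooth_ext oI _ h) => x _; rewrite gtangent_inZ.
Qed.

Lemma forms_smoothZ W f w : open W -> fun_smooth W f -> forms_smooth W w ->
  forms_smooth W (fun q => f q *: w q).
Proof.
move=> oW fs ws c ac; have oI := open_chart_image (c := c) oW.
have h : forms_csmooth (img c W) (fun x => f (chart_inv c x) *: forms_in c w x).
  move=> S; under eq_fun do rewrite ffunE.
  exact: csmooth_onM oI (fs c ac) (ws c ac S).
by apply: (forms_csmooth_ext oI _ h) => x _; rewrite forms_inZ.
Qed.

Lemma gtangent_smoothD W A B : open W -> gtangent_smooth W A -> gtangent_smooth W B ->
  gtangent_smooth W (fun q => A q + B q).
Proof.
move=> oW As Bs c ac; have oI := open_chart_image (c := c) oW.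
have h : gtangent_csmooth (img c W) (fun x => gtangent_in c A x + gtangent_in c B x).
  move=> j; have [s1 s2] := As c ac j; have [t1 t2] := Bs c ac j.
  split; under eq_fun do rewrite mxE.
    exact: csmooth_onD oI s1 t1.
  exact: csmooth_onD oI s2 t2.
by apply: (gtangent_csmooth_ext oI _ h) => x _; rewrite gtangent_inD.
Qed.

Lemma forms_smoothD W w w' : open W -> forms_smooth W w -> forms_smooth W w' ->
  forms_smooth W (fun q => w q + w' q).
Proof.
move=> oW ws ws' c ac; have oI := open_chart_image (c := c) oW.
have h : forms_csmooth (img c W) (fun x => forms_in c w x + forms_in c w' x).
  move=> S; under eq_fun do rewrite ffunE.
  exact: csmooth_onD oI (ws c ac S) (ws' c ac S).
by apply: (forms_csmooth_ext oI _ h) => x _; rewrite forms_inD.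
Qed.

Lemma fun_smooth_cst W (k : C) : fun_smooth W (fun=> k).
Proof. by move=> c ac; exact: csmooth_on_cst. Qed.

Lemma fun_smooth_sub W W' f : W' `<=` W -> fun_smooth W f -> fun_smooth W' f.
Proof.
by move=> WW fs c ac; apply: csmooth_on_sub (fs c ac) => x [p [/WW Wp cp] <-]; exists p.
Qed.

Lemma forms_smooth0 W : forms_smooth W (fun=> 0 : forms R n).
Proof.
move=> c ac S; have h : (fun x : E => forms_in c (fun=> 0 : forms R n) x S : C) = (fun=> 0).
  apply/funext => x; rewrite /forms_in.
  have -> : forms_change (chart_at (chart_inv c x)) c (chart_inv c x) 0 = 0 by exact: linear0.
  by rewrite ffunE.
by rewrite h; exact: csmooth_on_cst.
Qed.

Lemma gtangent_smooth0 W : gtangent_smooth W (fun=> 0 : gtangent R n).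
Proof.
move=> c ac j; have h (x : E) : gtangent_in c (fun=> 0 : gtangent R n) x = 0.
  by rewrite /gtangent_in; exact: linear0.
by split; under eq_fun do rewrite h mxE; exact: csmooth_on_cst.
Qed.

Lemma gtangent_smooth_sum W k (F : 'I_k -> M -> gtangent R n) (s : seq 'I_k) : open W ->
  (forall i, gtangent_smooth W (F i)) ->
  gtangent_smooth W (fun q => \sum_(i <- s) F i q).
Proof.
move=> oW Fs; elim: s => [|i s IH].
  by under eq_fun do rewrite big_nil; exact: gtangent_smooth0.
by under eq_fun do rewrite big_cons; exact: gtangent_smoothD.
Qed.

Lemma gtangent_smooth_ext W A B : open W -> (forall q, W q -> A q = B q) ->
  gtangent_smooth W A -> gtangent_smooth W B.
Proof.
move=> oW AB As c ac; have oI := open_chart_image (c := c) oW.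
apply: (gtangent_csmooth_ext oI _ (As c ac)) => _ [p [Wp cp] <-].
by apply: (eq_trans (gtangent_inE A cp)); apply: esym; rewrite (gtangent_inE B cp) AB.
Qed.

Lemma forms_smooth_ext W w w' : open W -> (forall q, W q -> w q = w' q) ->
  forms_smooth W w -> forms_smooth W w'.
Proof.
move=> oW ww ws c ac; have oI := open_chart_image (c := c) oW.
apply: (forms_csmooth_ext oI _ (ws c ac)) => _ [p [Wp cp] <-].
by apply: (eq_trans (forms_inE w cp)); apply: esym; rewrite (forms_inE w' cp) ww.
Qed.

Lemma gtangent_smooth_local W A :
  (forall p, W p -> exists W', W' p /\ gtangent_smooth W' A) -> gtangent_smooth W A.
Proof.
move=> h c ac j; split; apply: csmooth_on_local => x [p [Wp cp] <-];
  have [W' [W'p As]] := h p Wp; exists (img c W'); (split; first by exists p);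
  by have [] := As c ac j.
Qed.

Lemma forms_smooth_local W w :
  (forall p, W p -> exists W', W' p /\ forms_smooth W' w) -> forms_smooth W w.
Proof.
move=> h c ac S; apply: csmooth_on_local => x [p [Wp cp] <-].
have [W' [W'p ws]] := h p Wp; exists (img c W'); split; first by exists p.
exact: ws.
Qed.

(** K is a closed set containing the support. Its complement is open and phi vanishes there, so W
    and the complement of K form an open cover on which a product with phi can be studied. *)
Definition is_bump W p (phi : M -> C) := exists (V K : set M),
  [/\ fun_smooth setT phi, open V /\ V p, (forall q, V q -> phi q = 1),
      closed K /\ K `<=` W & forall q, ~ K q -> phi q = 0].

Lemma bump_manifold W p : open W -> W p -> exists phi, is_bump W p phi.
Proof.
move=> oW Wp; pose c := chart_at p; have cp : chart_dom c p := chart_at_dom p.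
have ac : atlas c := chart_at_atlas p.
have /nbhs_ballP[r0 /= r00 hr0] : nbhs (chart_map c p) (img c W).
  by apply: open_nbhs_nbhs; split; [exact: open_chart_image | exact: imgI].
(* The closed ball of radius 2 r, outside which [phi0] vanishes, then lies in the open ball of
   radius r0. *)
pose r := r0 / 3; have rp : 0 < r by rewrite divr_gt0.
have [phi0 [ps p1 p0]] := bump_rV (chart_map c p) rp.
pose phi q : C := if `[< chart_dom c q >] then (phi0 (chart_map c q))%:C else 0.
pose D := [set y : E | `|y - chart_map c p| <= 2 * r].
have DW : D `<=` img c W.
  move=> y /= Dy; apply: hr0; rewrite -ball_normE /= distrC (le_lt_trans Dy) //.
  by rewrite /r mulrCA gtr_pMr // ltr_pdivrMr // mul1r ltr_nat.
pose K := chart_inv c @` D.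
have cD : compact D.
  apply: bounded_closed_compact.
    exists (2 * r + `|chart_map c p|); split; first by rewrite num_real.
    move=> t ht y /= Dy; rewrite (le_trans _ (ltW ht)) //.
    rewrite -[y in leLHS](subrK (chart_map c p)) (le_trans (ler_normD _ _)) // lerD2r //.
  have -> : D = closed_ball_ (@Num.norm _ _) (chart_map c p) (2 * r).
    by apply/seteqP; split => y /=; rewrite /closed_ball_ /= distrC.
  exact: closed_closed_ball_.
(* A ball that is closed in the chart need not be closed in M in general; here it is compact, and M
   is Hausdorff. *)
have cK : closed K.
  apply: compact_closed; first exact: manifold_hausdorff.
  apply: continuous_compact => //.
  apply: (@continuous_subspaceW _ _ _ (chart_map c @` chart_dom c)).
    by move=> y /DW [q [_ cq] <-]; exists q.
  exact: chart_inv_continuous.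
have Kdom q : K q -> W q /\ chart_dom c q.
  by move=> [y /DW [q' [Wq' cq'] <-] <-]; rewrite (chart_mapK cq').
have phi0K q : ~ K q -> phi q = 0.
  move=> nK; rewrite /phi; case: asboolP => // cq; rewrite p0 //.
  rewrite leNgt; apply/negP => lt; apply: nK; exists (chart_map c q); last exact: chart_mapK.
  exact: ltW.
exists phi, (chart_dom c `&` chart_map c @^-1` (ball (chart_map c p) r)), K; split => //.
- move=> b ab; apply: csmooth_on_local => x [q [_ bq] <-].
  have [cq|ncq] := pselect (chart_dom c q).
    exists (overlap b c); split; first exact: overlapI.
    have oO := @open_overlap _ _ _ b c.
    have h := csmooth_on_real (smooth_on_compm oO (fun x _ => I : setT (transition b c x))
      (transition_smooth ab ac) ps).
    apply: (csmooth_on_ext oO _ h) => _ [q' [bq' cq'] <-].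
    rewrite /phi (chart_mapK bq') asboolT //; congr (_ %:C).
    exact: (congr1 phi0 (transitionE c bq')).
  exists (img b (~` K)); split.
    by exists q => //; split => // /Kdom [].
  have oO := open_chart_image (c := b) (closed_openC cK).
  apply: (csmooth_on_ext oO _ (csmooth_on_cst _ 0)) => _ [q' [nK bq'] <-].
  by rewrite (chart_mapK bq') phi0K.
- split; last by split => //=; exact: ballxx.
  by apply: open_chart_preimage; exact: ball_open.
- move=> q [cq /=]; rewrite -ball_normE /= => lt; rewrite /phi asboolT // p1 //.
  by rewrite distrC ltW.
- by split => // q /Kdom [].
Qed.

Lemma gtangent_smooth_extend W p phi A : open W -> is_bump W p phi -> gtangent_smooth W A ->
  gtangent_smooth setT (fun q => phi q *: A q).
Proof.
move=> oW [V [K [phis _ _ [cK KW] phi0]]] As.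
apply: gtangent_smooth_local => q _; have [Wq|nWq] := pselect (W q).
  exists W; split => //; apply: gtangent_smoothZ => //.
  exact: fun_smooth_sub phis.
exists (~` K); split; first by move=> /KW.
apply: (gtangent_smooth_ext (closed_openC cK) _ (gtangent_smooth0 _)) => q' nK.
by rewrite phi0 // scale0r.
Qed.

Lemma forms_smooth_extend W p phi w : open W -> is_bump W p phi -> forms_smooth W w ->
  forms_smooth setT (fun q => phi q *: w q).
Proof.
move=> oW [V [K [phis _ _ [cK KW] phi0]]] ws.
apply: forms_smooth_local => q _; have [Wq|nWq] := pselect (W q).
  exists W; split => //; apply: forms_smoothZ => //.
  exact: fun_smooth_sub phis.
exists (~` K); split; first by move=> /KW.
apply: (forms_smooth_ext (closed_openC cK) _ (forms_smooth0 _)) => q' nK.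
by rewrite phi0 // scale0r.
Qed.

End BumpFunctions.

(** * Dirac structures and their spinor lines *)

Section DiracSpinor.
Context {R : realType} {n : nat} {M : smoothManifold R n}.
Local Notation C := R[i].
Local Notation E := 'rV[R]_n.
Context {L : M -> {vspace gtangent R n}} {U : M -> {vspace forms R n}}.
Hypotheses (hL : almost_dirac L) (hU : pure_spinor_line L U).
Implicit Types (p q : M) (W : set M) (rho w : M -> forms R n) (A B : M -> gtangent R n).

Let mL p : maximal_isotropic (L p). Proof. by have [_] := hL; apply. Qed.
Let dU p : \dim (U p) = 1%N. Proof. by have [_ h _] := hU. Qed.
Let LU p v : v \in L p <-> (forall w : forms R n, w \in U p -> clifford v w = 0).
Proof. by have [_ _ h] := hU. Qed.

Lemma dirac_annihilates p v (w : forms R n) : v \in L p -> w \in U p -> clifford v w = 0.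
Proof. by move=> /LU h /h. Qed.

Lemma spinor_line p r (w : forms R n) : r \in U p -> r != 0 -> w \in U p -> exists k, w = k *: r.
Proof.
move=> rU r0 wU; have : U p = <[r]>%VS.
  by apply/esym/eqP; rewrite eqEdim -memvE rU dim_vline r0 dU.
by move=> h; rewrite h in wU; apply/vlineP.
Qed.

Lemma exists_trivialization p : exists W rho, local_trivialization U W rho /\ W p.
Proof.
have [sU _ _] := hU; have [W [k [s [oW Wp ss bs]]]] := sU p.
have k1 : k = 1%N.
  have h : basis_of (U p) (mktuple (fun i => s i p)) := bs p Wp.
  by rewrite -(size_basis h) dU.
have k0 : (0 < k)%N by rewrite k1.
have mem q : s (Ordinal k0) q \in [seq s i q | i <- enum 'I_k].
  by apply/mapP; exists (Ordinal k0) => //; rewrite mem_enum.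
exists W, (s (Ordinal k0)); split => //; split => // q Wq; split.
  exact: (basis_mem (bs q Wq) (mem q)).
exact: free_not0 (basis_free (bs q Wq)) (mem q).
Qed.

Lemma exists_frame p : exists W k (s : 'I_k -> M -> gtangent R n),
  [/\ open W, W p, forall i, gtangent_smooth W (s i) &
      forall q, W q -> basis_of (L q) (mktuple (fun i => s i q))].
Proof.
have [sL _] := hL; have [W [k [s [oW Wp ss bs]]]] := sL p.
by exists W, k, s; split.
Qed.

(** Involutivity speaks of global sections only, so each vector of L has to be reached by one:
    constant coefficients in a local frame, cut off by a bump function. *)
Lemma section_through p u : u \in L p -> exists A, gtangent_section L A /\ A p = u.
Proof.
move=> uL; have [W [k [s [oW Wp ss bs]]]] := exists_frame p.
pose B q := \sum_(i < k) coord (mktuple (fun i => s i p)) i u *: s i q.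
have Bs : gtangent_smooth W B.
  apply: gtangent_smooth_sum => // i.
  exact: gtangent_smoothZ oW (fun_smooth_cst W _) (ss i).
have BL q : W q -> B q \in L q.
  move=> Wq; apply: memv_suml => i _; apply: memvZ.
  apply: (basis_mem (bs q Wq)); apply/tnthP; exists i; by rewrite tnth_mktuple.
have Bp : B p = u.
  have uS : u \in <<mktuple (fun i => s i p)>>%VS by rewrite (span_basis (bs p Wp)).
  rewrite [RHS](coord_span uS); apply: eq_bigr => i _.
  by rewrite nth_mktuple.
have [phi bphi] := bump_manifold oW Wp.
exists (fun q => phi q *: B q); split; last first.
  by have [V [K [_ [_ Vp] phi1 _ _]]] := bphi; rewrite phi1 // scale1r.
split; first exact: gtangent_smooth_extend oW bphi Bs.
move=> q; have [V [K [_ _ _ [_ KW] phi0]]] := bphi.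
have [Wq|nWq] := pselect (W q); first by apply: memvZ; exact: BL.
by rewrite phi0 ?scale0r ?mem0v // => /KW.
Qed.

Lemma ext_d0 p : ext_d (fun _ : M => 0 : forms R n) p = 0.
Proof.
rewrite /ext_d ext_d_coordE big1 // => j _.
have -> : forms_partial j (forms_in (chart_at p) (fun=> 0)) (chart_map (chart_at p) p) = 0.
  apply/ffunP => S; rewrite ffunE [RHS]ffunE.
  have h (x : E) : forms_in (chart_at p) (fun=> 0 : forms R n) x = 0.
    by rewrite /forms_in; exact: linear0.
  by under eq_fun do rewrite h ffunE; exact: cpartial_cst.
exact: linear0.
Qed.

Lemma courant_on_spinor A B W rho p : gtangent_section L A -> gtangent_section L B ->
  local_trivialization U W rho -> W p ->
  clifford (courant A B p) (rho p) = clifford (A p) (clifford (B p) (ext_d rho p)).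
Proof.
move=> [As AL] [Bs BL] [oW rs rU] Wp.
have As' : gtangent_smooth W A by apply: gtangent_smooth_sub As.
have Bs' : gtangent_smooth W B by apply: gtangent_smooth_sub Bs.
(* The products A' rho vanish on all of the open set W, so their exterior derivatives vanish at p as
   well. *)
have z A' : (forall q, A' q \in L q) -> forall q, W q -> cliffordM A' rho q = 0.
  by move=> A'L q Wq; exact: dirac_annihilates (A'L q) (rU q Wq).1.
have dz A' : (forall q, A' q \in L q) -> ext_d (cliffordM A' rho) p = 0.
  by move=> A'L; apply: (eq_trans (ext_d_near oW Wp (z A' A'L))); exact: ext_d0.
have dzz A' B' : (forall q, B' q \in L q) -> ext_d (cliffordM A' (cliffordM B' rho)) p = 0.
  move=> B'L; apply: eq_trans (ext_d0 p); apply: (ext_d_near oW Wp) => q Wq.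
  by rewrite {1}/cliffordM (z B' B'L q Wq); exact: linear0.
have h := courant_cliffordM oW Wp As' Bs' rs.
have h' := eq_trans h (bracket_rhs_congr erefl erefl (dzz A B BL) (dzz B A AL)
  (dz B BL) (dz A AL) erefl).
have iAB : inner (A p) (B p) = 0 by apply: (mL p).1.
move: h'; rewrite /bracket_rhs.
move: (courant A B p) (ext_d rho p) (A p) (B p) (rho p) iAB => c d a b r iab h'.
apply: (@scalerI _ _ (2 : C)); first by rewrite pnatr_eq0.
(* A and B are orthogonal, so B A d rho = - A B d rho; the last two terms add up and absorb the
   factor 2. *)
rewrite {}h' [clifford b (clifford a d)]cliffordC innerC iab mulr0 scale0r !sub0r opprK.
have -> (v : gtangent R n) : clifford v 0 = 0 :> forms R n by exact: linear0.
have -> (v : gtangent R n) : clifford v 0 = 0 :> forms R n by exact: linear0.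
by rewrite !scaler0 !(subr0, addr0, oppr0, add0r) -mulr2n scaler_nat.
Qed.

(** Vectors u and v of a single fibre replace sections: this pointwise form no longer distinguishes
    local from global sections of L. *)
Definition spinor_condition := forall W rho p, local_trivialization U W rho -> W p ->
  forall u v, u \in L p -> v \in L p -> clifford u (clifford v (ext_d rho p)) = 0.

Lemma involutive_spinor_condition : courant_involutive L -> spinor_condition.
Proof.
move=> inv W rho p tr Wp u v uL vL.
have [A [As <-]] := section_through uL; have [B [Bs <-]] := section_through vL.
rewrite -(courant_on_spinor As Bs tr Wp).
have [_ rs rU] := tr; have [rpU _] := rU p Wp.
exact: dirac_annihilates ((inv A B As Bs).2 p) rpU.
Qed.

Lemma spinor_condition_involutive : spinor_condition -> courant_involutive L.
Proof.
move=> cond A B As Bs; split.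
  exact: gtangent_smooth_courant openT As.1 Bs.1.
move=> p; apply/LU => w wU; have [W [rho [tr Wp]]] := exists_trivialization p.
have [_ rs rU] := tr; have [rpU rp0] := rU p Wp.
have [k ->] := spinor_line rpU rp0 wU.
have h := courant_on_spinor As Bs tr Wp.
have h' := cond W rho p tr Wp _ _ (As.2 p) (Bs.2 p).
have z := eq_trans h h'.
by rewrite cliffordZr z scaler0.
Qed.

(** Moving u' past v leaves a scalar multiple of w, since u' kills w; u then kills that multiple. *)
Lemma clifford_isotropic p u u' v (w : forms R n) : u \in L p -> u' \in L p -> w \in U p ->
  clifford u (clifford u' (clifford v w)) = 0.
Proof.
move=> uL u'L wU; rewrite [clifford u' _]cliffordC cliffordBr cliffordZr.
rewrite (dirac_annihilates uL wU) (dirac_annihilates u'L wU).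
have -> : clifford v 0 = 0 :> forms R n by exact: linear0.
have -> : clifford u 0 = 0 :> forms R n by exact: linear0.
by rewrite scaler0 subr0.
Qed.

(** A bump function equal to 1 near p turns [rho] into a global section with the same exterior
    derivative at p. *)
Lemma global_spinor_condition :
  (forall w, forms_section (U0 U) w -> forms_section (U1 U) (ext_d w)) -> spinor_condition.
Proof.
move=> glob W rho p [oW rs rU] Wp u v uL vL.
have [phi bphi] := bump_manifold oW Wp.
have ws : forms_section (U0 U) (fun q => phi q *: rho q).
  split; first exact: forms_smooth_extend oW bphi rs.
  move=> q; have [V [K [_ _ _ [_ KW] phi0]]] := bphi; rewrite /U0 /=.
  have [Wq|nWq] := pselect (W q); first by apply: memvZ; exact: (rU q Wq).1.
  by rewrite phi0 ?scale0r ?mem0v // => /KW.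
have [v' [w [wU dw]]] := (glob _ ws).2 p.
have [V [K [_ [oV Vp] phi1 _ _]]] := bphi.
have e : ext_d (fun q => phi q *: rho q) p = ext_d rho p.
  by apply: (ext_d_near oV Vp) => q Vq; rewrite phi1 // scale1r.
have e' := eq_trans (esym e) dw.
by rewrite e'; exact: (clifford_isotropic v' uL vL wU).
Qed.

End DiracSpinor.

(** * Local solutions of d rho = v rho *)

Section PrescribedInner.
Context {R : realType} {n : nat}.
Local Notation C := R[i].
Local Notation E := 'rV[R]_n.

(** The partial derivatives of r inherit its parity, because e is the same at all points of O, and
    multiplication by dx_j reverses it. *)
Lemma parity_ext_d (O : set E) (r : E -> forms R n) (e : C) x : open O -> O x ->
  (forall y, O y -> parity (r y) = e *: r y) ->
  parity (ext_d_coord r x) = - e *: ext_d_coord r x.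
Proof.
move=> oO Ox pr; rewrite ext_d_coordE linear_sum scaler_sumr; apply: eq_bigr => j _ /=.
rewrite parity_clifford.
have -> : parity (forms_partial j r x) = e *: forms_partial j r x.
  apply/ffunP => T; rewrite ffunE [RHS]ffunE ffunE.
  (* If the sign of T differs from e, the coefficient r_T vanishes throughout O, and so do its
     derivatives. *)
  have [<-//|ne] := eqVneq ((-1) ^+ #|T|) e.
  have -> : cpartial j (fun y => r y T) x = cpartial j (fun=> 0) x.
    apply: cpartial_ext; apply: filterS (open_nbhs_nbhs (conj oO Ox)) => y Oy.
    have /ffunP/(_ T) := pr y Oy; rewrite ffunE [RHS]ffunE => /eqP.
    rewrite -subr_eq0 -[X in _ - X]/(e * r y T) -mulrBl mulf_eq0 subr_eq0 (negPf ne) /=.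
    by move/eqP.
  by rewrite cpartial_cst mulr0; apply: esym; exact: mulr0.
by rewrite cliffordZr scaleNr.
Qed.

Lemma inner_csmooth (O : set E) (u : gtangent R n) (A : E -> gtangent R n) : open O ->
  gtangent_csmooth O A -> csmooth_on O (fun x => inner u (A x)).
Proof.
move=> oO As; apply: (csmooth_onM oO); first exact: csmooth_on_cst.
apply: (csmooth_onD oO); apply: (csmooth_on_sum _ _ oO) => k; apply: (csmooth_onM oO).
- exact: csmooth_on_cst.
- by have [] := As k.
- by have [] := As k.
- exact: csmooth_on_cst.
Qed.

Lemma adj_csmooth (O : set E) k (G : E -> 'M[C]_k) i j : open O ->
  (forall i j, csmooth_on O (fun x => G x i j)) -> csmooth_on O (fun x => (\adj (G x)) i j).
Proof.
move=> oO Gs; under eq_fun do rewrite mxE.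
apply: (csmooth_onM oO); first exact: csmooth_on_cst.
apply: (csmooth_on_det oO) => i' j'; under eq_fun do rewrite 2!mxE.
exact: Gs.
Qed.

(* Cramer's rule: v has prescribed pairings g with the moving frame A. *)
Lemma prescribed_inner (O : set E) k (A : 'I_k -> E -> gtangent R n) (g : 'I_k -> E -> C)
    (f : 'I_k -> gtangent R n) :
  let G x := \matrix_(i, j) (2 * inner (f i) (A j x)) in
  open O -> (forall i, gtangent_csmooth O (A i)) -> (forall i, csmooth_on O (g i)) ->
  (forall x, O x -> \det (G x) != 0) ->
  exists v, gtangent_csmooth O v /\ forall x, O x -> forall j, 2 * inner (A j x) (v x) = g j x.
Proof.
move=> G oO As gs G0.
have Gs i j : csmooth_on O (fun x => G x i j).
  under eq_fun do rewrite mxE; apply: (csmooth_onM oO); first exact: csmooth_on_cst.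
  exact: inner_csmooth.
(* v is sought in the span of the constant vectors f i; its coefficients solve a G = g, that is a =
   g G^(-1). *)
pose a x := (\det (G x))^-1 *: ((\row_i g i x) *m \adj (G x)).
have as_ i : csmooth_on O (fun x => a x 0 i).
  under eq_fun do rewrite 2!mxE; apply: (csmooth_onM oO).
    by apply: (csmooth_on_inv oO) => //; exact: csmooth_on_det.
  apply: (csmooth_on_sum _ _ oO) => j; under eq_fun do rewrite mxE.
  by apply: (csmooth_onM oO) => //; exact: adj_csmooth.
have comp1 x j : (\sum_i a x 0 i *: f i).1 0 j = \sum_i a x 0 i * (f i).1 0 j.
  have -> : (\sum_i a x 0 i *: f i).1 = \sum_i a x 0 i *: (f i).1 by exact: (big_morph fst).
  by rewrite summxE; apply: eq_bigr => i _; rewrite mxE.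
have comp2 x j : (\sum_i a x 0 i *: f i).2 0 j = \sum_i a x 0 i * (f i).2 0 j.
  have -> : (\sum_i a x 0 i *: f i).2 = \sum_i a x 0 i *: (f i).2 by exact: (big_morph snd).
  by rewrite summxE; apply: eq_bigr => i _; rewrite mxE.
exists (fun x => \sum_i a x 0 i *: f i); split.
  move=> j; split; [under eq_fun do rewrite comp1|under eq_fun do rewrite comp2];
    apply: (csmooth_on_sum _ _ oO) => i; apply: (csmooth_onM oO) => //; exact: csmooth_on_cst.
move=> x Ox j; rewrite inner_sumr mulr_sumr.
have aG : a x *m G x = \row_i g i x.
  by rewrite /a -scalemxAl -mulmxA mul_adj_mx mul_mx_scalar scalerA mulVf ?G0 // scale1r.
have -> : g j x = (a x *m G x) 0 j by rewrite aG mxE.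
rewrite mxE; apply: eq_bigr => i _.
by rewrite innerC innerZl mulrCA [G x i j]mxE.
Qed.

End PrescribedInner.

Section LocalSolution.
Context {R : realType} {n : nat} {M : smoothManifold R n}.
Local Notation C := R[i].
Local Notation E := 'rV[R]_n.
Context {L : M -> {vspace gtangent R n}} {U : M -> {vspace forms R n}}.
Hypotheses (hL : almost_dirac L) (hU : pure_spinor_line L U).
Implicit Types (p q : M) (W : set M) (rho w : M -> forms R n) (A B : M -> gtangent R n).

Let mL p : maximal_isotropic (L p). Proof. by have [_] := hL; apply. Qed.
Let dU p : \dim (U p) = 1%N. Proof. by have [_ h _] := hU. Qed.
Let LU p v : v \in L p <-> (forall w : forms R n, w \in U p -> clifford v w = 0).
Proof. by have [_ _ h] := hU. Qed.

(** By [spinor_condition], L annihilates e d rho, which therefore lies in the line spanned by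
    rho. *)
Lemma frame_coefficient (W : set M) rho q e : @spinor_condition _ _ _ L U ->
  local_trivialization U W rho -> W q -> e \in L q ->
  exists k, clifford e (ext_d rho q) = k *: rho q.
Proof.
move=> cond tr Wq eL; have [_ _ rU] := tr; have [rqU rq0] := rU q Wq.
apply: (spinor_line hU rqU rq0); apply: (pure_spinor_uniq (mL q) (dU q) (LU q)) => v vL.
exact: cond tr Wq _ _ vL eL.
Qed.

(** Along a frame e_i of L, e_i d rho = k_i rho, and e_i (s rho) = 2 <e_i, s> rho because e_i kills
    rho. It suffices to find a smooth s with 2 <e_i, s> = k_i; parity then excludes the multiple of
    rho that could still separate d rho from s rho. *)
Lemma local_solution W rho p : @spinor_condition _ _ _ L U ->
  local_trivialization U W rho -> W p -> exists W' s,
  [/\ open W', W' p, W' `<=` W, gtangent_smooth W' s &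
      forall q, W' q -> ext_d rho q = clifford (s q) (rho q)].
Proof.
move=> cond tr Wp; have [oW rs rU] := tr.
have [W1 [k [e [oW1 W1p es eb]]]] := exists_frame hL p.
pose c := chart_at p; have cp : chart_dom c p := chart_at_dom p.
have ac : atlas c := chart_at_atlas p.
have oN : open (W `&` W1) by exact: openI.
pose O := chart_map c @` ((W `&` W1) `&` chart_dom c).
have oO : open O by exact: open_chart_image.
have Op : O (chart_map c p) by exists p.
pose r := forms_in c rho; pose al := ext_d_coord r.
pose ei i := gtangent_in c (e i).
have rsm : forms_csmooth O r by exact: forms_smooth_sub (@subIsetl _ W W1) rs c ac.
have alsm : forms_csmooth O al by exact: ext_d_csmooth.
have eism i : gtangent_csmooth O (ei i).
  exact: gtangent_smooth_sub (@subIsetr _ W W1) (es i) c ac.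
(* One coefficient of rho that does not vanish near p serves twice: dividing by it gives the k_i as
   smooth functions, and the cardinal of S gives the parity of rho. *)
have [S rS] : exists S, rho p S != 0.
  apply: contrapT => /forallNP h; have [_ /eqP] := rU p Wp; apply.
  by apply/ffunP => S; rewrite [RHS]ffunE; apply/eqP/negPn/negP; exact: h.
have rp : r (chart_map c p) = rho p := forms_in_at rho p.
have eip i : ei i (chart_map c p) = e i p := gtangent_in_at (e i) p.
have ex_f i : exists f, forall j, 2 * inner f (e j p) = (i == j)%:R.
  have [f hf] := dual_family (basis_free (eb p W1p)) i.
  by exists f => j; rewrite -hf nth_mktuple.
pose f i := sval (cid (ex_f i)).
have hf i j : 2 * inner (f i) (e j p) = (i == j)%:R by rewrite /f; case: cid.
pose G x := \matrix_(i, j) (2 * inner (f i) (ei j x)).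
have Gs i j : csmooth_on O (fun x => G x i j).
  under eq_fun do rewrite mxE; apply: (csmooth_onM oO); first exact: csmooth_on_cst.
  exact: inner_csmooth.
(* A single function whose nonvanishing ensures both conditions. It is nonzero at p, where G is the
   identity since f is dual to the frame there. *)
pose h x : C := r x S * \det (G x).
have hs : csmooth_on O h.
  by apply: (csmooth_onM oO); [exact: rsm | exact: csmooth_on_det].
pose O' := O `&` [set x | h x != 0].
have oO' : open O' by exact: csmooth_open_neq0.
have O'O : O' `<=` O by exact: subIsetl.
have O'p : O' (chart_map c p).
  split => //=; rewrite /h rp; apply: mulf_neq0 => //.
  have -> : G (chart_map c p) = 1%:M by apply/matrixP => i j; rewrite !mxE eip hf.
  by rewrite det1 oner_neq0.
have rS0 x : O' x -> r x S != 0 by move=> [_ /=]; rewrite mulf_eq0 negb_or => /andP[].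
have G0 x : O' x -> \det (G x) != 0 by move=> [_ /=]; rewrite mulf_eq0 negb_or => /andP[].
(* The scalar k_i of [frame_coefficient], read off from the coefficient of index S. *)
pose g i x : C := clifford (ei i x) (al x) S / r x S.
have rsm' : forms_csmooth O' r by move=> T; apply: csmooth_on_sub (rsm T).
have eism' i : gtangent_csmooth O' (ei i).
  by move=> j; have [s1 s2] := eism i j; split; [exact: csmooth_on_sub s1|exact: csmooth_on_sub s2].
have alsm' : forms_csmooth O' al by move=> T; apply: csmooth_on_sub (alsm T).
have gs i : csmooth_on O' (g i).
  apply: (csmooth_onM oO'); first exact: (clifford_csmooth oO' (eism' i) alsm').
  by apply: (csmooth_on_inv oO') => //; exact: rsm'.
have [v [vs hv]] := prescribed_inner oO' eism' gs G0.
pose W' := chart_dom c `&` chart_map c @^-1` O'.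
have W'sub q : W' q -> W q /\ W1 q.
  move=> [cq /O'O [q' [[Wq' W1q'] cq'] e']].
  by rewrite -(chart_mapK cq) -e' (chart_mapK cq').
have oW' : open W' by exact: open_chart_preimage.
have W'c : W' `<=` chart_dom c by exact: subIsetl.
pose s q := gtangent_change c (chart_at q) q (v (chart_map c q)).
have sE q : chart_dom c q -> gtangent_in c s (chart_map c q) = v (chart_map c q).
  move=> cq; apply: (eq_trans (gtangent_inE s cq)).
  exact: (gtangent_changeK ac (chart_at_atlas q) cq (chart_at_dom q)).
exists W', s; split => //.
- by move=> q /W'sub [].
- apply: (gtangent_smooth_of_chart ac oW' W'c).
  have oI : open (chart_map c @` W').
    by have := open_chart_image (c := c) oW'; rewrite (setIidl W'c).
  apply: (@gtangent_csmooth_ext _ _ _ v) => //.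
    by move=> _ [q [cq _] <-]; rewrite sE.
  move=> j; have [s1 s2] := vs j.
  by split; [apply: csmooth_on_sub s1|apply: csmooth_on_sub s2] => _ [q [_ O'q] <-].
move=> q W'q; have [Wq W1q] := W'sub q W'q; have [cq O'q] := W'q.
set x := chart_map c q in O'q.
have aq := chart_at_atlas q; have dq := chart_at_dom q.
pose T := forms_change (chart_at q) c q.
have TZ k' z : T (k' *: z) = k' *: T z by exact: linearZ.
have Tinj : injective T by exact: can_inj (forms_changeK aq ac dq cq).
have Tr : T (rho q) = r x := esym (forms_inE rho cq).
have Tal : T (ext_d rho q) = al x.
  exact: (eq_trans (esym (forms_inE _ cq)) (ext_d_in ac cq oW Wq rs)).
have [rqU rq0] := rU q Wq.
(* Since r_S does not vanish on O', the sign of rho is (-1)^#|S| at every point of O';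
   [parity_ext_d] needs this constancy. *)
have sgn y : O' y -> forall a, parity (r y) = a *: r y -> a = (-1) ^+ #|S|.
  move=> O'y a /ffunP/(_ S); rewrite ffunE [RHS]ffunE => hS; apply: esym.
  exact: (mulIf (rS0 y O'y) hS).
have prO y : O' y -> parity (r y) = (-1) ^+ #|S| *: r y.
  move=> O'y; have [q' [[Wq' _] cq'] yE] := O'O y O'y.
  have [rU' _] := rU q' Wq'.
  have [a ha] := parity_pure (mL q') (dU q') (LU q') rU'.
  have hy : parity (r y) = a *: r y.
    rewrite -yE /r (forms_inE rho cq') parity_change ha; exact: linearZ.
  by rewrite -(sgn y O'y a hy).
apply: (spinor_solution (mL q) (dU q) (LU q) rqU rq0).
  move=> a ha; apply: Tinj.
  have hx : parity (r x) = a *: r x.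
    rewrite -Tr; apply: (eq_trans (parity_change _ _ _ _)).
    by rewrite ha; exact: TZ.
  have hal := parity_ext_d oO' O'q prO.
  have l := esym (parity_change (chart_at q) c q (ext_d rho q)).
  have l' : parity (T (ext_d rho q)) = parity (al x) := congr1 (@parity _ _) Tal.
  have rr : T (- a *: ext_d rho q) = - a *: al x := eq_trans (TZ _ _) (congr1 _ Tal).
  apply: (eq_trans l); apply: (eq_trans l'); apply: (eq_trans _ (esym rr)).
  by rewrite (sgn x O'q a hx); exact: hal.
move=> u uL.
have ce i : clifford (e i q) (ext_d rho q) = (2 * inner (e i q) (s q)) *: rho q.
  have eL : e i q \in L q.
    by apply: (basis_mem (eb q W1q)); apply/tnthP; exists i; rewrite tnth_mktuple.
  have [k' hk] := frame_coefficient cond tr Wq eL.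
  rewrite hk; congr (_ *: _).
  have eiE : gtangent_change (chart_at q) c q (e i q) = ei i x := esym (gtangent_inE (e i) cq).
  have vE : gtangent_change (chart_at q) c q (s q) = v x.
    exact: (eq_trans (esym (gtangent_inE s cq)) (sE q cq)).
  have h1 : clifford (ei i x) (al x) = k' *: r x.
    have := clifford_change (e i q) (ext_d rho q) aq ac dq cq.
    by rewrite eiE -/T Tal hk TZ Tr.
  have h2 : inner (e i q) (s q) = inner (ei i x) (v x).
    have := inner_change (e i q) (s q) aq ac dq cq.
    by rewrite eiE vE.
  apply: esym; apply: (eq_trans (congr1 ( *%R 2) h2)); apply: (eq_trans (hv x O'q i)).
  apply: (eq_trans (congr1 (fun z : forms R n => z S / r x S) h1)).
  by rewrite ffunE; exact: (mulfK (rS0 x O'q)).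
have uS : u \in <<mktuple (fun i => e i q)>>%VS by rewrite (span_basis (eb q W1q)).
rewrite (coord_span uS) clifford_suml inner_suml mulr_sumr scaler_suml.
apply: eq_bigr => i _; rewrite nth_mktuple cliffordZl ce innerZl scalerA.
by rewrite mulrCA.
Qed.

End LocalSolution.

(** * Gluing local solutions *)

Section Gluing.
Context {R : realType} {n : nat} {M : smoothManifold R n}.
Local Notation C := R[i].
Implicit Types (p q : M) (W : set M).

(** Lindelof's argument: for each member of a countable base contained in some V p, one such p is
    kept. *)
Lemma countable_subcover W (V : M -> set M) p0 : W p0 ->
  (forall p, W p -> open (V p) /\ V p p) ->
  exists u : nat -> M, (forall k, W (u k)) /\ forall q, W q -> exists k, V (u k) q.
Proof.
move=> Wp0 hV; have [B cB bB] := @manifold_second_countable _ _ M.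
have /countable_injP[g ginj] := cB.
pose P k p := W p /\ exists b, [/\ B b, g b = k & b `<=` V p].
(* The point p0 is the default when the index k codes no suitable member of the base; it keeps every
   u k in W. *)
have hu k : exists p, W p /\ ((exists p', P k p') -> P k p).
  have [[p Pp]|np] := pselect (exists p', P k p').
    by exists p; split => //; exact: Pp.1.
  by exists p0; split.
have [u hu'] := choice hu.
exists u; split; first by move=> k; exact: (hu' k).1.
move=> q Wq; have [oV Vq] := hV q Wq.
have [b [Bb bq] bV] := bB.2 q (V q) (open_nbhs_nbhs (conj oV Vq)).
have [_ [b' [Bb' gb' b'V]]] : P (g b) (u (g b)).
  by apply: (hu' (g b)).2; exists q; split => //; exists b.
exists (g b); apply: b'V; have -> // : b' = b.
by apply: ginj => //; rewrite inE.
Qed.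

Lemma fun_smoothM1B W (f g : M -> C) : open W -> fun_smooth W f -> fun_smooth W g ->
  fun_smooth W (fun q => f q * (1 - g q)).
Proof.
move=> oW fs gs c ac; have oI := open_chart_image (c := c) oW.
apply: (csmooth_onM oI); first exact: fs.
apply: (csmooth_onD oI); first exact: csmooth_on_cst.
exact: (csmooth_onN oI (gs c ac)).
Qed.

(* On V k only the first k+1 terms of the series below are non zero, and the
   weights psi_k * phi_k add up to 1. *)
Lemma glue_solutions W (r al : M -> forms R n) : open W ->
  (forall p, W p -> exists W' (s : M -> gtangent R n),
    [/\ open W', W' p, W' `<=` W, gtangent_smooth W' s &
      forall q, W' q -> al q = clifford (s q) (r q)]) ->
  exists s, gtangent_smooth W s /\ forall q, W q -> al q = clifford (s q) (r q).
Proof.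
move=> oW loc; have [[p0 Wp0]|nW] := pselect (exists p, W p); last first.
  exists (fun=> 0); split; first exact: gtangent_smooth0.
  by move=> q Wq; case: nW; exists q.
(* D bundles a cut-off solution phi s, the bump function phi, and the neighbourhood where phi = 1.
   The cut-off solution acts on r as phi al on the whole of W. *)
have loc1 p : exists D : (M -> gtangent R n) * (M -> C) * set M, W p ->
    [/\ fun_smooth W D.1.2, gtangent_smooth W D.1.1, open D.2 /\ D.2 p,
       (forall q, D.2 q -> D.1.2 q = 1) &
       forall q, W q -> clifford (D.1.1 q) (r q) = D.1.2 q *: al q].
  have [Wp|nWp] := pselect (W p); last by exists (fun=> 0, fun=> 0, set0).
  have [W' [s [oW' W'p WW ss hs]]] := loc p Wp.
  have [phi bphi] := bump_manifold oW' W'p.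
  have [V [K [phis [oV Vp] phi1 [cK KW] phi0]]] := bphi.
  exists (fun q => phi q *: s q, phi, V) => _; split => //=.
  - exact: fun_smooth_sub phis.
  - by apply: gtangent_smooth_sub (gtangent_smooth_extend oW' bphi ss).
  - move=> q Wq; rewrite cliffordZl.
    have [W'q|nW'q] := pselect (W' q); first by rewrite -hs.
    by rewrite phi0 ?scale0r // => /KW.
have [D hD] := choice loc1.
have [|u [Wu cov]] := @countable_subcover W (fun p => (D p).2) p0 Wp0.
  by move=> p /hD [].
pose phi k := (D (u k)).1.2; pose sig k := (D (u k)).1.1; pose V k := (D (u k)).2.
have hphi k : fun_smooth W (phi k) by have [] := hD _ (Wu k).
have hsig k : gtangent_smooth W (sig k) by have [] := hD _ (Wu k).
have hV k : open (V k) by have [_ _ []] := hD _ (Wu k).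
have hphi1 k q : V k q -> phi k q = 1 by have [_ _ _ h _] := hD _ (Wu k); exact: h.
have hsol k q : W q -> clifford (sig k q) (r q) = phi k q *: al q.
  by have [_ _ _ _ h] := hD _ (Wu k); exact: h.
(* psi k is the product of the 1 - phi i for i < k, so that psi k - psi (k+1) = psi k phi k: the
   weights telescope and the partial sum S k acts on r as (1 - psi k) al. *)
have [psi [psi_0 psi_S]] : exists psi : nat -> M -> C,
    psi 0%N = (fun=> 1) /\ forall k, psi k.+1 = (fun q => psi k q * (1 - phi k q)).
  by exists (fix psi k := if k is k'.+1 then fun q => psi k' q * (1 - phi k' q) else fun=> 1).
have [S [S_0 S_S]] : exists S : nat -> M -> gtangent R n,
    S 0%N = (fun=> 0) /\ forall k, S k.+1 = (fun q => S k q + psi k q *: sig k q).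
  by exists (fix S k := if k is k'.+1 then fun q => S k' q + psi k' q *: sig k' q else fun=> 0).
have psis k : fun_smooth W (psi k).
  elim: k => [|k IH]; first by rewrite psi_0; exact: fun_smooth_cst.
  by rewrite psi_S; exact: fun_smoothM1B.
have Ss k : gtangent_smooth W (S k).
  elim: k => [|k IH]; first by rewrite S_0; exact: gtangent_smooth0.
  rewrite S_S; apply: (gtangent_smoothD oW IH); exact: gtangent_smoothZ.
have Ssol k q : W q -> clifford (S k q) (r q) = (1 - psi k q) *: al q.
  move=> Wq; elim: k => [|k IH]; first by rewrite S_0 psi_0 clifford0l subrr scale0r.
  rewrite S_S psi_S cliffordDl IH cliffordZl (hsol k q Wq) scalerA -scalerDl.
  by congr (_ *: _); ring.
(* The factor 1 - phi m enters at index m + 1 and vanishes on V m. This takes the place of local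
   finiteness. *)
have psi0 m i q : V m q -> psi (i + m.+1)%N q = 0.
  move=> Vq; elim: i => [|i IH]; first by rewrite add0n psi_S (hphi1 m q Vq) subrr mulr0.
  by rewrite addSn psi_S IH mul0r.
have Sstab m i q : V m q -> S (i + m.+1)%N q = S m.+1 q.
  move=> Vq; elim: i => [//|i IH].
  by rewrite addSn S_S IH (psi0 m i q Vq) scale0r addr0.
have cov' q : exists m, W q -> V m q.
  have [Wq|nWq] := pselect (W q); last by exists 0%N.
  by have [m Vm] := cov q Wq; exists m.
(* N is an arbitrary choice of index; the partial sums are stationary, so any other index m with q
   in V m gives the same value, and smoothness follows. *)
have [N hN] := choice cov'.
have sE m q : W q -> V m q -> S m.+1 q = S (N q).+1 q.
  move=> Wq Vq; have VN := hN q Wq.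
  by rewrite -(Sstab m (N q).+1 q Vq) addnC (Sstab (N q) m.+1 q VN).
exists (fun q => S (N q).+1 q); split.
  apply: gtangent_smooth_local => q Wq.
  have oV : open (W `&` V (N q)) by apply: openI.
  exists (W `&` V (N q)); split; first by split => //; exact: hN.
  apply: (gtangent_smooth_ext oV (A := S (N q).+1)).
    by move=> q' [Wq' Vq']; exact: sE.
  by apply: gtangent_smooth_sub (Ss (N q).+1); exact: subIsetl.
move=> q Wq; rewrite (Ssol _ q Wq).
by rewrite (psi0 (N q) 0%N q (hN q Wq)) subr0 scale1r.
Qed.

End Gluing.

(** * Global sections of U and the theorem *)

Section Global.
Context {R : realType} {n : nat} {M : smoothManifold R n}.
Local Notation C := R[i].
Context {L : M -> {vspace gtangent R n}} {U : M -> {vspace forms R n}}.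
Hypotheses (hL : almost_dirac L) (hU : pure_spinor_line L U).
Implicit Types (p q : M) (W : set M) (rho w : M -> forms R n).

Lemma open_neq0 W w p : open W -> forms_smooth W w -> W p -> w p != 0 ->
  exists W', [/\ open W', W' p, W' `<=` W & forall q, W' q -> w q != 0].
Proof.
move=> oW ws Wp wp0; pose c := chart_at p; have cp : chart_dom c p := chart_at_dom p.
have ac : atlas c := chart_at_atlas p.
have [S wS] : exists S, w p S != 0.
  apply: contrapT => /forallNP h; move/eqP: wp0; apply.
  by apply/ffunP => S; rewrite [RHS]ffunE; apply/eqP/negPn/negP; exact: h.
have oI := open_chart_image (c := c) oW.
have oO := csmooth_open_neq0 oI (ws c ac S).
exists (chart_dom c `&` chart_map c @^-1`
  ((chart_map c @` (W `&` chart_dom c)) `&` [set x | forms_in c w x S != 0])); split.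
- exact: open_chart_preimage.
- split => //; split; first by exists p.
  by rewrite /= (_ : forms_in c w _ = w p) //; exact: forms_in_at.
- by move=> q [cq [[q' [Wq' cq'] e] _]]; rewrite -(chart_mapK cq) -e (chart_mapK cq').
move=> q [cq [_ /= h]]; apply: contra h => /eqP wq0.
have -> : forms_in c w (chart_map c q) = 0.
  apply: (eq_trans (forms_inE w cq)); rewrite wq0; exact: linear0.
by rewrite ffunE.
Qed.

Lemma ext_dD W w w' p : open W -> W p -> forms_smooth W w -> forms_smooth W w' ->
  ext_d (fun q => w q + w' q) p = ext_d w p + ext_d w' p.
Proof.
move=> oW Wp ws ws'; have ac := chart_at_atlas p; have cp := chart_at_dom p.
have I := imgI Wp cp.
have dw := forms_csmooth_diff (ws _ ac) I; have dw' := forms_csmooth_diff (ws' _ ac) I.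
rewrite /ext_d !ext_d_coordE -big_split /=; apply: eq_bigr => j _.
rewrite -cliffordDr; congr (clifford _ _); apply/ffunP => S; rewrite ffunE [RHS]ffunE !ffunE.
under eq_fun do rewrite forms_inD ffunE.
exact: (cpartialD j (dw S) (dw' S)).
Qed.

(** Where w does not vanish, w is itself a trivialization. Where w p = 0, the sections tau and w +
    tau are both trivializations near p with the same value at p, and the difference of their
    solutions gives dw = (v2 - v1) tau at p. *)
Lemma spinor_condition_global : @spinor_condition _ _ _ L U ->
  forall w, forms_section (U0 U) w -> forms_section (U1 U) (ext_d w).
Proof.
move=> cond w [ws wU]; split; first exact: forms_smooth_ext_d openT ws.
move=> p; have [W [tau [tr Wp]]] := exists_trivialization hU p.
have [oW ts tU] := tr.
have sol W' rho : local_trivialization U W' rho -> W' p ->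
    exists v, ext_d rho p = clifford v (rho p).
  move=> tr' W'p; have [W'' [s [_ W''p _ _ hs]]] := local_solution hL hU cond tr' W'p.
  by exists (s p); exact: hs.
have wsW : forms_smooth W w by apply: forms_smooth_sub ws.
have triv w' : forms_smooth W w' -> (forall q, W q -> w' q \in U q) -> w' p != 0 ->
    exists v, ext_d w' p = clifford v (w' p).
  move=> w's w'U w'p0; have [W' [oW' W'p WW h]] := open_neq0 oW w's Wp w'p0.
  apply: (sol W') => //; split => //; first exact: forms_smooth_sub w's.
  by move=> q W'q; split; [exact: w'U (WW q W'q) | exact: h].
have [wp0|wp0] := eqVneq (w p) 0; last first.
  have [v hv] := triv w wsW (fun q _ => wU q) wp0.
  by exists v, (w p); split => //; exact: wU.
have [v1 h1] := sol W tau tr Wp.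
have [|||v2 h2] := triv (fun q => w q + tau q).
- exact: forms_smoothD.
- by move=> q Wq; apply: memvD; [exact: wU | exact: (tU q Wq).1].
- by rewrite wp0 add0r; exact: (tU p Wp).2.
exists (v2 - v1), (tau p); split; first exact: (tU p Wp).1.
have hD := ext_dD oW Wp wsW ts.
rewrite wp0 add0r in h2; rewrite cliffordBl -h1 -h2 hD.
by rewrite addrK.
Qed.

End Global.

Theorem theorem3p38 (R : realType) (n : nat) (M : smoothManifold R n)
    (L : M -> {vspace gtangent R n}) (U : M -> {vspace forms R n})
    (hL : almost_dirac L) (hU : pure_spinor_line L U) :
  (courant_involutive L <->
     forall w : M -> forms R n,
       forms_section (U0 U) w -> forms_section (U1 U) (ext_d w)) /\
  (courant_involutive L <->
     forall (W : set M) (rho : M -> forms R n),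
       local_trivialization U W rho ->
       exists s : M -> gtangent R n,
         gtangent_smooth W s /\
         forall p, W p ->
           ext_d rho p = interior_product (s p).1 (rho p)
                         + wedge1 (s p).2 (rho p)).
Proof.
have inv_cond := involutive_spinor_condition hL hU.
have cond_inv := spinor_condition_involutive hL hU.
split; split=> [inv|glob].
- exact: spinor_condition_global hL hU (inv_cond inv).
- exact: cond_inv (global_spinor_condition hU glob).
(* The equation d rho = s rho is linear in s for fixed rho, so weights of sum 1 glue local
   solutions. *)
- move=> W rho tr; apply: (glue_solutions (r := rho) (al := ext_d rho)); first by have [] := tr.
  by move=> p Wp; exact: (local_solution hL hU (inv_cond inv) tr Wp).
(* Conversely d rho = s rho gives L L d rho = 0 at each point, by [clifford_isotropic]. *)
apply: cond_inv => W rho p tr Wp u v uL vL.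
have [s [_ hs]] := glob W rho tr; have e : ext_d rho p = clifford (s p) (rho p) := hs p Wp.
have [_ _ rU] := tr; rewrite e.
exact: (clifford_isotropic hU (s p) uL vL (rU p Wp).1).
Qed.
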